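(* For a generic smooth function $\Psi:\mathbb{R}^3\times\mathbb{R}\to\mathbb{C}$, $(x,y,z,t)\mapsto\Psi(x,y,z,t)$, the following holds. At any point and any moment $(x_0,y_0,z_0,t_0)$ with $\Psi(x_0,y_0,z_0,t_0)=0$, the phase singularity of $\Psi$ at $(x_0,y_0,z_0,t_0)$ is radially equivalent to one of the following functions at the origin $(x,y,z)=(0,0,0)$: (R, regular singularity) $\psi(x,y,z)=x+\mathrm{i}y$; (DH, definite hyperbolic singularity) $\psi(x,y,z)=x^2+y^2-z^2+\mathrm{i}z$; (DE, definite elliptic singularity) $\psi(x,y,z)=x^2+y^2+z^2+\mathrm{i}z$; (I, indefinite singularity) $\psi(x,y,z)=x^2-y^2-z^2+\mathrm{i}z$.
   Context: Smooth means $C^\infty$; $\mathbb{C}$ is identified with $\mathbb{R}^2$ via $u+\mathrm{i}w=(u,w)$. ''Generic'' means: for all $\Psi$ in a residual subset of $C^\infty(\mathbb{R}^3\times\mathbb{R},\mathbb{C})$ in the Whitney $C^\infty$ topology. A radial transformation near $0\in\mathbb{C}$ is a local diffeomorphism $\tau:(\mathbb{C},0)\to(\mathbb{C},0)$, $\tau(u,w)=(U,W)$, sending each radial line (ray) $\{\theta=\mathrm{const.}\}$ to a radial line, where $u+\mathrm{i}w=re^{\mathrm{i}\theta}$; equivalently $U=\rho(u,w)(au+bw)$, $W=\rho(u,w)(cu+dw)$ with $\rho$ a positive function and $a,b,c,d\in\mathbb{R}$, $ad-bc\neq0$. The phase singularity of $\Psi$ at $(x_0,y_0,z_0,t_0)$,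 where $\Psi$ vanishes, is the germ at $(x_0,y_0,z_0)$ of $\Psi(\cdot,\cdot,\cdot,t_0)$ considered up to radial equivalence. It is radially equivalent to $\psi(x,y,z)$ at the origin if there are a local diffeomorphism $\sigma$ of $\mathbb{R}^3$ with $\sigma(0,0,0)=(x_0,y_0,z_0)$ and a local radial transformation $\tau$ near $0\in\mathbb{C}$ such that $\Psi(\sigma(x,y,z),t_0)=\tau(\psi(x,y,z))$ near the origin. *)

(* Defs.v *)
From HB Require Import structures.
From mathcomp Require Import all_boot all_order all_algebra.
From mathcomp Require Import all_classical all_reals all_analysis.

Set Implicit Arguments.
Unset Strict Implicit.
Unset Printing Implicit Defensive.

Import Order.TTheory GRing.Theory Num.Theory.
Import numFieldNormedType.Exports.

Local Open Scope classical_set_scope.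
Local Open Scope ring_scope.

Section smooth_maps.
Context {R : realType} {V W : normedModType R}.

Definition iter_derive (vs : seq V) (f : V -> W) : V -> W :=
  foldr (fun v g => 'D_v g) f vs.

(* Meant for open A: every iterated directional derivative of f exists and is
   differentiable (hence continuous) at the points of A. *)
Definition smooth_on (A : set V) (f : V -> W) : Prop :=
  forall (vs : seq V) (x : V), A x -> differentiable (iter_derive vs f) x.

End smooth_maps.

(* The germ at a of a total function f is a diffeomorphism germ
   (V, a) -> (W, b); the values of f away from a are irrelevant. *)
Definition local_diffeo (R : realType) (V W : normedModType R)
    (f : V -> W) (a : V) (b : W) : Prop :=
  f a = b /\
  exists (g : W -> V) (A : set V) (B : set W),
    [/\ open A /\ A a, open B /\ B b,
        (forall x, A x -> B (f x) /\ g (f x) = x),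
        (forall y, B y -> A (g y) /\ f (g y) = y)
      & smooth_on A f /\ smooth_on B g].

Section jets.
Context {R : realType} {n : nat} {W : normedModType R}.

Definition partial (a : 'I_n -> nat) (f : 'rV[R]_n -> W) : 'rV[R]_n -> W :=
  iter_derive (flatten [seq nseq (a i) (delta_mx 0 i) | i <- enum 'I_n]) f.

End jets.

Notation multi_index n k :=
  {a : {ffun 'I_n -> 'I_k.+1} | (\sum_(i < n) a i <= k)%N}.

(* J^k(R^n, W), with the jet of f at x recorded as x together with all the
   partial derivatives of f at x of order at most k, f x included. *)
Notation jet_space R n W k :=
  ('rV[R]_n * 'rV[W]_#|{: multi_index n k}|)%type.

Definition jet (R : realType) (n : nat) (W : normedModType R) (k : nat)
    (f : 'rV[R]_n -> W) (x : 'rV[R]_n) : jet_space R n W k :=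
  (x, \row_i partial (fun j => val (enum_val i : multi_index n k) j) f x).

Record smooth_map (R : realType) (n : nat) (W : normedModType R) := SmoothMap {
  smooth_map_fun :> 'rV[R]_n -> W;
  _ : smooth_on setT smooth_map_fun
}.

HB.instance Definition _ (R : realType) (n : nat) (W : normedModType R) :=
  gen_eqMixin (smooth_map n W).
HB.instance Definition _ (R : realType) (n : nat) (W : normedModType R) :=
  gen_choiceMixin (smooth_map n W).

Section jet_restriction.
Context {R : realType} {n : nat} {W : normedModType R} (k m : nat).
Hypothesis km : (k <= m)%N.

Let widen (a : {ffun 'I_n -> 'I_k.+1}) : {ffun 'I_n -> 'I_m.+1} :=
  [ffun i => widen_ord (km : (k.+1 <= m.+1)%N) (a i)].

Let widen_subproof (a : multi_index n k) :
  (\sum_(i < n) widen (val a) i <= m)%N.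
Proof.
rewrite (eq_bigr (fun i => val a i : nat)); last by move=> i _; rewrite ffunE.
exact: leq_trans (valP a) km.
Qed.

Definition widen_multi_index (a : multi_index n k) : multi_index n m :=
  exist _ (widen (val a)) (widen_subproof a).

Definition restrict_jet (p : jet_space R n W m) : jet_space R n W k :=
  (p.1, \row_i p.2 0 (enum_rank (widen_multi_index (enum_val i)))).

Lemma restrict_jetE (f : 'rV[R]_n -> W) (x : 'rV[R]_n) :
  restrict_jet (jet m f x) = jet k f x.
Proof.
rewrite /restrict_jet /jet /=; congr pair; apply/rowP => i; rewrite !mxE.
rewrite enum_rankK /partial; congr iter_derive; congr flatten.
by apply: eq_map => j /=; rewrite ffunE.
Qed.

Lemma restrict_jet_continuous : continuous restrict_jet.
Proof.
move=> [x v] P [[P1 P2] /= [xP1 [Q vQ QP2]] PP].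
pose idx (i : 'I_#|{: multi_index n k}|) :=
  enum_rank (widen_multi_index (enum_val i)).
exists (P1, [set u : 'rV[W]_#|{: multi_index n m}| |
             forall i, Q 0 i (u 0 (idx i))]); last first.
  move=> [y u] /= [P1y Qu]; apply: PP; split=> //=; apply: QP2 => i j.
  by rewrite (ord1 i) mxE; exact: Qu.
split=> //=.
apply: (@filter_forall _ _
  (fun i (u : 'rV[W]_#|{: multi_index n m}|) => Q 0 i (u 0 (idx i)))
  (nbhs v) _ _) => i.
exists (fun _ j => [set w | j = idx i -> Q 0 i w]).
  move=> a j; case: (eqVneq j (idx i)) => [->|jl]; last first.
    by apply: filterE => w /= jl'; rewrite jl' eqxx in jl.
  have := vQ 0 i; rewrite mxE (ord1 a); apply: filterS => w /= Qw _; exact: Qw.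
by move=> u /(_ 0 (idx i)); apply.
Qed.

End jet_restriction.

Section whitney_topology.
Context {R : realType} {n : nat} {W : normedModType R}.
Local Notation T := (smooth_map n W).

Definition whitney_basis (B : set T) : Prop :=
  exists (k : nat) (U : set (jet_space R n W k)),
    open U /\ B = [set f : T | forall x, U (jet k f x)].

Definition whitney_open (O : set T) : Prop :=
  forall f, O f -> exists B, [/\ whitney_basis B, B f & B `<=` O].

Lemma whitney_basisI (A B : set T) :
  whitney_basis A -> whitney_basis B -> whitney_basis (A `&` B).
Proof.
move=> [k [U [Uo ->]]] [l [U' [Uo' ->]]].
have kM := leq_maxl k l; have lM := leq_maxr k l.
exists (maxn k l),
  (restrict_jet kM @^-1` U `&` restrict_jet lM @^-1` U'); split.
  by apply: openI; apply: open_comp => // p _; exact: restrict_jet_continuous.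
apply/seteqP; split=> f /=.
  by move=> [Uf Uf'] x; rewrite !restrict_jetE.
by move=> h; split=> x; have := h x; rewrite !restrict_jetE => -[].
Qed.

Lemma whitney_openT : whitney_open setT.
Proof.
move=> f _; exists setT; split=> //; exists 0%N, setT; split; first exact: openT.
by apply/seteqP; split.
Qed.

Lemma whitney_openI : setI_closed whitney_open.
Proof.
move=> A B oA oB f [/oA [A' [bA A'f sA]] /oB [B' [bB B'f sB]]].
exists (A' `&` B'); split=> //; first exact: whitney_basisI.
exact: setISS.
Qed.

Lemma whitney_open_bigU (I : Type) (F : I -> set T) :
  (forall i, whitney_open (F i)) -> whitney_open (\bigcup_i F i).
Proof.
move=> oF f [i _ /oF [B [bB Bf BF]]]; exists B; split=> // g /BF Fg.
by exists i.
Qed.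

HB.instance Definition _ := isOpenTopological.Build T
  whitney_openT whitney_openI whitney_open_bigU.

End whitney_topology.

Definition residual (T : topologicalType) (A : set T) : Prop :=
  exists U : nat -> set T,
    (forall i, open (U i) /\ dense (U i)) /\ \bigcap_i U i `<=` A.

Definition generically (T : topologicalType) (P : T -> Prop) : Prop :=
  exists2 A : set T, residual A & forall x, A x -> P x.

(* The complex number u + iw is the pair (u, w) : R * R. *)

Definition ray (R : realType) (theta : R) : set (R * R) :=
  [set z | exists2 r, 0 < r & z = (r * cos theta, r * sin theta)].

(* As tau is a germ, rays are only considered inside a neighbourhood of 0. *)
Definition radial_transformation (R : realType) (tau : R * R -> R * R) : Prop :=
  local_diffeo tau 0 0 /\
  exists2 N : set (R * R), nbhs (0 : R * R) N &
    forall theta : R, exists theta' : R,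
      tau @` (N `&` ray theta) `<=` ray theta'.

(* The germ of f at p is radially equivalent to the germ of psi at 0. *)
Definition radially_equivalent (R : realType) (f : 'rV[R]_3 -> R * R)
    (p : 'rV[R]_3) (psi : 'rV[R]_3 -> R * R) : Prop :=
  exists (sigma : 'rV[R]_3 -> 'rV[R]_3) (tau : R * R -> R * R),
    [/\ local_diffeo sigma 0 p, radial_transformation tau
      & \forall q \near (0 : 'rV[R]_3), f (sigma q) = tau (psi q)].

Section normal_forms.
Context {R : realType}.
Implicit Type p : 'rV[R]_3.
Local Notation x p := (p 0 0).
Local Notation y p := (p 0 1).
Local Notation z p := (p 0 2%:R).

Definition regular_form p : R * R := (x p, y p).

Definition definite_hyperbolic_form p : R * R :=
  (x p ^+ 2 + y p ^+ 2 - z p ^+ 2, z p).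

Definition definite_elliptic_form p : R * R :=
  (x p ^+ 2 + y p ^+ 2 + z p ^+ 2, z p).

Definition indefinite_form p : R * R :=
  (x p ^+ 2 - y p ^+ 2 - z p ^+ 2, z p).

End normal_forms.

(* R^3 x R is 'rV_(3 + 1), the last coordinate being the time. *)
Definition at_time (R : realType) (Psi : 'rV[R]_(3 + 1) -> R * R) (t : R) :
    'rV[R]_3 -> R * R :=
  fun p => Psi (row_mx p t%:M).

(* Main.v *)
Require Import Defs.
From HB Require Import structures.
From mathcomp Require Import all_boot all_order all_algebra.
From mathcomp Require Import all_classical all_reals all_analysis.
From mathcomp Require Import ring lra.

Set Implicit Arguments.
Unset Strict Implicit.
Unset Printing Implicit Defensive.

Import Order.TTheory GRing.Theory Num.Theory.
Import numFieldNormedType.Exports.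

Local Open Scope classical_set_scope.
Local Open Scope ring_scope.

(** Let f be the restriction of Psi to a fixed time, and p a zero of f. If the
    differentials of the two components of f are independent at p, the inverse
    function theorem gives the form (R). Otherwise a combination u of the
    components is critical at p; let w be the other component. Suppose that the
    Hessian H of u at p is nondegenerate, and so is its restriction to the kernel
    of dw. Then dw is not 0, and in suitable linear coordinates H is diagonal and
    dw = dz (adapted_basis); taking w itself as the third coordinate, w = z
    (germ_form). For each z near 0 the function u has a nondegenerate critical
    point in the plane of height z. When these points have been moved to the third
    axis, Hadamard's lemma gives

      u = x^2 a + x y b + y^2 c + z^2 h(z),  with a, c, h nonzero and b = 0 at 0,

    and the first three terms are two squares up to signs. The function h is a
    genuine obstruction to a normal form under changes of coordinates that keep
    w = z, but the map (u, w) -> |h(w)| (u, w) is a radial transformation. In the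
    coordinates where |h(z)| z is the new z, it replaces u by a sum of three
    squares with signs (fold_form). Changing u into - u and exchanging x and y
    leaves the three forms (DH), (DE) and (I) (classification).

    It remains to see that the exceptional situation does not occur for generic
    Psi. At a degenerate zero, for one of the two choices of w, some real lambda
    makes u = f_c + lambda w critical and det H times the determinant of H on the
    kernel of dw is 0. These are six equations on the point x of space-time and
    lambda, five unknowns. The functions Psi for which they have no solution with
    |x| <= n and |lambda| <= n form an open set, since the equations concern 2-jets
    and lambda lies in a compact interval (open_avoids_degeneracy).

    This set is also dense (dense_avoids_degeneracy). Perturb the components by
    b0 + a.x + s |x|^2 / 2 and b + s x_0, functions of the position in space which
    are cut off outside a ball (small_perturbation). If (x, lambda) is a solution
    for the perturbed components, then the first five equations determine
    (a, b, b0) as a Lipschitz function of (x, lambda), for given s, while the last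
    one is a monic equation of degree 7 in s. A count of small cubes, which
    replaces the theorem of Sard, shows that some small (s, a, b, b0) does not
    arise in this way (avoid_lipschitz_family). *)

(** * Differentiability and smoothness *)

Section differentiability.
Context {R : realType} {V W : normedModType R}.
Implicit Types (f g : V -> W) (a v : V).

Lemma differentiable_epsP f a : differentiable f a <->
  exists2 df : {linear V -> W}, continuous df &
    forall e, 0 < e -> \forall h \near 0, `|f (h + a) - f a - df h| <= e * `|h|.
Proof.
split=> [df|[df dfc dfE]].
  exists ('d f a); first exact: diff_continuous.
  have [_ /eqaddoP E] := (diff_locallyP a f).1 df.
  move=> e e0; have := E e e0; apply: filterS => h /=.
  by rewrite !fctE /= opprD addrA.
have E : f \o shift a = cst (f a) + df +o_ 0 id.
  apply/eqaddoP => e e0; have := dfE e e0; apply: filterS => h /=.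
  by rewrite !fctE /= opprD addrA.
by apply/diff_locallyP; rewrite (diff_unique dfc E).
Qed.

Lemma diff_eps f a : differentiable f a ->
  forall e, 0 < e -> \forall h \near 0, `|f (h + a) - f a - 'd f a h| <= e * `|h|.
Proof.
move=> /diff_locallyP[_ /eqaddoP E] e e0; have := E e e0; apply: filterS => h /=.
by rewrite !fctE /= opprD addrA.
Qed.

Lemma diff_eps_unique f a (df : {linear V -> W}) : continuous df ->
    (forall e, 0 < e -> \forall h \near 0, `|f (h + a) - f a - df h| <= e * `|h|) ->
  'd f a = df :> (V -> W).
Proof.
move=> dfc dfE; apply: diff_unique => //.
apply/eqaddoP => e e0; have := dfE e e0; apply: filterS => h /=.
by rewrite !fctE /= opprD addrA.
Qed.

Lemma near_eq_differentiable f g a : (\near a, f a = g a) ->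
  differentiable f a -> differentiable g a.
Proof.
move=> fg /differentiable_epsP[df dfc dfE].
apply/differentiable_epsP; exists df => // e e0.
have fga := nbhs_singleton fg.
have fgh : \forall h \near 0, f (h + a) = g (h + a).
  have /(@nbhs0P _ _ (fun x => f x = g x)) := fg.
  by apply: filterS => h; rewrite addrC.
near=> h; rewrite -fga -(near fgh h)//.
by near: h; exact: dfE.
Unshelve. all: by end_near. Qed.

End differentiability.

Section Cn.
Context {R : realType}.
Implicit Types V W : normedModType R.

(** Smoothness speaks of all iterated derivatives at once; in this version of
    finite order its closure properties can be proved by induction on the order. *)
Fixpoint Cn V W (k : nat) (A : set V) (f : V -> W) : Prop :=
  if k is k'.+1 then
    (forall x, A x -> differentiable f x) /\ (forall v, Cn k' A ('D_v f))
  else True.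

Lemma CnS V W k A (f : V -> W) : Cn k.+1 A f <->
  (forall x, A x -> differentiable f x) /\ (forall v, Cn k A ('D_v f)).
Proof. by []. Qed.

Lemma CnS_diff V W k A (f : V -> W) x : Cn k.+1 A f -> A x -> differentiable f x.
Proof. by move=> [+ _]; exact. Qed.

Lemma CnS_derive V W k A (f : V -> W) v : Cn k.+1 A f -> Cn k A ('D_v f).
Proof. by move=> [_ ]; exact. Qed.

Local Arguments Cn : simpl never.

Lemma iter_derive_rcons V W (f : V -> W) vs v :
  iter_derive (rcons vs v) f = iter_derive vs ('D_v f).
Proof. by rewrite /iter_derive foldr_rcons. Qed.

Lemma smooth_onD V W A (f : V -> W) v : smooth_on A f -> smooth_on A ('D_v f).
Proof. by move=> sf vs x Ax; rewrite -iter_derive_rcons; exact: sf. Qed.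

Lemma smooth_onP V W A (f : V -> W) : smooth_on A f <-> forall k, Cn k A f.
Proof.
split=> [sf k|].
  elim: k f sf => [//|k IH] f sf; split; first exact: (sf [::]).
  by move=> v; apply: IH; exact: smooth_onD.
move=> cf vs; elim/last_ind: vs f cf => [|vs v IH] f cf x Ax.
  exact: (cf 1%N).1.
by rewrite iter_derive_rcons; apply: IH => // k; exact: (cf k.+1).2.
Qed.

Lemma smooth_on_differentiable V W A (f : V -> W) x :
  smooth_on A f -> A x -> differentiable f x.
Proof. by move=> sf; exact: (sf [::]). Qed.

Lemma smooth_on_continuous V W A (f : V -> W) x :
  smooth_on A f -> A x -> {for x, continuous f}.
Proof. by move=> sf Ax; apply/differentiable_continuous/(smooth_on_differentiable sf). Qed.

Lemma smooth_on_sub V W A B (f : V -> W) :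
  B `<=` A -> smooth_on A f -> smooth_on B f.
Proof. by move=> BA sf vs x /BA; exact: sf. Qed.

Lemma CnW V W k A (f : V -> W) : Cn k.+1 A f -> Cn k A f.
Proof.
elim: k f => [//|k IH] f /CnS[df Df]; apply/CnS; split=> // v; exact/IH/Df.
Qed.

Lemma open_near V (A : set V) x : open A -> A x -> \forall y \near x, A y.
Proof. by move=> oA Ax; exact: open_nbhs_nbhs. Qed.

Lemma eq_Cn V W k A (f g : V -> W) : open A -> (forall x, A x -> f x = g x) ->
  Cn k A f -> Cn k A g.
Proof.
move=> oA; elim: k f g => [//|k IH] f g fg /CnS[df Df]; apply/CnS.
have nfg x : A x -> \near x, f x = g x.
  by move=> Ax; apply: filterS (open_near oA Ax) => y; exact: fg.
split=> [x Ax|v]; first exact: near_eq_differentiable (nfg _ Ax) (df _ Ax).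
by apply: IH (Df v) => x Ax; apply: near_eq_derive; exact: nfg.
Qed.

Lemma eq_smooth_on V W A (f g : V -> W) : open A ->
  (forall x, A x -> f x = g x) -> smooth_on A f -> smooth_on A g.
Proof.
by move=> oA fg /smooth_onP sf; apply/smooth_onP => k; exact: eq_Cn (sf k).
Qed.

Lemma Cn_cst V W k A (c : W) : Cn k A (cst c : V -> W).
Proof.
elim: k c => [//|k IH] c; apply/CnS; split=> [x _|v]; first exact: differentiable_cst.
by rewrite (_ : 'D_v _ = cst 0) //; apply/funext => x; rewrite derive_cst.
Qed.

Lemma Cn_lin V W k A (f : {linear V -> W}) : continuous f -> Cn k A f.
Proof.
move=> cf; case: k => [//|k]; apply/CnS; split=> [x _|v]; first exact: linear_differentiable.
rewrite (_ : 'D_v _ = cst (f v)); first exact: Cn_cst.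
apply/funext => x; rewrite deriveE; last exact: linear_differentiable.
by rewrite diff_lin.
Qed.

Lemma CnD V W k A (f g : V -> W) : open A ->
  Cn k A f -> Cn k A g -> Cn k A (f \+ g).
Proof.
move=> oA; elim: k f g => [//|k IH] f g /CnS[df Df] /CnS[dg Dg]; apply/CnS.
split=> [x Ax|v]; first exact: differentiableD (df _ Ax) (dg _ Ax).
apply: (@eq_Cn _ _ _ _ ('D_v f \+ 'D_v g)) => //; last exact: IH.
move=> x Ax; rewrite [RHS]deriveD//.
- exact/diff_derivable/df.
- exact/diff_derivable/dg.
Qed.

Lemma CnM V k A (f g : V -> R) : open A ->
  Cn k A f -> Cn k A g -> Cn k A (f \* g).
Proof.
move=> oA; elim: k f g => [//|k IH] f g Cf Cg.
have /CnS[df Df] := Cf; have /CnS[dg Dg] := Cg; apply/CnS; split=> [x Ax|v]; first exact: differentiableM (df _ Ax) (dg _ Ax).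
apply: (@eq_Cn _ _ _ _ ((f \* 'D_v g) \+ (g \* 'D_v f))) => //; last first.
  by apply: CnD => //; apply: IH => //; first [exact: CnW|exact: Df|exact: Dg].
move=> x Ax; rewrite [RHS]deriveM//.
- exact/diff_derivable/df.
- exact/diff_derivable/dg.
Qed.

Lemma Cn_comp_lin V W (X : normedModType R) k A (f : V -> W) (l : {linear W -> X}) :
  open A -> continuous l -> Cn k A f -> Cn k A (l \o f).
Proof.
move=> oA cl; elim: k f => [//|k IH] f /CnS[df Df]; apply/CnS.
have dl x : differentiable l x by exact: linear_differentiable.
split=> [x Ax|v]; first exact: differentiable_comp (df _ Ax) (dl _).
apply: (@eq_Cn _ _ _ _ (l \o 'D_v f)) => //; last exact: IH.
move=> x Ax; have dfx := df _ Ax.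
rewrite [RHS]deriveE; last exact: differentiable_comp.
by rewrite diff_comp//= diff_lin// -deriveE.
Qed.

Lemma derive_affine V W (X : normedModType R) (f : W -> X) (l : {linear V -> W}) b v x :
  'D_v (fun x => f (l x + b)) x = 'D_(l v) f (l x + b).
Proof.
rewrite /derive.
suff E : (fun h : R => h^-1 *: (((fun x => f (l x + b)) \o shift x) (h *: v) -
    f (l x + b))) =
    (fun h => h^-1 *: ((f \o shift (l x + b)) (h *: l v) - f (l x + b))).
  by rewrite E.
apply/funext => h /=; have -> : l (h *: v + x) = h *: l v + l x by exact: linearP.
by rewrite addrA.
Qed.

Lemma smooth_on_affine V W (X : normedModType R) (B : set W) (f : W -> X)
    (l : {linear V -> W}) b :
  continuous l -> smooth_on B f ->
  smooth_on [set x | B (l x + b)] (fun x => f (l x + b)).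
Proof.
move=> cl sf vs x Bx.
have -> : iter_derive vs (fun x => f (l x + b)) =
          (fun x => iter_derive (map l vs) f (l x + b)).
  by elim: vs => [//|v vs /= ->]; apply/funext => y; rewrite derive_affine.
apply: (@differentiable_comp _ _ _ _ (fun x => l x + b)) (sf _ _ Bx).
apply: differentiableD => //; exact: linear_differentiable.
Qed.

Lemma Cn_opp V k A (f : V -> R) : open A -> Cn k A f -> Cn k A (fun x => - f x).
Proof.
move=> oA Cf; apply: (@eq_Cn _ _ _ _ (cst (-1) \* f)) => //.
  by move=> x _ /=; rewrite mulN1r.
by apply: CnM => //; exact: Cn_cst.
Qed.

Lemma Cn_inv V k A (f : V -> R) : open A -> (forall x, A x -> f x != 0) ->
  Cn k A f -> Cn k A (fun x => (f x)^-1).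
Proof.
move=> oA f0; elim: k => [//|k IH] Cf; have /CnS[df Df] := Cf; apply/CnS.
split=> [x Ax|v]; first by apply: differentiableV; [exact: df|exact: f0].
have Cg : Cn k A (fun x => (f x)^-1) by apply: IH; exact: CnW.
apply: (@eq_Cn _ _ _ _ (fun x => - (((f x)^-1 * (f x)^-1) * 'D_v f x))) => //.
  move=> x Ax; rewrite [RHS]deriveV; [|exact: f0|exact/diff_derivable/df].
  by rewrite /= -expr2 exprVn scaleNr.
apply: Cn_opp => //.
by apply: (@CnM _ _ _ (fun x => (f x)^-1 * (f x)^-1)) => //; exact: CnM.
Qed.

Lemma Cn_sum V W k A (I : Type) (r : seq I) (f : I -> V -> W) : open A ->
  (forall i, Cn k A (f i)) -> Cn k A (fun x => \sum_(i <- r) f i x).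
Proof.
move=> oA Cf; elim: r => [|i r IH].
  by apply: eq_Cn (Cn_cst _ _ 0) => // x _; rewrite big_nil.
by apply: eq_Cn (CnD oA (Cf i) IH) => // x _; rewrite big_cons.
Qed.

Lemma Cn_prod V k A (I : Type) (r : seq I) (f : I -> V -> R) : open A ->
  (forall i, Cn k A (f i)) -> Cn k A (fun x => \prod_(i <- r) f i x).
Proof.
move=> oA Cf; elim: r => [|i r IH].
  by apply: (eq_Cn oA _ (Cn_cst k A (1 : R))) => // x _; rewrite big_nil.
by apply: eq_Cn (CnM oA (Cf i) IH) => // x _; rewrite big_cons.
Qed.

Lemma Cn_sqrt V k A (f : V -> R) : open A -> (forall x, A x -> 0 < f x) ->
  Cn k A f -> Cn k A (fun x => Num.sqrt (f x)).
Proof.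
move=> oA f0; elim: k => [//|k IH] Cf; have /CnS[df Df] := Cf; apply/CnS.
have dsq x : A x -> differentiable (@Num.sqrt R) (f x).
  move=> Ax; apply/derivable1_diffP.
  exact: (@ex_derive _ _ _ _ _ _ _ (is_derive1_sqrt (f0 x Ax))).
split=> [x Ax|v].
  by apply: (@differentiable_comp _ _ _ _ f) => //; [exact: df|exact: dsq].
have Cg : Cn k A (fun x => Num.sqrt (f x)) by apply: IH; exact: CnW.
apply: (@eq_Cn _ _ _ _ (fun x => (2 * Num.sqrt (f x))^-1 * 'D_v f x)) => //.
  move=> x Ax; have dfx := df _ Ax.
  rewrite [RHS]deriveE; last exact: (@differentiable_comp _ _ _ _ f) dfx (dsq _ Ax).
  rewrite (diff_comp dfx (dsq _ Ax))/= deriveE//.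
  have sE := @derive_val _ _ _ _ _ _ _ (is_derive1_sqrt (f0 x Ax)).
  rewrite deriveE in sE; last exact: dsq.
  rewrite -[X in _ = 'd _ _ X]mulr1 -[_ * 1]/('d f x v *: (1 : R)) linearZ /= sE.
  by rewrite [RHS]mulrC.
apply: CnM => //; apply: Cn_inv => //.
  by move=> x Ax; rewrite mulf_neq0// ?pnatr_eq0// gt_eqF// sqrtr_gt0 f0.
by apply: (@CnM _ _ _ (cst 2)) => //; exact: Cn_cst.
Qed.

Definition mklin V W (f : V -> W) (lf : linear f) : {linear V -> W} :=
  HB.pack f (GRing.isLinear.Build R V W *:%R f lf).

Lemma Cn_linear V W k A (f : V -> W) : linear f -> continuous f -> Cn k A f.
Proof. by move=> lf cf; exact: (@Cn_lin _ _ _ _ (mklin lf)). Qed.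

Lemma linear_rV_continuous n W (f : 'rV[R]_n -> W) : linear f -> continuous f.
Proof.
move=> lf; pose F := mklin lf.
have -> : f = fun x => \sum_i x 0 i *: f (delta_mx 0 i).
  apply/funext => x; rewrite -[f]/(F : _ -> _) [in LHS](row_sum_delta x) linear_sum.
  by apply: eq_bigr => i _; rewrite linearZ.
move=> x; apply: (@continuous_big _ _ +%R); [exact: add_continuous|] => i _ y.
have cc : {for y, continuous (fun x0 : 'rV[R]_n => x0 0 i)} by exact: coord_continuous.
by have := @cvgZr_tmp _ _ _ _ _ _ _ (f 'e_i) cc; exact.
Qed.

Lemma Cn_coord n k A i : Cn k A (fun x : 'rV[R]_n => x 0 i).
Proof.
apply: Cn_linear; first by move=> a x y; rewrite !mxE.
exact: coord_continuous.
Qed.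

Lemma Cn_coordP V n k A (g : V -> 'rV[R]_n) : open A ->
  Cn k A g <-> (forall i, Cn k A (fun x => g x 0 i)).
Proof.
move=> oA; split=> [Cg i|Cg].
  have lc : linear (fun x : 'rV[R]_n => x 0 i) by move=> a x y; rewrite !mxE.
  apply: (@Cn_comp_lin _ _ _ _ _ g (mklin lc)) => //; exact: coord_continuous.
apply: (@eq_Cn _ _ _ _ (fun x => \sum_i g x 0 i *: delta_mx 0 i)) => //.
  by move=> x _; rewrite -row_sum_delta.
apply: Cn_sum => // i.
have ls : linear (fun r : R => r *: (delta_mx 0 i : 'rV[R]_n)).
  by move=> a x y; rewrite scalerDl scalerA.
apply: (@Cn_comp_lin _ _ _ _ _ (fun x => g x 0 i) (mklin ls)) => //.
exact: scalel_continuous.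
Qed.

Lemma diff_sum_coord n (f : 'rV[R]_n -> R) a v : differentiable f a ->
  'd f a v = \sum_i v 0 i * 'D_(delta_mx 0 i) f a.
Proof.
move=> df; rewrite [in LHS](row_sum_delta v) linear_sum.
by apply: eq_bigr => i _; rewrite linearZ deriveE.
Qed.

Lemma derive_coord V n (g : V -> 'rV[R]_n) a v i : differentiable g a ->
  'D_v (fun x => g x 0 i) a = ('D_v g a) 0 i.
Proof. by move=> dg; rewrite derive_mx ?mxE//; exact: diff_derivable. Qed.

Lemma derive_comp V n (g : V -> 'rV[R]_n) (f : 'rV[R]_n -> R) a v :
  differentiable g a -> differentiable f (g a) ->
  'D_v (f \o g) a =
    \sum_i 'D_v (fun x => g x 0 i) a * 'D_(delta_mx 0 i) f (g a).
Proof.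
move=> dg df; rewrite deriveE; last exact: differentiable_comp.
rewrite diff_comp//= diff_sum_coord//.
by apply: eq_bigr => i _; rewrite derive_coord// [in RHS]deriveE.
Qed.

(** By the chain rule, order k + 1 for a composite reduces to order k for
    composites of the same kind. *)
Lemma Cn_comp V n k A B (g : V -> 'rV[R]_n) (f : 'rV[R]_n -> R) :
  open A -> (forall x, A x -> B (g x)) -> Cn k A g -> Cn k B f -> Cn k A (f \o g).
Proof.
move=> oA AB; elim: k f g AB => [//|k IH] f g AB Cg Cf.
have /CnS[dg Dg] := Cg; have /CnS[df Df] := Cf; apply/CnS.
split=> [x Ax|v]; first exact: differentiable_comp (dg _ Ax) (df _ (AB _ Ax)).
apply: (@eq_Cn _ _ _ _ (fun x =>
    \sum_i 'D_v (fun x => g x 0 i) x * 'D_(delta_mx 0 i) f (g x))) => //.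
  by move=> x Ax; rewrite derive_comp//; [exact: dg|apply/df/AB].
apply: Cn_sum => // i; apply: CnM => //.
  by have /(Cn_coordP _ _ oA)/(_ i) := Cg => /CnS[].
by apply: (IH ('D_(delta_mx 0 i) f) g) => //; exact: CnW.
Qed.

End Cn.
Local Arguments Cn : simpl never.

Section smooth.
Context {R : realType}.
Implicit Types V W : normedModType R.

Lemma smooth_cst V W A (c : W) : smooth_on A (fun _ : V => c).
Proof. by apply/smooth_onP => k; exact: Cn_cst. Qed.

Lemma smooth_linear V W A (f : V -> W) : linear f -> continuous f -> smooth_on A f.
Proof. by move=> lf cf; apply/smooth_onP => k; exact: Cn_linear. Qed.

Lemma smooth_coord n A i : smooth_on A (fun x : 'rV[R]_n => x 0 i).
Proof. by apply/smooth_onP => k; exact: Cn_coord. Qed.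

Lemma smoothD V W A (f g : V -> W) : open A ->
  smooth_on A f -> smooth_on A g -> smooth_on A (fun x => f x + g x).
Proof. by move=> oA /smooth_onP f' /smooth_onP g'; apply/smooth_onP => k; exact: CnD. Qed.

Lemma smoothN V A (f : V -> R) : open A ->
  smooth_on A f -> smooth_on A (fun x => - f x).
Proof. by move=> oA /smooth_onP f'; apply/smooth_onP => k; exact: Cn_opp. Qed.

Lemma smoothB V A (f g : V -> R) : open A ->
  smooth_on A f -> smooth_on A g -> smooth_on A (fun x => f x - g x).
Proof. by move=> oA f' g'; apply: smoothD => //; exact: smoothN. Qed.

Lemma smoothM V A (f g : V -> R) : open A ->
  smooth_on A f -> smooth_on A g -> smooth_on A (fun x => f x * g x).
Proof. by move=> oA /smooth_onP f' /smooth_onP g'; apply/smooth_onP => k; exact: CnM. Qed.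

Lemma smoothV V A (f : V -> R) : open A -> (forall x, A x -> f x != 0) ->
  smooth_on A f -> smooth_on A (fun x => (f x)^-1).
Proof. by move=> oA f0 /smooth_onP f'; apply/smooth_onP => k; exact: Cn_inv. Qed.

Lemma smooth_sqrt V A (f : V -> R) : open A -> (forall x, A x -> 0 < f x) ->
  smooth_on A f -> smooth_on A (fun x => Num.sqrt (f x)).
Proof. by move=> oA f0 /smooth_onP f'; apply/smooth_onP => k; exact: Cn_sqrt. Qed.

Lemma smooth_sum V W A (I : Type) (r : seq I) (f : I -> V -> W) : open A ->
  (forall i, smooth_on A (f i)) -> smooth_on A (fun x => \sum_(i <- r) f i x).
Proof.
move=> oA f'; apply/smooth_onP => k; apply: Cn_sum => // i.
by have /smooth_onP := f' i; exact.
Qed.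

Lemma smooth_prod V A (I : Type) (r : seq I) (f : I -> V -> R) : open A ->
  (forall i, smooth_on A (f i)) -> smooth_on A (fun x => \prod_(i <- r) f i x).
Proof.
move=> oA f'; apply/smooth_onP => k; apply: Cn_prod => // i.
by have /smooth_onP := f' i; exact.
Qed.

Lemma smooth_coordP V n A (g : V -> 'rV[R]_n) : open A ->
  smooth_on A g <-> (forall i, smooth_on A (fun x => g x 0 i)).
Proof.
move=> oA; split=> [/smooth_onP g' i|g'].
  by apply/smooth_onP => k; exact: (Cn_coordP _ _ oA).1.
apply/smooth_onP => k; apply/(Cn_coordP _ _ oA) => i.
by have /smooth_onP := g' i; exact.
Qed.

Lemma smooth_comp V n A B (g : V -> 'rV[R]_n) (f : 'rV[R]_n -> R) : open A ->
  (forall x, A x -> B (g x)) -> smooth_on A g -> smooth_on B f ->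
  smooth_on A (fun x => f (g x)).
Proof.
move=> oA AB /smooth_onP g' /smooth_onP f'; apply/smooth_onP => k.
exact: (Cn_comp oA AB).
Qed.

Lemma smooth_comp_rV V n m A B (g : V -> 'rV[R]_n) (f : 'rV[R]_n -> 'rV[R]_m) :
  open A -> open B ->
  (forall x, A x -> B (g x)) -> smooth_on A g -> smooth_on B f ->
  smooth_on A (fun x => f (g x)).
Proof.
move=> oA oB AB g' /(smooth_coordP _ oB) f'; apply/(smooth_coordP _ oA) => i.
exact: (smooth_comp oA AB g' (f' i)).
Qed.

End smooth.

Lemma smooth_sqr (R : realType) (V : normedModType R) (A : set V) (f : V -> R) : open A ->
  smooth_on A f -> smooth_on A (fun x => f x ^+ 2).
Proof.
move=> oA sf; rewrite (_ : (fun x => _) = fun x => f x * f x); first exact: smoothM.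
by apply/funext => x; exact: expr2.
Qed.

Ltac smooth_auto := repeat (first
  [ exact: smooth_coord | exact: smooth_cst | assumption
  | apply: smooth_onD | apply: smoothB => // | apply: smoothD => //
  | apply: smooth_sqr => // | apply: smoothM => // | apply: smoothN => //]).

(** * Mean value estimates *)

Section mean_value.
Context {R : realType}.

Lemma coord_le_norm n (v : 'rV[R]_n) i : `|v 0 i| <= `|v|.
Proof.
rewrite [leRHS]/Num.Def.normr/= mx_normrE.
exact: (le_bigmax _ (fun ij : 'I_1 * 'I_n => `|v ij.1 ij.2|) (0, i)).
Qed.

Lemma norm_rV_le n (v : 'rV[R]_n) c : 0 <= c -> (forall i, `|v 0 i| <= c) ->
  `|v| <= c.
Proof.
move=> c0 vc; rewrite [leLHS]/Num.Def.normr/= mx_normrE.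
by apply: bigmax_le => // -[i j] _ /=; rewrite (ord1 i).
Qed.

Lemma is_derive_line (V : normedModType R) (f : V -> R) a d (t : R) :
  differentiable f (t *: d + a) ->
  is_derive t 1 (fun t => f (t *: d + a)) ('D_d f (t *: d + a)).
Proof.
move=> df.
have ls : linear (fun t : R => t *: d).
  by move=> k x y; rewrite scalerDl scalerA.
have E := @derive_affine _ _ _ _ f (mklin ls) a 1 t.
apply: DeriveDef; last by rewrite [LHS]E /= scale1r.
apply/diff_derivable/(@differentiable_comp _ _ _ _ (fun t : R => t *: d + a)) => //.
Qed.

Lemma mean_value_segment (V : normedModType R) (f : V -> R) a d :
  (forall t : R, 0 <= t <= 1 -> differentiable f (t *: d + a)) ->
  exists2 t : R, 0 <= t <= 1 & f (d + a) - f a = 'D_d f (t *: d + a).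
Proof.
move=> df.
have dl (t : R) : t \in `[0, 1]%R -> is_derive t 1 (fun t => f (t *: d + a)) ('D_d f (t *: d + a)).
  by rewrite in_itv/= => /df; exact: is_derive_line.
have h01 : (0 : R) <= 1 by [].
have MV := @MVT_segment R (fun t => f (t *: d + a))
    (fun t => 'D_d f (t *: d + a)) 0 1 h01.
have P1 (x : R) : x \in `]0, 1[%R ->
    is_derive x 1 (fun t : R => f (t *: d + a)) ('D_d f (x *: d + a)).
  by move=> /subset_itv_oo_cc; exact: dl.
have P2 : {within `[0, 1], continuous (fun t : R => f (t *: d + a))}.
  by apply: derivable_within_continuous => t /dl h;
    apply: (@ex_derive _ _ _ _ _ _ _ h).
have [t] := MV P1 P2.
rewrite in_itv/= scale1r scale0r add0r subr0 mulr1 => t01 E.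
by exists t.
Qed.

Lemma ball_segment (V : normedModType R) (a x y : V) (r t : R) : ball a r x -> ball a r y ->
  0 <= t <= 1 -> ball a r (t *: (x - y) + y).
Proof.
rewrite -!ball_normE /= => ax ay /andP[t0 t1].
have -> : a - (t *: (x - y) + y) = t *: (a - x) + (1 - t) *: (a - y).
  have -> : a - x = (a - y) - (x - y) by rewrite opprB addrA subrK.
  rewrite opprD addrA addrAC; move: (a - y) (x - y) => b d.
  by rewrite [RHS]addrC scalerBl scale1r (scalerBr t b d) subrKA.
apply: le_lt_trans (ler_normD _ _) _; rewrite !normrZ (ger0_norm t0).
rewrite ger0_norm ?subr_ge0//.
have [->|tn0] := eqVneq t 0; first by rewrite mul0r add0r subr0 mul1r.
have t_gt0 : 0 < t by rewrite lt_neqAle eq_sym tn0.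
have : t * `|a - x| < t * r by rewrite ltr_pM2l.
have : (1 - t) * `|a - y| <= (1 - t) * r by rewrite ler_wpM2l ?subr_ge0// ltW.
lra.
Qed.

(** The finitely many partial derivatives are continuous, and control the
    derivative in all directions. *)
Lemma derive_uniform n (f : 'rV[R]_n -> R) A a : open A -> A a -> Cn 2 A f ->
  forall e : R, 0 < e -> exists2 r : R, 0 < r & ball a r `<=` A /\
    forall z z' v, ball a r z -> ball a r z' -> `|'D_v f z - 'D_v f z'| <= e * `|v|.
Proof.
(* n.+1 rather than n, which may be 0 *)
move=> oA Aa Cf e e0; pose e' := e / 2 / n.+1%:R.
have e'0 : 0 < e' by rewrite !divr_gt0.
have nA : \forall z \near a, A z /\ forall i, `|'D_'e_i f z - 'D_'e_i f a| <= e'.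
  have h := open_near oA Aa.
  near=> z; split; first by near: z.
  near: z; apply: filter_forall => i.
  have cD : {for a, continuous ('D_'e_i f)}.
    exact/differentiable_continuous/(CnS_diff (CnS_derive 'e_i Cf)).
  move/cvgrPdist_le : cD => /(_ _ e'0); apply: filterS => z.
  by rewrite distrC.
have /nbhs_ballP[r /= r0 Hr] := nA.
exists r => //; split=> [z /Hr[]//|z z' v az az'].
have [Az Hz] := Hr _ az; have [Az' Hz'] := Hr _ az'.
have dz := CnS_diff Cf Az; have dz' := CnS_diff Cf Az'.
rewrite (deriveE v dz) (deriveE v dz').
have -> := congr2 (fun u w : R => u - w) (diff_sum_coord v dz) (diff_sum_coord v dz').
rewrite -sumrB; under eq_bigr do rewrite -mulrBr.
apply: le_trans (ler_norm_sum _ _ _) _.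
apply: (@le_trans _ _ (\sum_(i < n) `|v| * (e / n.+1%:R))).
  apply: ler_sum => i _; rewrite normrM; apply: ler_pM => //; first exact: coord_le_norm.
  have := ler_distD ('D_'e_i f a) ('D_'e_i f z) ('D_'e_i f z').
  have := Hz i; have := Hz' i; rewrite (distrC ('D_'e_i f z')).
  have -> : e / n.+1%:R = e' + e' by rewrite /e'; field.
  lra.
rewrite sumr_const card_ord -[leLHS]mulr_natr -mulrA (mulrC e `|v|) ler_wpM2l//.
by rewrite mulrAC ler_pdivrMr ?ltr0Sn// ler_wpM2l ?(ltW e0)// ler_nat.
Unshelve. all: by end_near. Qed.

(** By the mean value theorem. This strict form of differentiability makes
    x - Phi x a contraction near a point where the derivative of Phi is 1. *)
Lemma strict_diff n (f : 'rV[R]_n -> R) A a : open A -> A a -> Cn 2 A f ->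
  forall e : R, 0 < e -> exists2 r : R, 0 < r & forall x y, ball a r x -> ball a r y ->
    `|f x - f y - 'd f a (x - y)| <= e * `|x - y|.
Proof.
move=> oA Aa Cf e e0; have [r r0 [rA Hr]] := derive_uniform oA Aa Cf e0.
exists r => // x y ax ay.
have seg (t : R) : 0 <= t <= 1 -> ball a r (t *: (x - y) + y).
  by move=> t01; exact: ball_segment.
have [|t t01] := @mean_value_segment _ f y (x - y).
  by move=> t t01; exact/(CnS_diff Cf)/rA/seg.
rewrite subrK => ->; rewrite -(deriveE _ (CnS_diff Cf Aa)).
by apply: Hr; [exact: seg|exact: ballxx].
Qed.

End mean_value.

(** * The inverse function theorem *)

Section matrix_smooth.
Context {R : realType}.

Lemma smooth_det (V : normedModType R) (A : set V) m (M : V -> 'M[R]_m) : open A ->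
  (forall i j, smooth_on A (fun x => M x i j)) -> smooth_on A (fun x => \det (M x)).
Proof.
move=> oA sM; rewrite /determinant; apply: smooth_sum => // s.
apply: smoothM => //; first exact: smooth_cst.
by apply: smooth_prod.
Qed.

(** By Cramer's formula. *)
Lemma smooth_invmx (V : normedModType R) (A : set V) m (M : V -> 'M[R]_m) i j : open A ->
  (forall x, A x -> M x \in unitmx) ->
  (forall i j, smooth_on A (fun x => M x i j)) ->
  smooth_on A (fun x => invmx (M x) i j).
Proof.
move=> oA uM sM.
apply: (@eq_smooth_on _ _ _ _ (fun x => (\det (M x))^-1 * cofactor (M x) j i)) => //.
  by move=> x Ax; rewrite /invmx uM// !mxE.
apply: smoothM => //.
  apply: smoothV => //; last exact: smooth_det.
  by move=> x /uM; rewrite unitmxE unitfE.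
rewrite /cofactor; apply: smoothM => //; first exact: smooth_cst.
apply: smooth_det => // p q.
by apply: (@eq_smooth_on _ _ _ _ (fun x => M x (lift j p) (lift i q))) => // x _; rewrite !mxE.
Qed.

End matrix_smooth.

(** The contraction principle is applied in the complete normed module of row
    vectors. *)
HB.instance Definition _ (R : realType) n := Complete.on 'rV[R]_n.

Section inverse_function.
Context {R : realType} {n : nat}.
Implicit Types (Phi : 'rV[R]_n -> 'rV[R]_n).

Definition jac Phi (x : 'rV[R]_n) : 'M[R]_n :=
  \matrix_(i, j) 'D_'e_i (fun x => Phi x 0 j) x.

Lemma diff_jac Phi x v : differentiable Phi x -> 'd Phi x v = v *m jac Phi x.
Proof.
move=> dP; apply/rowP => j; rewrite [in LHS](row_sum_delta v) linear_sum summxE mxE.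
apply: eq_bigr => i _; rewrite linearZ !mxE /=; congr (_ * _).
by rewrite -deriveE// derive_coord.
Qed.

(** With h = g (y0 + k) - g y0 one has k = 'd Phi h + o(h), hence L k = h + o(h),
    where h = O(k) by the Lipschitz bound. *)
Lemma inverse_differentiable (V W : normedModType R) (Phi : V -> W) (g : W -> V)
    (y0 : W) (L : {linear W -> V}) C :
  continuous L -> differentiable Phi (g y0) ->
  (forall v, L ('d Phi (g y0) v) = v) ->
  (\forall y \near y0, Phi (g y) = y) ->
  (\forall k \near 0, `|g (k + y0) - g y0| <= C * `|k|) ->
  differentiable g y0 /\ 'd g y0 = L :> (W -> V).
Proof.
move=> cL dP LP Pg gC.
have [K K0 LK] := linear_lipschitz cL.
suff E e : 0 < e -> \forall k \near 0, `|g (k + y0) - g y0 - L k| <= e * `|k|.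
  by split; [apply/differentiable_epsP; exists L | exact: diff_eps_unique].
move=> e0; pose C' := Num.max C 1.
have C'0 : 0 < C' by rewrite lt_max ltr01 orbT.
have d0 : 0 < e / (K * C') by rewrite divr_gt0// mulr_gt0.
have := diff_eps dP d0; move=> /nbhs_ballP[r /= r0 Hr].
near=> k.
have kC : `|g (k + y0) - g y0| <= C' * `|k|.
  apply: le_trans (_ : C * `|k| <= _); first by near: k.
  by rewrite ler_wpM2r// le_max lexx.
have Py0 : Phi (g y0) = y0 by exact: nbhs_singleton Pg.
have Pk : Phi (g (k + y0)) = k + y0.
  near: k; have /(@nbhs0P _ _ (fun x => Phi (g x) = x)) := Pg.
  by apply: filterS => h; rewrite addrC.
have bk : ball 0 r (g (k + y0) - g y0).
  rewrite -ball_normE /= sub0r normrN; apply: le_lt_trans kC _.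
  rewrite mulrC -ltr_pdivlMr//; near: k; apply: nbhs0_lt; exact: divr_gt0.
have := Hr _ bk; rewrite subrK Pk Py0 addrK => H.
have -> : g (k + y0) - g y0 - L k = - L (k - 'd Phi (g y0) (g (k + y0) - g y0)).
  by rewrite linearB LP opprB.
rewrite normrN; apply: le_trans (LK _) _.
apply: le_trans (ler_wpM2l (ltW K0) H) _.
apply: le_trans (_ : K * (e / (K * C') * (C' * `|k|)) <= _).
  by rewrite ler_wpM2l ?(ltW K0)// ler_wpM2l// ltW.
rewrite le_eqVlt; apply/orP; left; apply/eqP; field.
by rewrite !gt_eqF.
Unshelve. all: by end_near. Qed.

Lemma half_contraction_fixpoint (X : completeNormedModType R) (U : set X) (f : X -> X) :
  closed U -> U !=set0 -> (forall x, U x -> U (f x)) ->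
  (forall x y, U x -> U y -> `|f x - f y| <= 2^-1 * `|x - y|) ->
  exists2 p, U p & p = f p.
Proof.
move=> cU U0 fU fL.
pose F : {fun U >-> U} := HB.pack f (isFun.Build X X U U f fU).
suff cF : is_contraction F.
  by have [p Up pE] := banach_fixed_point cF cU U0; exists p.
have h0 : 0 <= 2^-1 :> R by rewrite invr_ge0.
exists (NngNum h0); split=> /=; first by rewrite invf_lt1// ltr1n.
by move=> [x y] /= [Ux Uy]; exact: fL.
Qed.

(** What the contraction principle yields: a local inverse which is only known
    to be Lipschitz. *)
Definition near_inverse Phi (a : 'rV[R]_n) (r : R) (g : 'rV[R]_n -> 'rV[R]_n)
    (B : set 'rV[R]_n) :=
  [/\ open B, B (Phi a),
    forall y, B y -> ball a r (g y) /\ Phi (g y) = y,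
    forall x, ball a r x -> B (Phi x) -> g (Phi x) = x
  & exists C, forall y y', B y -> B y' -> `|g y - g y'| <= C * `|y - y'| ].

(** The equation Phi x = y says that x is a fixed point of x - Phi x + y, a
    contraction of ratio 1/2 near a. *)
Lemma near_inverse_id Phi A a : open A -> A a -> Cn 2 A Phi -> jac Phi a = 1%:M ->
  forall r0, 0 < r0 -> exists r g B, 0 < r <= r0 /\ near_inverse Phi a r g B.
Proof.
move=> oA Aa CP J1 r0 r00.
have dPa : differentiable Phi a by exact: CnS_diff CP Aa.
have CPj j := (Cn_coordP _ _ oA).1 CP j.
have e0 : 0 < 2^-1 :> R by rewrite invr_gt0.
have st j := strict_diff oA Aa (CPj j) e0.
have [r r_gt0 [rr0 H]] : exists2 r : R, 0 < r & r <= r0 /\ forall x y,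
    ball a r x -> ball a r y -> `|(x - y) - (Phi x - Phi y)| <= 2^-1 * `|x - y|.
  have : \forall r \near (0 : R)^'+, r <= r0 /\ forall j x y, ball a r x -> ball a r y ->
     `|Phi x 0 j - Phi y 0 j - 'd (fun x => Phi x 0 j) a (x - y)| <= 2^-1 * `|x - y|.
    near=> r; split; first by near: r; exact: nbhs_right_le.
    near: r; apply: filter_forall => j; have [d d0 Hd] := st j.
    near=> r => x y ax ay; have rd : r <= d by near: r; exact: nbhs_right_le.
    by apply: Hd; apply: le_ball rd _ _.
  move=> Hr; have [r [[rr0 Hj] r_gt0]] := filter_ex (filterI Hr (nbhs_right_gt 0)).
  exists r => //.
  split=> // x y ax ay; apply: norm_rV_le; first by rewrite mulr_ge0// ltW.
  move=> j; have := Hj j x y ax ay.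
  have -> : 'd (fun x => Phi x 0 j) a (x - y) = (x - y) 0 j; last first.
    by rewrite distrC !mxE.
  rewrite -deriveE; last exact: CnS_diff (CPj j) Aa.
  by rewrite derive_coord// deriveE// diff_jac// J1 mulmx1.
have inj x y : ball a r x -> ball a r y -> `|x - y| <= 2 * `|Phi x - Phi y|.
  move=> ax ay; have := H x y ax ay; have := ler_normB (x - y) (Phi x - Phi y).
  have := lerB_dist (x - y) (Phi x - Phi y). lra.
pose B := ball (Phi a) (r / 4).
have fix_ y : B y -> exists2 x, ball a r x & Phi x = y.
  rewrite /B -ball_normE /= => yB.
  pose U := [set x | `|a - x| <= r / 2].
  have Ur x : U x -> ball a r x.
    rewrite /U /= -ball_normE /= => /le_lt_trans; apply; lra.
  have Ua : U a by rewrite /U /= subrr normr0 divr_ge0// ltW.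
  pose f x := x - Phi x + y.
  have fL x x' : U x -> U x' -> `|f x - f x'| <= 2^-1 * `|x - x'|.
    move=> /Ur ax /Ur ax'; have := H _ _ ax ax'; congr (`|_| <= _).
    by rewrite /f; apply/rowP => i; rewrite !mxE; ring.
  have [||x|x /Ur ax xE] := @half_contraction_fixpoint 'rV[R]_n U f _ _ _ fL.
  - exact: closed_closed_ball_.
  - by exists a.
  - move=> Ux; have := fL _ _ Ux Ua; move: (Ux); rewrite /U /= => Ux'.
    have -> : a - f x = - (f x - f a) + (Phi a - y).
      by rewrite /f; apply/rowP => i; rewrite !mxE; ring.
    have := ler_normD (- (f x - f a)) (Phi a - y); rewrite normrN (distrC x a).
    lra.
  - exists x; first by move: ax; rewrite -ball_normE.
    apply/rowP => i; have := congr1 (fun z : 'rV[R]_n => z 0 i) xE.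
    by rewrite /f !mxE; lra.
pose g y := get [set x | ball a r x /\ Phi x = y].
have gP y : B y -> ball a r (g y) /\ Phi (g y) = y.
  move=> /fix_[x ax xy]; rewrite /g; apply: (@getPex _ [set x | ball a r x /\ Phi x = y]).
  by exists x.
exists r, g, B; rewrite r_gt0 rr0; split=> //; split=> //.
- exact: ball_open.
- by apply: ballxx; rewrite divr_gt0.
- move=> x ax Bx; have [ag Pg] := gP _ Bx.
  by apply/eqP; rewrite -subr_eq0 -normr_le0; have := inj _ _ ag ax; rewrite Pg subrr normr0 mulr0.
- exists 2 => y y' By By'; have [ag Pg] := gP _ By; have [ag' Pg'] := gP _ By'.
  by have := inj _ _ ag ag'; rewrite Pg Pg'.
Unshelve. all: by end_near. Qed.

Lemma local_diffeoI (V W : normedModType R) (f : V -> W) (g : W -> V) (A : set V)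
    (B : set W) (a : V) (b : W) :
  open A -> A a -> open B -> f a = b ->
  (forall x, A x -> B (f x) /\ g (f x) = x) ->
  (forall y, B y -> A (g y) /\ f (g y) = y) ->
  smooth_on A f -> smooth_on B g -> local_diffeo f a b.
Proof.
move=> oA Aa oB fab fg gf sf sg; split=> //; exists g, A, B; split=> //.
by split=> //; rewrite -fab; exact: (fg _ Aa).1.
Qed.

(** Composition with the inverse of the Jacobian at a reduces to the case of a
    derivative equal to 1. The inverse is smooth since its derivative is the
    inverse of the Jacobian, evaluated at the inverse itself: each order of
    differentiability yields the next one. *)
Theorem inverse_function Phi A a : open A -> A a -> smooth_on A Phi ->
  jac Phi a \in unitmx -> local_diffeo Phi a (Phi a).
Proof.
move=> oA Aa sP uJ; pose M := invmx (jac Phi a).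
have CP k : Cn k A Phi by have /smooth_onP := sP; exact.
have sJ i j : smooth_on A (fun x => jac Phi x i j).
  apply: (@eq_smooth_on _ _ _ _ ('D_'e_i (fun x => Phi x 0 j))) => //.
    by move=> x _; rewrite !mxE.
  exact/smooth_onD/(smooth_coordP _ oA).1.
have [r0 r00 Hr0] : exists2 r : R, 0 < r &
    ball a r `<=` [set x | A x /\ jac Phi x \in unitmx].
  have cdet : {for a, continuous (fun x => \det (jac Phi x))}.
    apply: smooth_on_continuous Aa; exact: smooth_det.
  have : \forall x \near a, A x /\ jac Phi x \in unitmx.
    have nA := open_near oA Aa.
    have nd := cvgr_neq0 _ cdet; move: uJ; rewrite unitmxE unitfE => /nd.
    by apply: filterS2 nA => x Ax; rewrite unitmxE unitfE.
  by move=> /nbhs_ballP[r /= r0 Hr]; exists r.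
pose Psi x := Phi x *m M.
have lM : linear (fun v : 'rV[R]_n => v *m M) by move=> k x y; rewrite mulmxDl scalemxAl.
have cM := linear_rV_continuous lM.
have CPsi : Cn 2 A Psi.
  by apply: (@Cn_comp_lin _ _ _ _ _ _ _ (mklin lM)) => //.
have JPsi : jac Psi a = 1%:M.
  have dPhi : differentiable Phi a by exact: CnS_diff (CP 1%N) Aa.
  have dlM : differentiable (mklin lM) (Phi a) by exact: linear_differentiable.
  have dPsi : differentiable Psi a by exact: CnS_diff CPsi Aa.
  apply/matrixP => i j; rewrite mxE derive_coord// deriveE//.
  have E v : 'd Psi a v = 'd Phi a v *m M.
    have E1 : 'd Psi a v = 'd (mklin lM) (Phi a) ('d Phi a v) :=
      congr1 (fun h => h v) (diff_comp dPhi dlM).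
    have E2 : 'd (mklin lM) (Phi a) = mklin lM :> (_ -> _) by exact: diff_lin.
    exact: etrans E1 (congr1 (fun h => h ('d Phi a v)) E2).
  by rewrite E diff_jac// mulmxK// !mxE eqxx eq_sym.
have [r [g [B [/andP[r_gt0 rr0] [oB Ba gP gK [C gC]]]]]] :=
  near_inverse_id oA Aa CPsi JPsi r00.
pose B' := [set y : 'rV[R]_n | B (y *m M)].
pose g' y := g (y *m M).
have oB' : open B' by apply: open_comp => // y _; exact: cM.
have ArA : ball a r `<=` A by move=> x ax; exact: (Hr0 _ (le_ball rr0 ax)).1.
have uA x : ball a r x -> jac Phi x \in unitmx.
  by move=> ax; exact: (Hr0 _ (le_ball rr0 ax)).2.
have uM : M \in unitmx by rewrite unitmx_inv.
have g'P y : B' y -> ball a r (g' y) /\ Phi (g' y) = y.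
  move=> /gP[ag Pg]; split=> //; rewrite -[LHS](mulmxK uM) -[RHS](mulmxK uM).
  by congr (_ *m _).
have g'K x : ball a r x -> B' (Phi x) -> g' (Phi x) = x by exact: gK.
pose A' := ball a r `&` Phi @^-1` B'.
have oA' : open A'.
  rewrite openE => x [ax Bx]; apply: filterI; first exact: open_near (ball_open _ _) ax.
  exact: (smooth_on_continuous sP (ArA _ ax)) (open_near oB' Bx).
apply: (@local_diffeoI _ _ Phi g' A' B') => //.
- by split; [exact: ballxx|exact: Ba].
- by move=> x [ax Bx]; split=> //; exact: g'K.
- by move=> y By; have [ag Pg] := g'P _ By; split=> //; split=> //=; rewrite Pg.
- by apply: smooth_on_sub sP => x [ax _]; exact: ArA.
have dg y : B' y -> differentiable g' y /\
    'd g' y = (fun v => v *m invmx (jac Phi (g' y))) :> ('rV[R]_n -> 'rV[R]_n).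
  move=> By; have [ag Pg] := g'P _ By.
  have lL : linear (fun v : 'rV[R]_n => v *m invmx (jac Phi (g' y))).
    by move=> k u v; rewrite mulmxDl scalemxAl.
  have cL := linear_rV_continuous lL.
  have [K K0 MK] := linear_lipschitz (cM : continuous (mklin lM)).
  apply: (@inverse_differentiable _ _ Phi g' y (mklin lL) (Num.max C 0 * K)) => //.
  - exact/(CnS_diff (CP 1%N))/ArA.
  - move=> v /=; rewrite diff_jac; last exact/(CnS_diff (CP 1%N))/ArA.
    by rewrite mulmxK//; exact: uA.
  - by apply: filterS (open_near oB' By) => z Bz; exact: (g'P _ Bz).2.
  - have : \forall k \near 0, B' (y + k).
      by apply/(@nbhs0P _ _ B'); exact: open_near.
    apply: filterS => k; rewrite addrC => Bk.
    apply: le_trans (gC _ _ Bk By) _; rewrite mulmxDl addrK.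
    apply: le_trans (_ : Num.max C 0 * `|k *m M| <= _).
      by rewrite ler_wpM2r// le_max lexx.
    by rewrite -mulrA ler_wpM2l// ?le_max ?lexx ?orbT//; exact: MK.
apply/smooth_onP; elim=> [//|k IH]; apply/CnS; split=> [y /dg[]//|v].
apply: (@eq_Cn _ _ _ _ _ (fun y => v *m invmx (jac Phi (g' y)))) => //.
  by move=> y By; have [dgy E] := dg _ By; rewrite [RHS]deriveE// E.
apply/(Cn_coordP _ _ oB') => j.
have oball : open (ball a r) by exact: ball_open.
apply: (@Cn_comp _ _ _ _ B' (ball a r) g'
          (fun x => (v *m invmx (jac Phi x)) 0 j)) => //.
  by move=> y /g'P[].
have : smooth_on (ball a r) (fun x => (v *m invmx (jac Phi x)) 0 j).
  apply: (@eq_smooth_on _ _ _ _ (fun x => \sum_i v 0 i * invmx (jac Phi x) i j)) => //.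
    by move=> x _; rewrite mxE.
  apply: smooth_sum => // i; apply: smoothM => //; first exact: smooth_cst.
  by apply: smooth_invmx => // p q; apply: smooth_on_sub (sJ p q) => x /ArA.
by move/smooth_onP; exact.
Qed.

End inverse_function.

(** * Integration over the unit interval *)

Section unit_interval_integral.
Context {R : realType}.
Notation mu := (@lebesgue_measure R).
Implicit Types f g : R -> R.

Definition cont01 f := forall s, 0 <= s <= 1 -> {for s, continuous f}.
Definition int01 f : R := (\int[mu]_(s in `[0%R, 1%R]) f s)%R.

Lemma cont01_within f : cont01 f -> {within `[0, 1], continuous f}.
Proof. by move=> cf; apply: continuous_in_subspaceT => s; rewrite inE/= in_itv/= => /cf. Qed.

Lemma cont01_integrable f : cont01 f -> mu.-integrable `[0%R, 1%R] (EFin \o f).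
Proof.
move=> /cont01_within cf; apply: continuous_compact_integrable => //.
exact: segment_compact.
Qed.

Lemma cont01D f g : cont01 f -> cont01 g -> cont01 (fun s => f s + g s).
Proof. by move=> cf cg s s01; apply: continuousD; [exact: cf|exact: cg]. Qed.

Lemma cont01M f g : cont01 f -> cont01 g -> cont01 (fun s => f s * g s).
Proof. by move=> cf cg s s01; apply: continuousM; [exact: cf|exact: cg]. Qed.

Lemma cont01_cst c : cont01 (fun=> c).
Proof. by move=> s _; exact: cst_continuous. Qed.

Lemma cont01_sum (I : Type) (r : seq I) (f : I -> R -> R) : (forall i, cont01 (f i)) ->
  cont01 (fun s => \sum_(i <- r) f i s).
Proof.
move=> cf; elim: r => [|i r IH].
  by under [X in cont01 X]eq_fun do rewrite big_nil; exact: cont01_cst.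
by under [X in cont01 X]eq_fun do rewrite big_cons; exact: cont01D.
Qed.

Lemma int01D f g : cont01 f -> cont01 g ->
  int01 (fun s => f s + g s) = int01 f + int01 g.
Proof. by move=> cf cg; rewrite /int01 RintegralD//; exact: cont01_integrable. Qed.

Lemma int01B f g : cont01 f -> cont01 g ->
  int01 (fun s => f s - g s) = int01 f - int01 g.
Proof. by move=> cf cg; rewrite /int01 RintegralB//; exact: cont01_integrable. Qed.

Lemma int01Z c f : cont01 f -> int01 (fun s => c * f s) = c * int01 f.
Proof. by move=> cf; rewrite /int01 RintegralZl//; exact: cont01_integrable. Qed.

Lemma int01_cst c : int01 (fun=> c) = c.
Proof.
by rewrite /int01 Rintegral_cst//= lebesgue_measure_itv/= lte_fin ltr01 EFinN sube0 mulr1.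
Qed.

Lemma int01_sum (I : Type) (r : seq I) (f : I -> R -> R) : (forall i, cont01 (f i)) ->
  int01 (fun s => \sum_(i <- r) f i s) = \sum_(i <- r) int01 (f i).
Proof.
move=> cf; elim: r => [|i r IH].
  by under [X in int01 X]eq_fun do rewrite big_nil; rewrite int01_cst big_nil.
under [X in int01 X]eq_fun do rewrite big_cons.
by rewrite int01D// ?IH ?big_cons//; exact: cont01_sum.
Qed.

Lemma eq_int01 f g : (forall s, 0 <= s <= 1 -> f s = g s) -> int01 f = int01 g.
Proof. by move=> fg; apply: eq_Rintegral => s; rewrite inE/= in_itv/=; exact: fg. Qed.

Lemma int01_le f c : cont01 f -> (forall s, 0 <= s <= 1 -> `|f s| <= c) ->
  `|int01 f| <= c.
Proof.
move=> cf fc.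
apply: le_trans (le_normr_Rintegral _ (cont01_integrable cf)) _ => //.
rewrite -[leRHS]int01_cst; apply: le_Rintegral => //.
- apply: (@cont01_integrable (fun s => `|f s|)) => s s01.
  by apply: cvg_norm; exact: cf.
- by apply: (@cont01_integrable (fun=> c)); exact: cont01_cst.
Qed.

Lemma int01_derive (f df : R -> R) : (forall s : R, 0 <= s <= 1 -> is_derive s 1 f (df s)) ->
  cont01 df -> int01 df = f 1 - f 0.
Proof.
move=> fdf cdf.
have cf s : 0 <= s <= 1 -> {for s, continuous f}.
  move=> /fdf h; apply/differentiable_continuous/derivable1_diffP.
  exact: (@ex_derive _ _ _ _ _ _ _ h).
rewrite /int01 /Rintegral (@continuous_FTC2 _ df f)//.
- exact: cont01_within.
- split.
  + move=> s; rewrite in_itv/= => /andP[s0 s1].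
    by apply: (@ex_derive _ _ _ _ _ _ _ (fdf s _)); rewrite !ltW.
  + by apply: cvg_at_right_filter; apply: cf; rewrite lexx ler01.
  + by apply: cvg_at_left_filter; apply: cf; rewrite lexx ler01.
- move=> s; rewrite in_itv/= => /andP[s0 s1].
  by rewrite derive1E (@derive_val _ _ _ _ _ _ _ (fdf s _))// !ltW.
Qed.

End unit_interval_integral.

(** * Hadamard's lemma *)

Section hadamard.
Context {R : realType} {n : nat} (i : 'I_n).
Implicit Types (x v : 'rV[R]_n) (s : R) (F : 'rV[R]_n -> R).

(** Multiplication of the coordinate i by s. *)
Definition collapse s x : 'rV[R]_n := x + ((s - 1) * x 0 i) *: 'e_i.

Lemma collapseE s x j : collapse s x 0 j = s ^+ (j == i) * x 0 j.
Proof. by rewrite !mxE eqxx /=; case: eqVneq => [->|_] /=; ring. Qed.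

Lemma collapseD s x y : collapse s (x + y) = collapse s x + collapse s y.
Proof. by apply/rowP => j; rewrite collapseE [RHS]mxE !collapseE mxE mulrDr. Qed.

Lemma collapse1 x : collapse 1 x = x.
Proof. by apply/rowP => j; rewrite collapseE expr1n mul1r. Qed.

Lemma collapse_id s x : x 0 i = 0 -> collapse s x = x.
Proof. by move=> xi; rewrite /collapse xi mulr0 scale0r addr0. Qed.

Lemma collapse_le s x : 0 <= s <= 1 -> `|collapse s x| <= `|x|.
Proof.
move=> /andP[s0 s1]; apply: norm_rV_le => // j; rewrite collapseE normrM.
apply: le_trans (_ : 1 * `|x 0 j| <= _); last by rewrite mul1r coord_le_norm.
by apply: ler_wpM2r => //; rewrite ger0_norm ?exprn_ge0//; case: (j == i).
Qed.

Lemma collapse_continuous x : continuous (collapse^~ x).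
Proof.
move=> s; rewrite /continuous_at /collapse; apply: cvgD; first exact: cvg_cst.
apply: cvgZr_tmp; apply: cvgM; last exact: cvg_cst.
by apply: cvgB; [exact: cvg_id|exact: cvg_cst].
Qed.

Lemma diff_collapse F s x v : differentiable F x ->
  'D_(collapse s v) F x = \sum_j s ^+ (j == i) * (v 0 j * 'D_'e_j F x).
Proof.
move=> dF; rewrite deriveE// diff_sum_coord//.
by apply: eq_bigr => j _; rewrite collapseE mulrA.
Qed.

Variable A : set 'rV[R]_n.
Hypotheses (oA : open A) (starA : forall s x, 0 <= s <= 1 -> A x -> A (collapse s x)).

(** The weights s ^+ k make this family of integrals stable under
    differentiation. *)
Definition avg k F x := int01 (fun s => s ^+ k * F (collapse s x)).

Lemma cont01_avg k F x : A x -> Cn 1 A F -> cont01 (fun s => s ^+ k * F (collapse s x)).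
Proof.
move=> Ax CF s s01; apply: continuousM; first exact: exprn_continuous.
apply: (@continuous_comp _ _ _ (collapse^~ x)); first exact: collapse_continuous.
exact/differentiable_continuous/(CnS_diff CF)/starA.
Qed.

(** Uniform in s by compactness of the unit interval, the expansion can be
    integrated. *)
Lemma avg_taylor F x e : A x -> Cn 2 A F -> 0 < e ->
  \forall h \near 0, A (h + x) /\ forall s, 0 <= s <= 1 ->
    `|F (collapse s (h + x)) - F (collapse s x) - 'D_(collapse s h) F (collapse s x)|
    <= e * `|h|.
Proof.
move=> Ax CF e0.
pose P (h : 'rV[R]_n) (s : R) := forall t : R, 0 <= t <= 1 ->
    `|'D_(collapse s h) F (t *: collapse s h + collapse s x) -
      'D_(collapse s h) F (collapse s x)| <= e * `|h|.
suff H : \forall h \near (0 : 'rV[R]_n), `[0, 1] `<=` P h.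
  have nA : \forall h \near 0, ball 0 1 h /\ forall t : R, 0 <= t <= 1 -> A (t *: h + x).
    have /nbhs_ballP[r /= r0 Hr] := open_near oA Ax.
    have : \forall h \near (0 : 'rV[R]_n), ball 0 r h by exact: nbhsx_ballx.
    move=> H0; near=> h; split; first by near: h; exact: nbhsx_ballx.
    move=> t /andP[t0 t1]; apply: Hr; rewrite -ball_normE /= opprD addrCA subrr addr0.
    have : ball 0 r h by near: h.
    rewrite -ball_normE /= sub0r !normrN normrZ ger0_norm//; apply: le_lt_trans.
    by rewrite ler_piMl.
  near=> h; have [_ Ah] : ball 0 1 h /\ forall t : R, 0 <= t <= 1 -> A (t *: h + x) by near: h.
  split; first by rewrite -(scale1r h); apply: Ah; rewrite ler01 lexx.
  move=> s s01; rewrite collapseD.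
  have [t t01|t t01 ->] := @mean_value_segment _ _ F (collapse s x) (collapse s h).
    have -> : t *: collapse s h + collapse s x = collapse s (t *: h + x).
      by apply/rowP => j; rewrite collapseE [LHS]mxE [X in X + _]mxE !collapseE !mxE; ring.
    by apply: (CnS_diff CF); apply: starA => //; exact: Ah.
  have Ph : `[0, 1] `<=` P h by near: h.
  by apply: (Ph s) => //=; rewrite in_itv.
have /compact_near_coveringP/near_covering_withinP cov := @segment_compact R 0 1.
apply: (cov _ (nbhs (0 : 'rV[R]_n)) P _).
move=> s0; rewrite /= in_itv/= => s01.
have [r r0 [rA Hr]] := derive_uniform oA (starA s01 Ax) CF e0.
have ns : \forall s \near s0, ball (collapse s0 x) (r / 2) (collapse s x).
  have /cvg_ball := @collapse_continuous x s0; apply; exact: divr_gt0.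
have nh : \forall h \near (0 : 'rV[R]_n), `|h| < r / 2 by apply: nbhs0_lt; exact: divr_gt0.
near=> s h => /=; rewrite in_itv/= => s01' t /andP[t0 t1].
have hr : `|h| < r / 2 by near: h.
have bs : ball (collapse s0 x) (r / 2) (collapse s x) by near: s.
apply: le_trans (Hr _ _ _ _ _) _.
- rewrite (splitr r); apply: ball_triangle bs _.
  rewrite -ball_normE /= opprD addrCA subrr addr0 normrN normrZ ger0_norm//.
  by apply: le_lt_trans hr; rewrite -[leRHS]mul1r ler_pM// collapse_le.
- by apply: le_ball bs; lra.
- by rewrite ler_wpM2l ?(ltW e0)// collapse_le.
Unshelve. all: by end_near. Qed.

(** Differentiation under the integral sign. *)
Lemma avg_diff k F x : A x -> Cn 3 A F -> differentiable (avg k F) x /\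
  forall v, 'D_v (avg k F) x = \sum_j v 0 j * avg (k + (j == i)) ('D_'e_j F) x.
Proof.
move=> Ax CF; pose dI v := \sum_j v 0 j * avg (k + (j == i)) ('D_'e_j F) x.
have lI : linear dI.
  move=> a u v; rewrite /dI scaler_sumr -big_split /=; apply: eq_bigr => j _.
  by rewrite !mxE mulrDl -mulrA.
have cI := linear_rV_continuous lI.
have CD j : Cn 1 A ('D_'e_j F) by exact/CnW/CnS_derive.
have C2 : Cn 2 A F by exact: CnW.
have c j := @cont01_avg (k + (j == i)) _ _ Ax (CD j).
pose S v s := \sum_j v 0 j * (s ^+ (k + (j == i)) * 'D_'e_j F (collapse s x)).
have SE v s : 0 <= s <= 1 -> S v s = s ^+ k * 'D_(collapse s v) F (collapse s x).
  move=> s01; rewrite diff_collapse; last exact/(CnS_diff CF)/starA.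
  by rewrite mulr_sumr; apply: eq_bigr => j _; rewrite exprD; ring.
have cS v : cont01 (S v).
  by apply: cont01_sum => j; apply: cont01M => //; exact: cont01_cst.
have dIE v : dI v = int01 (S v).
  rewrite int01_sum; last by move=> j; apply: cont01M => //; exact: cont01_cst.
  by apply: eq_bigr => j _; rewrite int01Z.
have E e : 0 < e ->
    \forall h \near 0, `|avg k F (h + x) - avg k F x - mklin lI h| <= e * `|h|.
  move=> e0; have := avg_taylor Ax C2 e0; apply: filterS => h [Ah Hh] /=.
  have c1 := @cont01_avg k _ _ Ah (CnW C2); have c2 := @cont01_avg k _ _ Ax (CnW C2).
  rewrite dIE -int01B// -int01B//; last first.
    by move=> s s01; apply: continuousB; [exact: c1|exact: c2].
  apply: int01_le.
    move=> s s01; apply: continuousB; [|exact: cS].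
    by apply: continuousB; [exact: c1|exact: c2].
  move=> s s01; rewrite SE// -!mulrBr normrM; apply: le_trans (Hh _ s01).
  by have /andP[? ?] := s01; rewrite ler_piMl// normrX exprn_ile1// ger0_norm.
split; first by apply/differentiable_epsP; exists (mklin lI).
move=> v; rewrite deriveE; last by apply/differentiable_epsP; exists (mklin lI).
by have -> := @diff_eps_unique _ _ _ _ _ (mklin lI) cI E.
Qed.

Lemma Cn_avg m k F : smooth_on A F -> Cn m A (avg k F).
Proof.
elim: m k F => [//|m IH] k F sF; have CF : Cn 3 A F by have /smooth_onP := sF; exact.
apply/CnS; split=> [x Ax|v]; first exact: (avg_diff k Ax CF).1.
apply: (@eq_Cn _ _ _ _ _
    (fun x => \sum_j v 0 j * avg (k + (j == i)) ('D_'e_j F) x)) => //.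
  by move=> x Ax; rewrite (avg_diff k Ax CF).2.
apply: Cn_sum => // j; apply: (@CnM _ _ _ _ (cst (v 0 j))) => //; first exact: Cn_cst.
exact/IH/smooth_onD.
Qed.

(** F x is the integral over s of the derivative of F (collapse s x), because F
    vanishes at collapse 0 x; this derivative is x_i times 'D_'e_i F. *)
Theorem hadamard F : smooth_on A F -> (forall x, A x -> x 0 i = 0 -> F x = 0) ->
  exists2 g, smooth_on A g & forall x, A x ->
    F x = x 0 i * g x /\ (x 0 i = 0 -> g x = 'D_'e_i F x).
Proof.
move=> sF F0; exists (avg 0 ('D_'e_i F)).
  by apply/smooth_onP => k; exact/Cn_avg/smooth_onD.
have CF k : Cn k A F by have /smooth_onP := sF; exact.
move=> x Ax; have c := @cont01_avg 0 _ _ Ax (CnS_derive 'e_i (CF 2%N)).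
split=> [|xi]; last first.
  rewrite /avg -[RHS]int01_cst; apply: eq_int01 => s _.
  by rewrite collapse_id// expr0 mul1r.
have dF s : 0 <= s <= 1 -> is_derive s 1 (fun s => F (collapse s x))
    (x 0 i * (s ^+ 0 * 'D_'e_i F (collapse s x))).
  move=> s01; have dF := CnS_diff (CF 1%N) (starA s01 Ax).
  pose b := x - x 0 i *: 'e_i.
  have cE s' : collapse s' x = s' *: (x 0 i *: 'e_i) + b.
    by apply/rowP => j; rewrite !mxE; ring.
  have -> : (fun s => F (collapse s x)) = (fun s => F (s *: (x 0 i *: 'e_i) + b)).
    by apply/funext => s'; rewrite cE.
  move: dF; rewrite cE => dF.
  apply: is_derive_eq (is_derive_line dF) _.
  by rewrite deriveE// linearZ /= -deriveE// expr0 mul1r.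
rewrite /avg -int01Z// (int01_derive dF).
  rewrite collapse1 (F0 (collapse 0 x)) ?subr0//.
    by apply: starA => //; rewrite lexx ler01.
  by rewrite collapseE eqxx expr1 mul0r.
by move=> s s01; apply: continuousM; [exact: cst_continuous|exact: c].
Qed.

End hadamard.

(** * Hadamard's lemma to second order *)

Section second_order_hadamard.
Context {R : realType} {n : nat}.
Implicit Types (x v : 'rV[R]_n).

Lemma star_ball (i : 'I_n) (r s : R) x :
  0 <= s <= 1 -> ball 0 r x -> ball 0 r (collapse i s x).
Proof.
rewrite -!ball_normE /= !sub0r !normrN => s01; apply: le_lt_trans; exact: collapse_le.
Qed.

Lemma hadamard_ball (i : 'I_n) (r : R) (F : 'rV[R]_n -> R) : smooth_on (ball 0 r) F ->
  (forall x, ball 0 r x -> x 0 i = 0 -> F x = 0) ->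
  exists2 g, smooth_on (ball 0 r) g & forall x, ball 0 r x ->
    F x = x 0 i * g x /\ (x 0 i = 0 -> g x = 'D_'e_i F x).
Proof. by apply: hadamard; [exact: ball_open|move=> s x; exact: star_ball]. Qed.

Lemma smooth_collapse (i : 'I_n) s A : smooth_on A (collapse i s : 'rV[R]_n -> 'rV[R]_n).
Proof.
have lc : linear (collapse i s : 'rV[R]_n -> 'rV[R]_n).
  by move=> k x y; apply/rowP => j; rewrite collapseE [RHS]mxE [X in _ = X + _]mxE !collapseE !mxE; ring.
by apply: smooth_linear => //; exact: linear_rV_continuous.
Qed.

Lemma smooth_comp_collapse (i : 'I_n) (r : R) (F : 'rV[R]_n -> R) :
  smooth_on (ball 0 r) F -> smooth_on (ball 0 r) (fun x => F (collapse i 0 x)).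
Proof.
apply: (smooth_comp (ball_open _ _)); last exact: smooth_collapse.
by move=> x; apply: star_ball; rewrite lexx ler01.
Qed.

Lemma derive_collapse (i : 'I_n) (F : 'rV[R]_n -> R) v x :
  'D_v (fun x => F (collapse i 0 x)) x = 'D_(collapse i 0 v) F (collapse i 0 x).
Proof.
have lc : linear (collapse i 0 : 'rV[R]_n -> 'rV[R]_n).
  by move=> k y z; apply/rowP => j; rewrite collapseE [RHS]mxE [X in _ = X + _]mxE !collapseE !mxE; ring.
have := @derive_affine _ _ _ _ F (mklin lc) 0 v x; rewrite /= addr0 => <-.
by congr ('D_v _ x); apply/funext => y; rewrite addr0.
Qed.

Lemma collapse_delta_same (i : 'I_n) : collapse i 0 'e_i = 0 :> 'rV[R]_n.
Proof. by apply/rowP => j; rewrite collapseE !mxE eqxx /=; case: eqP => _ /=; rewrite ?mulr0// expr1 mul0r. Qed.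

Lemma collapse_delta_other (i j : 'I_n) : i != j -> collapse i 0 'e_j = 'e_j :> 'rV[R]_n.
Proof. by move=> ij; rewrite collapse_id// mxE eqxx (negbTE ij). Qed.

Lemma derive_mulr (V : normedModType R) (f g : V -> R) (x v : V) : differentiable f x -> differentiable g x ->
  'D_v (fun y => f y * g y) x = f x * 'D_v g x + g x * 'D_v f x.
Proof. by move=> df dg; exact: (deriveM (diff_derivable df) (diff_derivable dg)). Qed.

Lemma derive_addr (V : normedModType R) (f g : V -> R) (x v : V) : differentiable f x -> differentiable g x ->
  'D_v (fun y => f y + g y) x = 'D_v f x + 'D_v g x.
Proof. by move=> df dg; exact: (deriveD (diff_derivable df) (diff_derivable dg)). Qed.

Lemma derive_subr (V : normedModType R) (f g : V -> R) (x v : V) : differentiable f x -> differentiable g x ->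
  'D_v (fun y => f y - g y) x = 'D_v f x - 'D_v g x.
Proof. by move=> df dg; exact: (deriveB (diff_derivable df) (diff_derivable dg)). Qed.

Lemma derive_xcoord (k : 'I_n) x v : 'D_v (fun x : 'rV[R]_n => x 0 k) x = v 0 k.
Proof. by rewrite (@derive_coord _ _ _ id)// derive_id. Qed.

Lemma derive_coordM (i j : 'I_n) (P Q : 'rV[R]_n -> R) v :
  differentiable P 0 -> differentiable Q 0 ->
  'D_v (fun x => x 0 i * P x + x 0 j * Q x) 0 = v 0 i * P 0 + v 0 j * Q 0.
Proof.
move=> dP dQ.
have dx k : differentiable (fun x : 'rV[R]_n => x 0 k : R) 0 by exact: differentiable_coord.
have dM k (S : 'rV[R]_n -> R) : differentiable S 0 ->
  differentiable (fun x : 'rV[R]_n => x 0 k * S x) 0 by move=> dS; exact: differentiableM.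
rewrite (derive_addr _ (dM i _ dP) (dM j _ dQ)) (derive_mulr _ (dx i) dP) (derive_mulr _ (dx j) dQ).
by rewrite !derive_xcoord !mxE; ring.
Qed.

(** Identifies the values at 0 of the quotients given by Hadamard's lemma. *)
Lemma derive_quadratic (i j : 'I_n) (A : set 'rV[R]_n) (K a b c : 'rV[R]_n -> R) :
  i != j -> open A -> A 0 -> smooth_on A a -> smooth_on A b -> smooth_on A c ->
  (forall x, A x -> K x = x 0 i ^+ 2 * a x + x 0 i * x 0 j * b x + x 0 j ^+ 2 * c x) ->
  [/\ 'D_'e_i ('D_'e_i K) 0 = 2 * a 0, 'D_'e_j ('D_'e_i K) 0 = b 0
     & 'D_'e_j ('D_'e_j K) 0 = 2 * c 0].
Proof.
move=> ij oA A0 sa sb sc KE.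
have dif F x : smooth_on A F -> A x -> differentiable F x.
  by move=> sF Ax; exact: smooth_on_differentiable sF Ax.
have sx k : smooth_on A (fun x : 'rV[R]_n => x 0 k) by exact: smooth_coord.
have sK' : smooth_on A (fun x => x 0 i * (x 0 i * a x) + (x 0 i * (x 0 j * b x) + x 0 j * (x 0 j * c x))).
  by apply: smoothD => //; [|apply: smoothD => //]; apply: smoothM => //; apply: smoothM.
have DK v x : A x -> 'D_v K x = x 0 i * (v 0 i * a x + (x 0 i * 'D_v a x + v 0 i * a x) +
      (x 0 j * 'D_v b x + b x * v 0 j)) + x 0 j * (v 0 i * b x +
      (x 0 j * 'D_v c x + c x * v 0 j) + c x * v 0 j).
  move=> Ax.
  have -> : 'D_v K x = 'D_v (fun x => x 0 i * (x 0 i * a x) +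
       (x 0 i * (x 0 j * b x) + x 0 j * (x 0 j * c x))) x.
    apply: near_eq_derive; apply: filterS (open_near oA Ax) => y Ay.
    by rewrite KE//; ring.
  have dx k : differentiable (fun x : 'rV[R]_n => x 0 k : R) x by exact: dif.
  have d2 F k : smooth_on A F -> differentiable (fun x : 'rV[R]_n => x 0 k * F x) x.
    by move=> sF; apply: dif => //; exact: smoothM.
  have d3 F k l : smooth_on A F -> differentiable (fun x : 'rV[R]_n => x 0 k * (x 0 l * F x)) x.
    by move=> sF; apply: d2; exact: smoothM.
  rewrite derive_addr; [|exact: d3|by apply: dif => //; apply: smoothD => //; apply: smoothM => //; exact: smoothM].
  rewrite derive_addr; [|exact: d3|exact: d3].
  rewrite !derive_mulr ?derive_xcoord; try by [exact: dx|exact: d2|exact: dif].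
  ring.
have DDK (P Q : 'rV[R]_n -> R) v w : smooth_on A P -> smooth_on A Q ->
    (forall x, A x -> 'D_v K x = x 0 i * P x + x 0 j * Q x) ->
    'D_w ('D_v K) 0 = w 0 i * P 0 + w 0 j * Q 0.
  move=> sP sQ E.
  have -> : 'D_w ('D_v K) 0 = 'D_w (fun x => x 0 i * P x + x 0 j * Q x) 0.
    by apply: near_eq_derive; apply: filterS (open_near oA A0) => y /E.
  by apply: derive_coordM; exact: dif.
have sD F v : smooth_on A F -> smooth_on A ('D_v F) by exact: smooth_onD.
have sP v : smooth_on A (fun x : 'rV[R]_n => v 0 i * a x + (x 0 i * 'D_v a x + v 0 i * a x) +
      (x 0 j * 'D_v b x + b x * v 0 j)).
  by repeat (first [exact: sD|exact: sx|exact: smooth_cst|assumption|apply: smoothD => //|apply: smoothM => //]).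
have sQ v : smooth_on A (fun x : 'rV[R]_n => v 0 i * b x +
      (x 0 j * 'D_v c x + c x * v 0 j) + c x * v 0 j).
  by repeat (first [exact: sD|exact: sx|exact: smooth_cst|assumption|apply: smoothD => //|apply: smoothM => //]).
have ji : (j == i) = false by rewrite eq_sym; exact: negbTE.
by split; rewrite (DDK _ _ _ _ (sP _) (sQ _) (DK _)) !mxE ?eqxx ?ji ?(negbTE ij) /=; ring.
Qed.

(** The restriction of K to x_i = 0 is divisible by x_j twice. The rest is
    divisible by x_i, and its quotient is again split into its restriction to
    x_i = 0, divisible by x_j, and a multiple of x_i. *)
Theorem hadamard2 (i j : 'I_n) (r : R) (K : 'rV[R]_n -> R) : i != j -> 0 < r ->
  smooth_on (ball 0 r) K ->
  (forall x, ball 0 r x -> x 0 i = 0 -> x 0 j = 0 ->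
    [/\ K x = 0, 'D_'e_i K x = 0 & 'D_'e_j K x = 0]) ->
  exists a b c, [/\ smooth_on (ball 0 r) a, smooth_on (ball 0 r) b, smooth_on (ball 0 r) c,
    forall x, ball 0 r x -> K x = x 0 i ^+ 2 * a x + x 0 i * x 0 j * b x + x 0 j ^+ 2 * c x
  & [/\ 'D_'e_i ('D_'e_i K) 0 = 2 * a 0, 'D_'e_j ('D_'e_i K) 0 = b 0
       & 'D_'e_j ('D_'e_j K) 0 = 2 * c 0]].
Proof.
move=> ij r0 sK K0; pose B : set 'rV[R]_n := ball 0 r.
have oB : open B by exact: ball_open.
have B0 : B 0 by exact: ballxx.
have pB x : B x -> B (collapse i 0 x) by apply: star_ball; rewrite lexx ler01.
have pi0 x : collapse i 0 x 0 i = 0 by rewrite collapseE eqxx expr1 mul0r.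
have pij x : collapse i 0 x 0 j = x 0 j by rewrite collapseE eq_sym (negbTE ij) expr0 mul1r.
have pid x : x 0 i = 0 -> collapse i 0 x = x by exact: collapse_id.
(* the restriction of K to x_i = 0, extended so as not to depend on x_i *)
pose Kp x := K (collapse i 0 x).
have sKp : smooth_on B Kp by exact: smooth_comp_collapse.
have [A1 sA1 hA1] := @hadamard_ball i r (fun x => K x - Kp x)
  (smoothB oB sK sKp) (fun x _ xi => ltac:(by rewrite /Kp pid// subrr)).
have DKpi x : 'D_'e_i Kp x = 0.
  by rewrite derive_collapse collapse_delta_same derive0.
have DKpj x : 'D_'e_j Kp x = 'D_'e_j K (collapse i 0 x).
  by rewrite derive_collapse collapse_delta_other.
have [B1 sB1 hB1] := @hadamard_ball j r Kp sKp (fun x Bx xj => ltac:(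
  by rewrite /Kp; have [] := K0 _ (pB _ Bx) (pi0 x) (etrans (pij x) xj))).
have [C sC hC] := @hadamard_ball j r B1 sB1 (fun x Bx xj => ltac:(
  by rewrite (hB1 _ Bx).2// DKpj; have [] := K0 _ (pB _ Bx) (pi0 x) (etrans (pij x) xj))).
pose A1p x := A1 (collapse i 0 x).
have sA1p : smooth_on B A1p by exact: smooth_comp_collapse.
have A1p0 x : B x -> x 0 j = 0 -> A1p x = 0.
  move=> Bx xj; rewrite /A1p (hA1 _ (pB _ Bx)).2//.
  have dK := smooth_on_differentiable sK (pB _ Bx).
  have dKp := smooth_on_differentiable sKp (pB _ Bx).
  by rewrite derive_subr// DKpi subr0; have [] := K0 _ (pB _ Bx) (pi0 x) (etrans (pij x) xj).
have [A2 sA2 hA2] := @hadamard_ball i r (fun x => A1 x - A1p x)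
  (smoothB oB sA1 sA1p) (fun x _ xi => ltac:(by rewrite /A1p pid// subrr)).
have [M sM hM] := @hadamard_ball j r A1p sA1p A1p0.
exists A2, M, C.
have KE x : B x -> K x = x 0 i ^+ 2 * A2 x + x 0 i * x 0 j * M x + x 0 j ^+ 2 * C x.
  move=> Bx; have e1 := (hA1 _ Bx).1; have e2 := (hB1 _ Bx).1; have e3 := (hC _ Bx).1.
  have e4 := (hA2 _ Bx).1; have e5 := (hM _ Bx).1.
  have -> : K x = (K x - Kp x) + Kp x by ring.
  rewrite e1 e2 e3; have -> : A1 x = (A1 x - A1p x) + A1p x by ring.
  by rewrite e4 e5; ring.
split=> //; exact: (derive_quadratic ij oB B0 sA2 sM sC KE).
Qed.

End second_order_hadamard.

(** * Local diffeomorphisms *)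

Section local_diffeo_calculus.
Context {R : realType}.

Lemma continuous_near (V W : normedModType R) (f : V -> W) a (P : set W) :
  {for a, continuous f} -> nbhs (f a) P -> \forall x \near a, P (f x).
Proof. by move=> cf; exact: cf. Qed.

Lemma smooth_open_preimage (V W : normedModType R) (f : V -> W) A B :
  open A -> smooth_on A f -> open B -> open (A `&` f @^-1` B).
Proof.
move=> oA sf oB; rewrite openE => x [Ax Bx]; apply: filterI; first exact: open_near Ax.
exact: (smooth_on_continuous sf Ax) (open_near oB Bx).
Qed.

(** Before composing local diffeomorphisms one has to shrink the domain of the
    first one. *)
Lemma local_diffeo_sub (V W : normedModType R) (f : V -> W) a b (A0 : set V) :
  local_diffeo f a b -> open A0 -> A0 a ->
  exists (g : W -> V) (A : set V) (B : set W),
    [/\ open A /\ A a, open B /\ B b,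
        (forall x, A x -> B (f x) /\ g (f x) = x),
        (forall y, B y -> A (g y) /\ f (g y) = y)
      & [/\ smooth_on A f, smooth_on B g, g b = a & A `<=` A0]].
Proof.
move=> [fab [g [A [B [[oA Aa] [oB Bb] fg gf [sf sg]]]]]] oA0 A0a.
have gb : g b = a by rewrite -fab; exact: (fg _ Aa).2.
exists g, (A `&` A0), (B `&` g @^-1` A0).
have oB' := smooth_open_preimage oB sg oA0.
split.
- by split; [exact: openI|].
- by split=> //; split=> //=; rewrite gb.
- by move=> x [Ax A0x]; have [Bf gfx] := fg _ Ax; do ?split=> //=; rewrite gfx.
- by move=> y [By A0y]; have [Ag fgy] := gf _ By.
- by split=> //; [apply: smooth_on_sub sf|apply: smooth_on_sub sg] => x [].
Qed.

Lemma local_diffeo_inv (V W : normedModType R) (f : V -> W) a b :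
  local_diffeo f a b -> exists2 g, local_diffeo g b a &
    (\forall x \near a, g (f x) = x) /\ (\forall y \near b, f (g y) = y).
Proof.
move=> fab; have [g [A [B [[oA Aa] [oB Bb] fg gf [sf sg gb _]]]]] :=
  local_diffeo_sub fab openT I.
exists g; last first.
  by split; [apply: filterS (open_near oA Aa) => x /fg[]|apply: filterS (open_near oB Bb) => x /gf[]].
exact: local_diffeoI gf fg sg sf.
Qed.

Lemma local_diffeo_comp n m k (f : 'rV[R]_n -> 'rV[R]_m) (g : 'rV[R]_m -> 'rV[R]_k) a b c :
  local_diffeo f a b -> local_diffeo g b c -> local_diffeo (fun x => g (f x)) a c.
Proof.
move=> fab gbc.
have [g' [B [C [[oB Bb] [oC Cc] gg' g'g [sg sg' gc _]]]]] := local_diffeo_sub gbc openT I.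
have [fa _] := fab; have [gb _] := gbc.
have [f0 [A0 [B0 [[oA0 A0a] [oB0 B0b] _ _ [sf0 _ _ _]]]]] := local_diffeo_sub fab openT I.
have oA1 := smooth_open_preimage oA0 sf0 oB.
have A1a : (A0 `&` f @^-1` B) a by split=> //=; rewrite fa.
have [f' [A [B' [[oA Aa] [oB' Bb'] ff' f'f [sf sf' fb AB]]]]] := local_diffeo_sub fab oA1 A1a.
have oC' := smooth_open_preimage oC sg' oB'.
apply: (@local_diffeoI _ _ _ _ (fun y => f' (g' y)) A (C `&` g' @^-1` B')) => //.
- by rewrite fa gb.
- move=> x Ax; have [B'f f'fx] := ff' _ Ax; have [_ Bf] := AB _ Ax.
  by have [Cg g'gx] := gg' _ Bf; split; [split=> //=; rewrite g'gx|rewrite g'gx].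
- move=> y [Cy B'y]; have [Bg gg'y] := g'g _ Cy; have [Af ff'y] := f'f _ B'y.
  by rewrite ff'y.
- by apply: (smooth_comp_rV oA oB _ sf sg) => x /AB[].
- by apply: (smooth_comp_rV oC' oB' _ _ sf') => [x []//|]; apply: smooth_on_sub sg' => x [].
Qed.

Lemma inverse_function_row n (F : 'I_n -> 'rV[R]_n -> R) A a : open A -> A a ->
  (forall j, smooth_on A (F j)) ->
  (\matrix_(i, j) 'D_'e_i (F j) a) \in unitmx ->
  local_diffeo (fun x => \row_j F j x) a (\row_j F j a).
Proof.
move=> oA Aa sF uF; apply: (inverse_function oA Aa).
  apply/(smooth_coordP _ oA) => j; apply: (@eq_smooth_on _ _ _ _ (F j)) => //.
  by move=> x _; rewrite mxE.
rewrite (_ : jac _ a = \matrix_(i, j) 'D_'e_i (F j) a)//.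
by apply/matrixP => i j; rewrite !mxE; congr ('D__ _ a); apply/funext => x; rewrite mxE.
Qed.

Lemma inverse_function_diag n (F : 'I_n -> 'rV[R]_n -> R) A a : open A -> A a ->
  (forall j, smooth_on A (F j)) ->
  (forall i j, i != j -> 'D_'e_i (F j) a = 0) ->
  (forall j, 'D_'e_j (F j) a != 0) ->
  local_diffeo (fun x => \row_j F j x) a (\row_j F j a).
Proof.
move=> oA Aa sF F0 F1; apply: (inverse_function_row oA Aa sF).
rewrite (_ : \matrix_(i, j) _ = diag_mx (\row_j 'D_'e_j (F j) a)).
  rewrite unitmxE det_diag unitfE; apply/prodf_neq0 => j _; rewrite mxE; exact: F1.
apply/matrixP => i j; rewrite !mxE; case: eqVneq => [->|ij]; first by rewrite mulr1n.
by rewrite mulr0n F0.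
Qed.

End local_diffeo_calculus.

(** * Coordinates in dimension three *)

Notation i0 := (0 : 'I_3).
Notation i1 := (1 : 'I_3).
Notation i2 := (2%:R : 'I_3).

Lemma I3P (P : 'I_3 -> Prop) : P i0 -> P i1 -> P i2 -> forall i, P i.
Proof.
move=> P0 P1 P2 [[|[|[|//]]] H].
- by rewrite (_ : Ordinal H = i0)//; exact: val_inj.
- by rewrite (_ : Ordinal H = i1)//; exact: val_inj.
- by rewrite (_ : Ordinal H = i2)//; exact: val_inj.
Qed.

Lemma sum3 (V : nmodType) (F : 'I_3 -> V) : \sum_i F i = F i0 + F i1 + F i2.
Proof.
rewrite !big_ord_recl big_ord0 addr0 addrA.
by congr (F _ + F _ + F _); apply: val_inj.
Qed.

Definition sel3 T (a b c : T) (j : 'I_3) : T :=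
  if j == i0 then a else if j == i1 then b else c.

Lemma sel3_0 T (a b c : T) : sel3 a b c i0 = a. Proof. by []. Qed.
Lemma sel3_1 T (a b c : T) : sel3 a b c i1 = b. Proof. by []. Qed.
Lemma sel3_2 T (a b c : T) : sel3 a b c i2 = c. Proof. by []. Qed.
Definition sel3E := (sel3_0, sel3_1, sel3_2).

(** * The normal form of a fold *)

Section fold.
Context {R : realType}.
Implicit Types (q p v : 'rV[R]_3).

Definition row3 (a b c : R) : 'rV[R]_3 := \row_j sel3 a b c j.

Lemma row3_0 a b c : row3 a b c 0 i0 = a. Proof. by rewrite mxE. Qed.
Lemma row3_1 a b c : row3 a b c 0 i1 = b. Proof. by rewrite mxE. Qed.
Lemma row3_2 a b c : row3 a b c 0 i2 = c. Proof. by rewrite mxE. Qed.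

Lemma row3_eq p q : p 0 i0 = q 0 i0 -> p 0 i1 = q 0 i1 -> p 0 i2 = q 0 i2 -> p = q.
Proof. by move=> h0 h1 h2; apply/rowP; exact: I3P. Qed.

(** A function of the third coordinate alone is encoded as a function F of three
    coordinates applied to axis q. *)
Definition axis q : 'rV[R]_3 := row3 0 0 (q 0 i2).

Lemma axis_linear : linear axis.
Proof.
move=> k x y; apply: row3_eq; rewrite !(mxE, sel3E)//; ring.
Qed.

Lemma axisK q : axis (axis q) = axis q.
Proof. by rewrite /axis row3_2. Qed.

Lemma axis0 : axis 0 = 0.
Proof. by apply: row3_eq; rewrite !(mxE, sel3E). Qed.

Lemma derive_axis (W : normedModType R) (F : 'rV[R]_3 -> W) v q :
  'D_v (fun q => F (axis q)) q = 'D_(axis v) F (axis q).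
Proof.
have := @derive_affine _ _ _ _ F (mklin axis_linear) 0 v q; rewrite /= addr0 => <-.
by congr ('D_v _ q); apply/funext => y; rewrite addr0.
Qed.

Lemma smooth_axis A : smooth_on A axis.
Proof. by apply: smooth_linear; [exact: axis_linear|exact/linear_rV_continuous/axis_linear]. Qed.

Lemma axis_e0 : axis 'e_i0 = 0. Proof. by apply: row3_eq; rewrite !(mxE, sel3E). Qed.
Lemma axis_e1 : axis 'e_i1 = 0. Proof. by apply: row3_eq; rewrite !(mxE, sel3E). Qed.

Lemma ball_axis (r : R) q : ball 0 r q -> ball 0 r (axis q).
Proof.
rewrite -!ball_normE /= !sub0r !normrN; apply: le_lt_trans.
by apply: norm_rV_le => //; apply: I3P; rewrite mxE sel3E ?normr0// coord_le_norm.
Qed.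

Lemma derive_composite (g : 'rV[R]_3 -> 'rV[R]_3) (F : 'rV[R]_3 -> R) a v :
  differentiable g a -> differentiable F (g a) ->
  'D_v (fun q => F (g q)) a = 'D_v (fun q => g q 0 i0) a * 'D_'e_i0 F (g a) +
     'D_v (fun q => g q 0 i1) a * 'D_'e_i1 F (g a) +
     'D_v (fun q => g q 0 i2) a * 'D_'e_i2 F (g a).
Proof. by move=> dg dF; have := derive_comp v dg dF; rewrite sum3. Qed.

Lemma derive_composite_val (g : 'rV[R]_3 -> 'rV[R]_3) (F : 'rV[R]_3 -> R) a b v d0 d1 d2 :
  differentiable g a -> g a = b -> differentiable F b ->
  'D_'e_i0 F b = d0 -> 'D_'e_i1 F b = d1 -> 'D_'e_i2 F b = d2 ->
  'D_v (fun q => F (g q)) a = 'D_v (fun q => g q 0 i0) a * d0 +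
     'D_v (fun q => g q 0 i1) a * d1 + 'D_v (fun q => g q 0 i2) a * d2.
Proof. by move=> dg <- dF <- <- <-; exact: derive_composite. Qed.

(** The map (D_0 f, D_1 f, z) is a local diffeomorphism, and c is its inverse
    on the third axis. As the Hessian is diagonal, c is tangent to this axis. *)
Lemma critical_curve (f : 'rV[R]_3 -> R) A (h : 'I_3 -> R) : open A -> A 0 ->
  smooth_on A f -> (forall j, 'D_'e_j f 0 = 0) ->
  (forall i j, 'D_'e_i ('D_'e_j f) 0 = if i == j then h j else 0) ->
  (forall j, h j != 0) ->
  exists (c : 'rV[R]_3 -> 'rV[R]_3) C, [/\ open C /\ C 0, smooth_on C c, c 0 = 0,
    (forall q, c (axis q) = c q) &
    [/\ forall q, C q -> [/\ C (axis q), A (c q), 'D_'e_i0 f (c q) = 0,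
                             'D_'e_i1 f (c q) = 0 & c q 0 i2 = q 0 i2] &
        forall v, 'D_v (fun q => c q 0 i0) 0 = 0 /\ 'D_v (fun q => c q 0 i1) 0 = 0]].
Proof.
move=> oA A0 sf f0 hE h0.
pose F1 : 'I_3 -> 'rV[R]_3 -> R := sel3 ('D_'e_i0 f) ('D_'e_i1 f) (fun q => q 0 i2).
have sF1 j : smooth_on A (F1 j) by move: j; apply: I3P; rewrite /F1 sel3E; smooth_auto.
have D1 i j : 'D_'e_i (F1 j) 0 = if i == j then sel3 (h i0) (h i1) 1 j else 0.
  move: j; apply: I3P; rewrite /F1 sel3E ?sel3E ?hE//.
  by rewrite derive_xcoord mxE eqxx eq_sym; case: eqP.
have := inverse_function_diag oA A0 sF1.
have -> : \row_j F1 j 0 = 0.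
  by apply: row3_eq; rewrite !mxE /F1 ?sel3E ?f0 ?mxE.
move=> /(_ _ _) LD; have {LD} : local_diffeo (fun x => \row_j F1 j x) 0 0.
  apply: LD; first by move=> i j ij; rewrite D1 (negbTE ij).
  by apply: I3P; rewrite D1 eqxx ?sel3E ?oner_neq0.
move=> /local_diffeo_sub /(_ oA A0)[g [A' [B [[oA' A'0] [oB B0] _ gK [_ sg g0 A'A]]]]].
pose c q := g (axis q); pose C := [set q | B (axis q)].
have oC : open C.
  have := smooth_open_preimage openT (@smooth_axis setT) oB; rewrite setTI; exact.
have sc : smooth_on C c.
  by apply: (smooth_comp_rV oC oB _ (@smooth_axis C) sg) => q.
have cP q : C q -> [/\ C (axis q), A (c q), 'D_'e_i0 f (c q) = 0,
                             'D_'e_i1 f (c q) = 0 & c q 0 i2 = q 0 i2].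
  move=> Cq; have [A'c cE] := gK _ Cq; split=> //.
  - by rewrite /C /= axisK.
  - exact: A'A.
  - by have := congr1 (fun z : 'rV[R]_3 => z 0 i0) cE; rewrite mxE /F1 sel3E row3_0.
  - by have := congr1 (fun z : 'rV[R]_3 => z 0 i1) cE; rewrite mxE /F1 sel3E row3_1.
  - by have := congr1 (fun z : 'rV[R]_3 => z 0 i2) cE; rewrite mxE /F1 sel3E row3_2.
exists c, C; split=> //.
- by split=> //; rewrite /C /= axis0.
- by rewrite /c axis0.
- by move=> q; rewrite /c axisK.
split=> // v.
have C0 : C 0 by rewrite /C /= axis0.
have c0 : c 0 = 0 by rewrite /c axis0.
have dc : differentiable c 0 by exact: smooth_on_differentiable sc C0.
have dD j : differentiable ('D_'e_j f) 0.
  by apply: smooth_on_differentiable A0; exact: smooth_onD.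
have E j : 'D_v (fun q => 'D_'e_j f (c q)) 0 = h j * 'D_v (fun q => c q 0 j) 0.
  rewrite (derive_composite_val v dc c0 (dD j) (hE i0 j) (hE i1 j) (hE i2 j)).
  by move: j {dD}; apply: I3P => /=; ring.
have Z j : (forall q, C q -> 'D_'e_j f (c q) = 0) -> 'D_v (fun q => c q 0 j) 0 = 0.
  move=> Hj; apply/eqP; have := E j.
  have -> : 'D_v (fun q => 'D_'e_j f (c q)) 0 = 'D_v (fun=> 0 : R) 0.
    by apply: near_eq_derive; apply: filterS (open_near oC C0) => q /Hj.
  by rewrite derive_cst => /esym/eqP; rewrite mulf_eq0 (negbTE (h0 j)).
by split; apply: Z => q /cP[].
Qed.

(** With r = |H| one has r z^2 H = sgn H (r z)^2. The factor r in front of the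
    squares in the two other coordinates is absorbed by its square root. *)
Lemma complete_square (r0 : R) (a b c H : 'rV[R]_3 -> R) : 0 < r0 ->
  smooth_on (ball 0 r0) a -> smooth_on (ball 0 r0) b -> smooth_on (ball 0 r0) c ->
  smooth_on (ball 0 r0) H -> a 0 != 0 -> b 0 = 0 -> c 0 != 0 -> H 0 != 0 ->
  exists Phi : 'rV[R]_3 -> 'rV[R]_3, [/\ local_diffeo Phi 0 0,
    (\forall q \near 0, 0 < Num.sg (H 0) * H (axis q)) &
    \forall q \near 0, let r := Num.sg (H 0) * H (axis q) in
      [/\ r * (q 0 i0 ^+ 2 * a q + q 0 i0 * q 0 i1 * b q + q 0 i1 ^+ 2 * c q +
               q 0 i2 ^+ 2 * H (axis q)) =
          Num.sg (a 0) * Phi q 0 i0 ^+ 2 + Num.sg (c 0) * Phi q 0 i1 ^+ 2 +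
          Num.sg (H 0) * Phi q 0 i2 ^+ 2
        & r * q 0 i2 = Phi q 0 i2]].
Proof.
move=> r0_gt0 sa sb sc sH a0 b0 c0 H0.
pose e (t : R) := Num.sg t; pose B : set 'rV[R]_3 := ball 0 r0.
have oB : open B by exact: ball_open.
have B0 : B 0 by exact: ballxx.
have e2 t : t != 0 -> e t * e t = 1 by move=> t0; rewrite -expr2 sqr_sg t0.
have et t : t != 0 -> 0 < e t * t by move=> t0; rewrite -normrEsg normr_gt0.
pose r q := e (H 0) * H (axis q).
have sr : smooth_on B r.
  apply: smoothM => //; first exact: smooth_cst.
  by apply: (smooth_comp oB _ (@smooth_axis B) sH) => q; exact: ball_axis.
have r0E : 0 < r 0 by rewrite /r axis0; exact: et.
(* U is where all the quantities under the square roots are positive *)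
pose sa' q := e (a 0) * a q.
have ssa' : smooth_on B sa' by apply: smoothM => //; exact: smooth_cst.
pose U := B `&` sa' @^-1` [set t | 0 < t].
have oU : open U by apply: smooth_open_preimage => //; exact: open_gt.
have U0 : U 0 by split=> //; exact: et.
have UB : U `<=` B by move=> q [].
have aU q : U q -> a q != 0.
  move=> [_]; rewrite /sa' /= => h; apply/eqP => aq; move: h; rewrite aq mulr0 ltxx//.
have sU (F : 'rV[R]_3 -> R) : smooth_on B F -> smooth_on U F by exact: smooth_on_sub.
pose ia q := (2 * a q)^-1.
have sia : smooth_on U ia.
  apply: smoothV => //.
    by move=> q /aU; rewrite mulf_eq0 negb_or pnatr_eq0.
  by apply: smoothM => //; [exact: smooth_cst|exact: sU].
pose d q := e (c 0) * (c q - b q * b q * ia q * 2^-1).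
have sd : smooth_on U d.
  have := sU _ sb; have := sU _ sc => ? ?; rewrite /d; smooth_auto.
pose V := U `&` d @^-1` [set t | 0 < t] `&` r @^-1` [set t | 0 < t].
have oV : open V.
  apply: smooth_open_preimage; [|apply: smooth_on_sub (sU _ sr) => q []//|exact: open_gt].
  by apply: smooth_open_preimage => //; exact: open_gt.
have V0 : V 0.
  split=> //; split=> //=; rewrite /d b0 !mul0r subr0; exact: et.
have VU : V `<=` U by move=> q [[]].
have sV (F : 'rV[R]_3 -> R) : smooth_on U F -> smooth_on V F by exact: smooth_on_sub.
pose S1 q := Num.sqrt (r q * sa' q); pose S2 q := Num.sqrt (r q * d q).
have sS1 : smooth_on V S1.
  apply: smooth_sqrt => //; first by move=> q [[[_ h1] _] h2]; exact: mulr_gt0.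
  by apply: smoothM => //; apply: sV; exact: sU.
have sS2 : smooth_on V S2.
  apply: smooth_sqrt => //; first by move=> q [[_ h1] h2]; exact: mulr_gt0.
  by apply: smoothM => //; apply: sV => //; exact: sU.
pose M q := S1 q * (b q * ia q).
have sM : smooth_on V M.
  by apply: smoothM => //; apply: smoothM => //; apply: sV => //; exact: sU.
have sr' : smooth_on V r by apply/sV/sU.
pose F2 : 'I_3 -> 'rV[R]_3 -> R := sel3 (fun q => q 0 i0 * S1 q + q 0 i1 * M q)
   (fun q => q 0 i1 * S2 q + q 0 i1 * 0) (fun q => q 0 i2 * r q + q 0 i2 * 0).
have sF2 j : smooth_on V (F2 j).
  by move: j; apply: I3P; rewrite /F2 sel3E; smooth_auto.
have dif (F : 'rV[R]_3 -> R) : smooth_on V F -> differentiable F 0 by move=> sF; exact: smooth_on_differentiable V0.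
have M0 : M 0 = 0 by rewrite /M b0 mul0r mulr0.
have D2 i j : 'D_'e_i (F2 j) 0 = if i == j then sel3 (S1 0) (S2 0) (r 0) j else 0.
  move: j; apply: I3P; rewrite /F2 ?sel3E.
  - rewrite derive_coordM; try exact: dif.
    rewrite M0 !mxE eqxx /= mulr0 addr0 eq_sym; case: eqP => _; by rewrite ?mul1r ?mul0r.
  - rewrite derive_coordM ?mulr0 ?addr0; [|exact: dif|exact: differentiable_cst].
    rewrite !mxE eqxx /= eq_sym; case: eqP => _; by rewrite ?mul1r ?mul0r.
  - rewrite derive_coordM ?mulr0 ?addr0; [|exact: dif|exact: differentiable_cst].
    rewrite !mxE eqxx /= eq_sym; case: eqP => _; by rewrite ?mul1r ?mul0r.
exists (fun q => \row_j F2 j q); split.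
- have E0 : \row_j F2 j 0 = 0.
    by apply: row3_eq; rewrite !mxE /F2 ?sel3E ?mxE ?mul0r ?addr0.
  rewrite -[X in local_diffeo _ _ X]E0; apply: (inverse_function_diag oV V0 sF2).
    by move=> i j ij; rewrite D2 (negbTE ij).
  apply: I3P; rewrite D2 eqxx ?sel3E gt_eqF// sqrtr_gt0 mulr_gt0//.
    exact: et.
  by have [[_ +] _] := V0.
- by apply: filterS (open_near oV V0) => q [].
apply: filterS (open_near oV V0) => q Vq /=.
have [[Uq dq] rq] := Vq; have aq := aU _ Uq; have [_ saq] := Uq.
rewrite !mxE /F2 !sel3E !mulr0 !addr0; split; last by rewrite mulrC.
have Sq1 : S1 q ^+ 2 = r q * sa' q by rewrite sqr_sqrtr// ltW// mulr_gt0.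
have Sq2 : S2 q ^+ 2 = r q * d q by rewrite sqr_sqrtr// ltW// mulr_gt0.
have -> : q 0 i0 * S1 q + q 0 i1 * M q = S1 q * (q 0 i0 + q 0 i1 * (b q * ia q)).
  by rewrite /M; ring.
set X := q 0 i0 + q 0 i1 * (b q * ia q).
have -> : Num.sg (a 0) * (S1 q * X) ^+ 2 = (e (a 0) * e (a 0)) * (r q * a q * X ^+ 2).
  by rewrite exprMn Sq1 /sa' -/(e (a 0)); ring.
have -> : Num.sg (c 0) * (q 0 i1 * S2 q) ^+ 2 =
   (e (c 0) * e (c 0)) * (r q * (c q - b q * b q * ia q * 2^-1) * q 0 i1 ^+ 2).
  by rewrite exprMn Sq2 /d -/(e (c 0)); ring.
have -> : Num.sg (H 0) * (q 0 i2 * r q) ^+ 2 =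
    (e (H 0) * e (H 0)) * (r q * (q 0 i2 ^+ 2 * H (axis q))).
  by rewrite exprMn [r q ^+ 2]expr2 {2}/r -/(e (H 0)); ring.
rewrite -/(e (H 0)) -/(r q) !e2// /X /ia; field.
exact: aq.
Qed.

(** In each plane z = const., f has a critical point near 0. Once these points
    have been moved to the third axis, f minus its value at the critical point is
    quadratic in the two first coordinates by Hadamard's lemma, and the critical
    value is z^2 H(z). The multiplier rho = |H| depends on z only: it is what a
    radial transformation can undo, and what turns H into a sign. *)
Theorem fold_form (f : 'rV[R]_3 -> R) A (h : 'I_3 -> R) : open A -> A 0 ->
  smooth_on A f -> f 0 = 0 -> (forall j, 'D_'e_j f 0 = 0) ->
  (forall i j, 'D_'e_i ('D_'e_j f) 0 = if i == j then h j else 0) ->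
  (forall j, h j != 0) ->
  exists (sigma : 'rV[R]_3 -> 'rV[R]_3) (rho : 'rV[R]_3 -> R) U,
    [/\ local_diffeo sigma 0 0, [/\ open U, U 0 & smooth_on U rho],
        (forall q, rho (axis q) = rho q),
        (\forall q \near 0, 0 < rho q) &
        \forall p \near 0, rho (sigma p) * f (sigma p) =
            Num.sg (h i0) * p 0 i0 ^+ 2 + Num.sg (h i1) * p 0 i1 ^+ 2 +
            Num.sg (h i2) * p 0 i2 ^+ 2 /\
          rho (sigma p) * sigma p 0 i2 = p 0 i2].
Proof.
move=> oA A0 sf f0 Df hE h0.
have [c [C [[oC C0] sc c0 cax [cP Dc0]]]] := critical_curve oA A0 sf Df hE h0.
(* s maps the third axis onto the curve c *)
pose s q := q + (c q - axis q).
have ss : smooth_on C s.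
  apply/(smooth_coordP _ oC) => i.
  apply: (@eq_smooth_on _ _ _ _ (fun q => q 0 i + (c q 0 i - axis q 0 i))) => //.
    by move=> q _; rewrite !mxE.
  have := (smooth_coordP _ oC).1 sc i => sci.
  have := (smooth_coordP _ oC).1 (@smooth_axis C) i => saxi.
  by smooth_auto.
have s0 : s 0 = 0 by rewrite /s c0 axis0 subrr addr0.
have s_axis q : C q -> s q 0 i2 = q 0 i2.
  by move=> /cP[_ _ _ _ E]; rewrite /s !mxE E sel3E subrr addr0.
have [r0 r0_gt0 r0C] : exists2 r0 : R, 0 < r0 & ball 0 r0 `<=` C `&` s @^-1` A.
  have oD := smooth_open_preimage oC ss oA.
  have /nbhs_ballP[r /= r_gt0 Hr] : nbhs 0 (C `&` s @^-1` A).
    by apply: (open_near oD); split=> //=; rewrite s0.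
  by exists r.
pose B : set 'rV[R]_3 := ball 0 r0.
have oB : open B by exact: ball_open.
have B0 : B 0 by exact: ballxx.
have BC q : B q -> C q by move=> /r0C[].
have BsA q : B q -> A (s q) by move=> /r0C[].
have BcA q : B q -> A (c q) by move=> /BC/cP[].
have ssB : smooth_on B s by exact: smooth_on_sub ss.
have scB : smooth_on B c by exact: smooth_on_sub sc.
have ds q : B q -> differentiable s q by move=> Bq; exact: smooth_on_differentiable ssB Bq.
have dcB q : B q -> differentiable c q by move=> Bq; exact: smooth_on_differentiable scB Bq.
pose F q := f (s q); pose G q := f (c q); pose K q := F q - G q.
have sF : smooth_on B F by exact: (smooth_comp oB BsA ssB sf).
have sG : smooth_on B G by exact: (smooth_comp oB BcA scB sf).
have sK : smooth_on B K by exact: smoothB.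
have dif (H : 'rV[R]_3 -> R) q : smooth_on B H -> B q -> differentiable H q.
  by move=> sH Bq; exact: smooth_on_differentiable sH Bq.
have difA (H : 'rV[R]_3 -> R) q : smooth_on A H -> A q -> differentiable H q.
  by move=> sH Aq; exact: smooth_on_differentiable sH Aq.
have sDf j : smooth_on A ('D_'e_j f) by exact: smooth_onD.
have cE : c = (fun q => c (axis q)) by apply/funext => q; rewrite cax.
have Dc_axial v q k : axis v = 0 -> 'D_v (fun q => c q 0 k) q = 0.
  move=> v0; rewrite cE (derive_axis (fun q => c q 0 k)) v0; exact: derive0.
have Ds v q k : B q -> 'D_v (fun q => s q 0 k) q =
    v 0 k + ('D_v (fun q => c q 0 k) q - axis v 0 k).
  move=> Bq; have -> : (fun q => s q 0 k) = (fun q => q 0 k + (c q 0 k - axis q 0 k)).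
    by apply/funext => y; rewrite !mxE.
  have d1 : differentiable (fun q : 'rV[R]_3 => q 0 k : R) q by exact: differentiable_coord.
  have d2 : differentiable (fun q => c q 0 k) q.
    by apply: dif => //; exact: ((smooth_coordP _ oB).1 scB).
  have d3 : differentiable (fun q : 'rV[R]_3 => axis q 0 k) q.
    by apply: dif => //; exact: ((smooth_coordP _ oB).1 (@smooth_axis B)).
  rewrite (derive_addr v d1 (differentiableB d2 d3)) (derive_subr v d2 d3) derive_xcoord.
  by rewrite (derive_axis (fun q : 'rV[R]_3 => q 0 k)) derive_xcoord.
have Ds_planar v q k : B q -> axis v = 0 -> 'D_v (fun q => s q 0 k) q = v 0 k.
  by move=> Bq v0; rewrite Ds// Dc_axial// v0 mxE subr0 addr0.
have DG_planar v q : axis v = 0 -> 'D_v G q = 0.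
  move=> v0; rewrite (_ : G = fun q => f (c (axis q))); last first.
    by apply/funext => y; rewrite cax.
  by rewrite (derive_axis (fun q => f (c q))) v0; exact: derive0.
have comp_s (H : 'rV[R]_3 -> R) v q : smooth_on A H -> B q -> axis v = 0 ->
  'D_v (fun q => H (s q)) q = v 0 i0 * 'D_'e_i0 H (s q) + v 0 i1 * 'D_'e_i1 H (s q).
  move=> sH Bq v0.
  rewrite (derive_composite_val v (ds _ Bq) erefl (difA _ _ sH (BsA _ Bq)) erefl erefl erefl).
  rewrite (Ds_planar _ _ i0 Bq v0) (Ds_planar _ _ i1 Bq v0) (Ds_planar _ _ i2 Bq v0).
  have -> : v 0 i2 = 0 by rewrite -(row3_2 0 0 (v 0 i2)) -/(axis v) v0 mxE.
  by rewrite mul0r addr0.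
have DK0 q : B q -> 'D_'e_i0 K q = 'D_'e_i0 f (s q).
  move=> Bq; rewrite (derive_subr _ (dif _ _ sF Bq) (dif _ _ sG Bq)).
  rewrite (DG_planar _ _ axis_e0) subr0 (comp_s _ _ _ sf Bq axis_e0).
  by rewrite !mxE /= mul1r mul0r addr0.
have DK1 q : B q -> 'D_'e_i1 K q = 'D_'e_i1 f (s q).
  move=> Bq; rewrite (derive_subr _ (dif _ _ sF Bq) (dif _ _ sG Bq)).
  rewrite (DG_planar _ _ axis_e1) subr0 (comp_s _ _ _ sf Bq axis_e1).
  by rewrite !mxE /= mul1r mul0r add0r.
have K0 q : B q -> q 0 i0 = 0 -> q 0 i1 = 0 ->
    [/\ K q = 0, 'D_'e_i0 K q = 0 & 'D_'e_i1 K q = 0].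
  move=> Bq q0 q1.
  have qax : axis q = q by apply: row3_eq; rewrite !mxE ?sel3E ?q0 ?q1.
  have sc' : s q = c q by rewrite /s qax addrC subrK.
  have [_ _ c1 c2 _] := cP _ (BC _ Bq).
  by rewrite DK0// DK1// sc' c1 c2 /K /F /G sc' subrr.
have [a [b [d [sa sb sd KE [Ka Kb Kd]]]]] :=
  @hadamard2 R 3 i0 i1 r0 K isT r0_gt0 sK K0.
have DD v j : axis v = 0 -> 'D_v ('D_'e_j K) 0 = 'D_v (fun q => 'D_'e_j f (s q)) 0 ->
   'D_v ('D_'e_j K) 0 = v 0 i0 * (if i0 == j then h j else 0) +
                        v 0 i1 * (if i1 == j then h j else 0).
  by move=> v0 ->; rewrite (comp_s _ _ _ (sDf j) B0 v0) s0 (hE i0 j) (hE i1 j).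
have nearB (H1 H2 : 'rV[R]_3 -> R) v : (forall q, B q -> H1 q = H2 q) -> 'D_v H1 0 = 'D_v H2 0.
  by move=> E; apply: near_eq_derive; apply: filterS (open_near oB B0) => q /E.
have a0 : 2 * a 0 = h i0.
  have := etrans (esym Ka) (DD 'e_i0 i0 axis_e0 (nearB _ _ 'e_i0 DK0)).
  by rewrite !mxE /= mul1r mul0r addr0.
have b0 : b 0 = 0.
  have := etrans (esym Kb) (DD 'e_i1 i0 axis_e1 (nearB _ _ 'e_i1 DK0)).
  by rewrite !mxE /= mul1r mul0r add0r.
have d0 : 2 * d 0 = h i1.
  have := etrans (esym Kd) (DD 'e_i1 i1 axis_e1 (nearB _ _ 'e_i1 DK1)).
  by rewrite !mxE /= mul1r mul0r add0r.
(* G and its derivative vanish where z = 0, so that z divides G twice *)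
have Dc2 q : B q -> 'D_'e_i2 (fun q => c q 0 i2) q = 1.
  move=> Bq; have E : 'D_'e_i2 (fun q : 'rV[R]_3 => q 0 i2) q = 1 by rewrite derive_xcoord mxE.
  apply: etrans _ E.
  by apply: near_eq_derive; apply: filterS (open_near oB Bq) => y /BC/cP[].
have DG q : B q -> 'D_'e_i2 G q = 'D_'e_i2 f (c q).
  move=> Bq; have [_ _ c1 c2 _] := cP _ (BC _ Bq).
  rewrite (derive_composite_val 'e_i2 (dcB _ Bq) erefl (difA _ _ sf (BcA _ Bq)) c1 c2 erefl).
  by rewrite !mulr0 !add0r Dc2// mul1r.
have cx0 q : q 0 i2 = 0 -> c q = 0.
  move=> q2; rewrite -cax (_ : axis q = 0) ?c0//.
  by apply: row3_eq; rewrite !mxE ?sel3E ?q2.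
have G00 q : B q -> q 0 i2 = 0 -> G q = 0 by move=> _ q2; rewrite /G (cx0 _ q2).
have [G1 sG1 hG1] := hadamard_ball sG G00.
have G10 q : B q -> q 0 i2 = 0 -> G1 q = 0.
  by move=> Bq q2; rewrite ((hG1 _ Bq).2 q2) (DG _ Bq) (cx0 _ q2).
have [H sH hH] := hadamard_ball sG1 G10.
have GE q : B q -> G q = q 0 i2 ^+ 2 * H q.
  by move=> Bq; rewrite (hG1 _ Bq).1 (hH _ Bq).1; ring.
have H0 : 2 * H 0 = h i2.
  have s00 : smooth_on B (fun=> 0 : R) by exact: smooth_cst.
  have [] := @derive_quadratic R 3 i2 i0 B G H (fun=> 0) (fun=> 0) isT oB B0 sH s00 s00.
    by move=> q Bq; rewrite GE// !mulr0 !addr0.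
  move=> <- _ _; rewrite (nearB _ _ 'e_i2 DG).
  rewrite (derive_composite_val 'e_i2 (dcB _ B0) c0 (difA _ _ (sDf i2) A0)
     (hE i0 i2) (hE i1 i2) (hE i2 i2)).
  by rewrite /= !mulr0 !add0r Dc2// mul1r.
have GaxE q : B q -> G q = q 0 i2 ^+ 2 * H (axis q).
  move=> Bq; have := GE _ (ball_axis Bq); rewrite row3_2 => <-.
  by rewrite /G cax.
have half (t u : R) : 2 * t = u -> u != 0 -> t != 0 /\ Num.sg t = Num.sg u.
  move=> <-; rewrite mulf_eq0 negb_or pnatr_eq0 /= => ->; split=> //.
  by rewrite sgrM [Num.sg 2]gtr0_sg// mul1r.
have [a0' sga] := half _ _ a0 (h0 i0); have [d0' sgd] := half _ _ d0 (h0 i1).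
have [H0' sgH] := half _ _ H0 (h0 i2).
have [Phi [LPhi rpos PhiE]] := complete_square r0_gt0 sa sb sd sH a0' b0 d0' H0'.
pose rho q := Num.sg (H 0) * H (axis q).
have Ls : local_diffeo s 0 0.
  have Ds0 v k : 'D_v (fun q => s q 0 k) 0 = v 0 k.
    rewrite (Ds v 0 k B0); move: k; apply: I3P.
    - by rewrite (Dc0 v).1 mxE sel3E subr0 addr0.
    - by rewrite (Dc0 v).2 mxE sel3E subr0 addr0.
    - have -> : 'D_v (fun q => c q 0 i2) 0 = v 0 i2.
        rewrite -(derive_xcoord i2 0 v); apply: near_eq_derive.
        by apply: filterS (open_near oB B0) => y /BC/cP[].
      by rewrite mxE sel3E subrr addr0.
  have := @inverse_function_diag R 3 (fun j q => s q 0 j) B 0 oB B0.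
  have sE : (fun x => \row_j s x 0 j) = s by apply/funext => q; apply/rowP => j; rewrite mxE.
  rewrite sE (_ : \row_j s 0 0 j = 0); last by rewrite s0; apply/rowP => j; rewrite !mxE.
  apply.
  - by move=> j; exact: ((smooth_coordP _ oB).1 ssB).
  - by move=> i j ij; rewrite Ds0 mxE eqxx eq_sym (negbTE ij).
  - by move=> j; rewrite Ds0 mxE !eqxx oner_neq0.
have [g Lg [_ gK]] := local_diffeo_inv LPhi.
exists (fun p => s (g p)), rho, B; split.
- exact: local_diffeo_comp Lg Ls.
- split=> //; apply: smoothM => //; first exact: smooth_cst.
  by apply: (smooth_comp oB _ (@smooth_axis B) sH) => q; exact: ball_axis.
- by move=> q; rewrite /rho axisK.
- exact: rpos.
have g0 : g 0 = 0 by have [] := Lg.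
have cg : {for 0, continuous g}.
  have [g' [A' [B' [[_ ?] _ _ _ [sg _ _ _]]]]] := local_diffeo_sub Lg openT I.
  exact: smooth_on_continuous sg _.
have near_g (P : set 'rV[R]_3) : nbhs 0 P -> \forall p \near 0, P (g p).
  by move=> nP; apply: (continuous_near cg); rewrite g0.
apply: filterS3 (near_g _ (open_near oB B0)) (near_g _ PhiE) gK => p Bg [E1 E2] gKp.
have ax_s : axis (s (g p)) = axis (g p) by rewrite /axis s_axis//; exact: BC.
rewrite /rho ax_s s_axis; last exact: BC.
rewrite E2 gKp; split=> //.
rewrite -/(F (g p)) (_ : F (g p) = K (g p) + G (g p)); last by rewrite /K subrK.
by rewrite KE// GaxE// E1 gKp sga sgd sgH.
Qed.

End fold.

(** * Symmetry of second derivatives *)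

Section schwarz.
Context {R : realType}.

Lemma dist_le_halves (P Q p q e : R) : p = q ->
  `|P - p| < e / 2 -> `|Q - q| < e / 2 -> `|P - Q| <= e.
Proof. by move=> ->; rewrite !ltr_norml ler_norml; lra. Qed.

Lemma derive_translate (V W : normedModType R) (f : V -> W) b v x :
  'D_v (fun y => f (y + b)) x = 'D_v f (x + b).
Proof.
have lid : linear (@id V) by [].
exact: (@derive_affine R V V W f (mklin lid) b v x).
Qed.

Lemma derive_scalev (V : normedModType R) (f : V -> R) k u x : differentiable f x ->
  'D_(k *: u) f x = k * 'D_u f x.
Proof. by move=> df; rewrite !deriveE// linearZ. Qed.

(** Two applications of the mean value theorem to a second difference, an
    expression symmetric in v and w. *)
Lemma second_difference (V : normedModType R) (f : V -> R) (A : set V) a v w :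
  (forall s t : R, 0 <= s <= 1 -> 0 <= t <= 1 -> A (t *: w + (s *: v + a))) ->
  smooth_on A f -> exists s t : R, [/\ 0 <= s <= 1, 0 <= t <= 1 &
    f (w + (v + a)) - f (v + a) - (f (w + a) - f a) =
    'D_w ('D_v f) (t *: w + (s *: v + a))].
Proof.
move=> hA sf.
have h0 : 0 <= (0 : R) <= 1 by rewrite lexx ler01.
have h1 : 0 <= (1 : R) <= 1 by rewrite lexx ler01.
pose fw y := f (y + w).
have lid : linear (@id V) by [].
have df s : 0 <= s <= 1 -> differentiable f (s *: v + a).
  move=> s01; apply: smooth_on_differentiable sf _.
  by have := hA s 0 s01 h0; rewrite scale0r add0r.
have dfw s : 0 <= s <= 1 -> differentiable fw (s *: v + a).
  move=> s01; apply: (@smooth_on_differentiable _ _ _ [set x | A (x + w)]).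
    apply: (@smooth_on_affine _ _ _ _ A f (mklin lid) w) => // x; exact: cvg_id.
  by have := hA s 1 s01 h1; rewrite scale1r addrC.
have dg s : 0 <= s <= 1 -> differentiable (fun y => fw y - f y) (s *: v + a).
  by move=> s01; exact: differentiableB (dfw _ s01) (df _ s01).
have [s s01 gE] := mean_value_segment dg.
have DgE : 'D_v (fun y => fw y - f y) (s *: v + a) = 'D_v f (s *: v + a + w) - 'D_v f (s *: v + a).
  by rewrite (derive_subr v (dfw _ s01) (df _ s01)); congr (_ - _); exact: derive_translate.
have dDv (t : R) : 0 <= t <= 1 -> differentiable ('D_v f) (t *: w + (s *: v + a)).
  by move=> t01; apply: smooth_on_differentiable (hA s t s01 t01); exact: smooth_onD.
have [t t01 E] := mean_value_segment dDv.
exists s, t; split=> //.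
rewrite -E; move: gE; rewrite DgE /fw => gE.
by rewrite (addrC w (v + a)) (addrC w a) gE (addrC w).
Qed.

(** At small scale k, both mixed derivatives are close to the same second
    difference divided by k^2. *)
Theorem schwarz n (f : 'rV[R]_n -> R) A a v w : open A -> A a -> smooth_on A f ->
  'D_w ('D_v f) a = 'D_v ('D_w f) a.
Proof.
move=> oA Aa sf; apply/eqP; rewrite -subr_eq0 -normr_le0; apply/ler_addgt0Pl => e e0.
rewrite addr0.
have [sWV sVW] : smooth_on A ('D_w ('D_v f)) /\ smooth_on A ('D_v ('D_w f)).
  by split; do 2!apply: smooth_onD.
have e2 : 0 < e / 2 by exact: divr_gt0.
have n1 : \forall z \near a, A z /\ `|'D_w ('D_v f) a - 'D_w ('D_v f) z| < e / 2 /\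
     `|'D_v ('D_w f) a - 'D_v ('D_w f) z| < e / 2.
  move/cvgrPdist_lt : (smooth_on_continuous sWV Aa) => /(_ _ e2) c1.
  move/cvgrPdist_lt : (smooth_on_continuous sVW Aa) => /(_ _ e2) c2.
  apply: filterS3 (open_near oA Aa) c1 c2 => z h1 h2 h3; exact: conj h1 (conj h2 h3).
have /nbhs_ballP[r /= r0 Hr] := n1.
pose k := r / (2 * (`|v| + `|w| + 1)).
have d0 : 0 < 2 * (`|v| + `|w| + 1).
  by rewrite mulr_gt0// ltr_wpDl// addr_ge0.
have k0 : 0 < k by rewrite divr_gt0.
have small (v' w' : 'rV[R]_n) (s t : R) : `|v'| + `|w'| = `|v| + `|w| ->
    0 <= s <= 1 -> 0 <= t <= 1 -> ball a r (t *: (k *: w') + (s *: (k *: v') + a)).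
  move=> vw /andP[s0 s1] /andP[t0 t1]; rewrite -ball_normE /= addrA opprD addrCA subrr addr0 normrN.
  apply: le_lt_trans (ler_normD _ _) _; rewrite !normrZ !ger0_norm// ?(ltW k0)//.
  apply: (@le_lt_trans _ _ (k * `|w'| + k * `|v'|)).
    by rewrite lerD// ler_piMl// mulr_ge0// ltW.
  rewrite -mulrDr (addrC `|w'|) vw /k -mulrA gtr_pMr// mulrC ltr_pdivrMr// mul1r.
  by have := addr_ge0 (normr_ge0 v) (normr_ge0 w); lra.
  exact: ltW.
have [s [t [s01 t01 E]]] := @second_difference _ f A a (k *: v) (k *: w)
  (fun s t s01 t01 => (Hr _ (small v w s t erefl s01 t01)).1) sf.
have [s' [t' [s01' t01' E']]] := @second_difference _ f A a (k *: w) (k *: v)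
  (fun s t s01 t01 => (Hr _ (small w v s t (addrC _ _) s01 t01)).1) sf.
have [Az [h1 _]] := Hr _ (small v w s t erefl s01 t01).
have [Az' [_ h2]] := Hr _ (small w v s' t' (addrC _ _) s01' t01').
set z := (t *: _ + _) in E Az h1; set z' := (t' *: _ + _) in E' Az' h2.
have scal (u1 u2 y : 'rV[R]_n) : A y -> 'D_(k *: u1) ('D_(k *: u2) f) y = k * (k * 'D_u1 ('D_u2 f) y).
  move=> Ay.
  have D1 x : A x -> 'D_(k *: u2) f x = k * 'D_u2 f x.
    move=> Ax; have dfx := smooth_on_differentiable sf Ax.
    exact: derive_scalev.
  have -> : 'D_(k *: u1) ('D_(k *: u2) f) y = 'D_(k *: u1) (k \*: 'D_u2 f) y.
    by apply: near_eq_derive; apply: filterS (open_near oA Ay) => x /D1.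
  have dDy : differentiable ('D_u2 f) y.
    by apply: smooth_on_differentiable Ay; exact: smooth_onD.
  rewrite deriveZ; last exact: diff_derivable.
  by rewrite (derive_scalev k u1 dDy).
have S1 := etrans E (scal w v z Az).
have S2 := etrans E' (scal v w z' Az').
have k_neq0 : k != 0 by rewrite gt_eqF.
have E12 : f (k *: w + (k *: v + a)) - f (k *: v + a) - (f (k *: w + a) - f a) =
           f (k *: v + (k *: w + a)) - f (k *: w + a) - (f (k *: v + a) - f a).
  by rewrite (addrCA (k *: w)); ring.
have EE := mulfI k_neq0 (mulfI k_neq0 (etrans (esym S1) (etrans E12 S2))).
exact: dist_le_halves EE h1 h2.
Qed.

End schwarz.

(** * Reduction of a pair of functions to a fold *)

Section germ.
Context {R : realType}.

Lemma derive_inverse n (f g : 'rV[R]_n -> 'rV[R]_n) b v :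
  differentiable g b -> differentiable f (g b) -> (\forall y \near b, f (g y) = y) ->
  'D_v g b *m jac f (g b) = v.
Proof.
move=> dg df fg; rewrite -[RHS](derive_id b v).
have <- : 'D_v (f \o g) b = 'D_v id b by exact: near_eq_derive.
rewrite [RHS]deriveE; last exact: differentiable_comp.
have -> : 'd (f \o g) b v = 'd f (g b) ('d g b v) by exact: (congr1 (fun h => h v) (diff_comp dg df)).
by rewrite (deriveE v dg); exact: (esym (diff_jac ('d g b v) df)).
Qed.

(** At a critical point of u the second derivatives of g do not contribute. *)
Lemma hess_comp (g : 'rV[R]_3 -> 'rV[R]_3) (u : 'rV[R]_3 -> R) A B b (N : 'M[R]_3) :
  open A -> open B -> B b -> (forall y, B y -> A (g y)) -> smooth_on A u -> smooth_on B g ->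
  (forall j, 'D_'e_j u (g b) = 0) ->
  (forall i j, 'D_'e_i (fun y => g y 0 j) b = N i j) ->
  forall i j, 'D_'e_i ('D_'e_j (fun y => u (g y))) b =
    (N *m (\matrix_(k, l) 'D_'e_k ('D_'e_l u) (g b)) *m N^T) i j.
Proof.
move=> oA oB Bb BA su sg Du gN i j.
have dg y : B y -> differentiable g y by exact: smooth_on_differentiable sg.
have sgk k : smooth_on B (fun y => g y 0 k) by exact: (smooth_coordP _ oB).1.
have sDg k : smooth_on B ('D_'e_j (fun y => g y 0 k)) by exact/smooth_onD.
have sDu k : smooth_on A ('D_'e_k u) by exact/smooth_onD.
have sDug k : smooth_on B (fun y => 'D_'e_k u (g y)) by exact: (smooth_comp oB BA sg (sDu k)).
have dif (H : 'rV[R]_3 -> R) y : smooth_on B H -> B y -> differentiable H y.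
  by move=> sH By; exact: smooth_on_differentiable sH By.
pose T k y := 'D_'e_j (fun y => g y 0 k) y * 'D_'e_k u (g y).
have dT k : differentiable (T k) b by apply: dif => //; exact: smoothM.
have E1 : 'D_'e_i ('D_'e_j (fun y => u (g y))) b =
    'D_'e_i (fun y => T i0 y + T i1 y + T i2 y) b.
  apply: near_eq_derive; apply: filterS (open_near oB Bb) => y By.
  by apply: derive_composite; [exact: dg|apply: smooth_on_differentiable su _; exact: BA].
have D2 l : 'D_'e_i (fun y => 'D_'e_l u (g y)) b = \sum_k N i k * 'D_'e_k ('D_'e_l u) (g b).
  have dDu : differentiable ('D_'e_l u) (g b).
    by apply: smooth_on_differentiable (sDu l) _; exact: BA.
  rewrite (derive_composite 'e_i (dg _ Bb) dDu) sum3.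
  by rewrite (gN i i0) (gN i i1) (gN i i2).
have E2 k : 'D_'e_i (T k) b = N j k * \sum_m N i m * 'D_'e_m ('D_'e_k u) (g b).
  rewrite (derive_mulr 'e_i (dif _ _ (sDg k) Bb) (dif _ _ (sDug k) Bb)) (D2 k).
  by rewrite (gN j k) (Du k) mul0r addr0.
rewrite E1 (derive_addr 'e_i (differentiableD (dT i0) (dT i1)) (dT i2)).
rewrite (derive_addr 'e_i (dT i0) (dT i1)) (E2 i0) (E2 i1) (E2 i2).
rewrite -(sum3 (fun k => N j k * \sum_m N i m * 'D_'e_m ('D_'e_k u) (g b))) mxE.
apply: eq_bigr => k _; rewrite mulrC !mxE; congr (_ * _).
by apply: eq_bigr => m _; rewrite mxE.
Qed.

Lemma smooth_sub_cst n (A : set 'rV[R]_n) (M : 'M[R]_n) p0 j :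
  smooth_on A (fun p : 'rV[R]_n => ((p - p0) *m M) 0 j).
Proof.
have lM : linear (fun p : 'rV[R]_n => (p *m M) 0 j).
  by move=> k x y; rewrite mulmxDl -scalemxAl !mxE.
have cM := linear_rV_continuous lM.
have s1 : smooth_on A (fun p : 'rV[R]_n => (p *m M) 0 j) by exact: smooth_linear.
move=> vs x Ax.
suff -> : (fun p : 'rV[R]_n => ((p - p0) *m M) 0 j) = (fun p => (p *m M) 0 j + (- (p0 *m M) 0 j)).
  have lid : linear (@id 'rV[R]_n) by [].
  have := @smooth_on_affine R _ _ _ setT (fun p : 'rV[R]_n => (p *m M) 0 j) (mklin lid) (- p0).
  move=> /(_ (fun x => cvg_id)) H.
  have {H}H := H (smooth_linear lM cM) vs x I.
  rewrite (_ : (fun x => _) = (fun p : 'rV[R]_n => (p *m M) 0 j + (- (p0 *m M) 0 j))) in H; last first.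
    by apply/funext => p; rewrite /= mulmxDl mulNmx !mxE.
  exact: H.
by apply/funext => p; rewrite mulmxBl !mxE.
Qed.

(** In the linear coordinates given by N, the last one being replaced by w, the
    Hessian of u is diagonal and w is the third coordinate: this is the situation
    of fold_form. *)
Theorem germ_form (u w : 'rV[R]_3 -> R) (p0 : 'rV[R]_3) (N : 'M[R]_3) (h : 'I_3 -> R) :
  smooth_on setT u -> smooth_on setT w -> u p0 = 0 -> w p0 = 0 ->
  (forall j, 'D_'e_j u p0 = 0) -> N \in unitmx ->
  N *m (\col_j 'D_'e_j w p0) = \col_j (j == i2)%:R ->
  N *m (\matrix_(k, l) 'D_'e_k ('D_'e_l u) p0) *m N^T = diag_mx (\row_j h j) ->
  (forall j, h j != 0) ->
  exists (sigma : 'rV[R]_3 -> 'rV[R]_3) (rho : 'rV[R]_3 -> R) U,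
    [/\ local_diffeo sigma 0 p0, [/\ open U, U 0 & smooth_on U rho],
        (forall q, rho (axis q) = rho q),
        (\forall q \near 0, 0 < rho q) &
        \forall p \near 0, rho (row3 0 0 (w (sigma p))) * u (sigma p) =
            Num.sg (h i0) * p 0 i0 ^+ 2 + Num.sg (h i1) * p 0 i1 ^+ 2 +
            Num.sg (h i2) * p 0 i2 ^+ 2 /\
          rho (row3 0 0 (w (sigma p))) * w (sigma p) = p 0 i2].
Proof.
move=> su sw u0 w0 Du uN Nv NH h0.
pose M := invmx N; have uM : M \in unitmx by rewrite unitmx_inv.
pose F : 'I_3 -> 'rV[R]_3 -> R := sel3 (fun p => ((p - p0) *m M) 0 i0)
  (fun p => ((p - p0) *m M) 0 i1) w.
have sF j : smooth_on setT (F j).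
  by move: j; apply: I3P; rewrite /F ?sel3E//; exact: smooth_sub_cst.
have DF i j : 'D_'e_i (F j) p0 = M i j.
  have Dlin k : 'D_'e_i (fun p : 'rV[R]_3 => ((p - p0) *m M) 0 k) p0 = M i k.
    have lM : linear (fun p : 'rV[R]_3 => (p *m M) 0 k).
      by move=> c x y; rewrite mulmxDl -scalemxAl !mxE.
    have cM := linear_rV_continuous lM.
    have -> : 'D_'e_i (fun p : 'rV[R]_3 => ((p - p0) *m M) 0 k) p0 =
       'D_'e_i (fun p : 'rV[R]_3 => (p *m M) 0 k) (p0 - p0).
      exact: (derive_translate (fun p : 'rV[R]_3 => (p *m M) 0 k) (- p0)).
    rewrite deriveE; last exact: (@linear_differentiable _ _ _ (mklin lM)).
    have -> : 'd (fun p : 'rV[R]_3 => (p *m M) 0 k) (p0 - p0) 'e_i = (('e_i : 'rV[R]_3) *m M) 0 k.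
      exact: (congr1 (fun f => f 'e_i) (@diff_lin _ _ _ (mklin lM) (p0 - p0) cM)).
    by rewrite -rowE mxE.
  move: j; apply: I3P; rewrite /F ?sel3E//.
  have : \col_j 'D_'e_j w p0 = M *m \col_j (j == i2)%:R by rewrite -Nv mulKmx.
  move=> /(congr1 (fun X : 'cV[R]_3 => X i 0)); rewrite mxE => ->.
  by rewrite mxE sum3 !mxE /= !mulr0 !add0r mulr1.
have LF : local_diffeo (fun p => \row_j F j p) p0 0.
  have -> : 0 = \row_j F j p0.
    by apply: row3_eq; rewrite !mxE /F ?sel3E ?subrr ?mul0mx ?mxE.
  apply: (inverse_function_row openT I sF).
  by rewrite (_ : \matrix_(i, j) _ = M)//; apply/matrixP => i j; rewrite mxE DF.
have [g [A [B [[oA Ap0] [oB B0] FK gK [sFA sg g0 _]]]]] := local_diffeo_sub LF openT I.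
have dg0 : differentiable g 0 by exact: smooth_on_differentiable sg B0.
have gN i j : 'D_'e_i (fun y => g y 0 j) 0 = N i j.
  rewrite derive_coord//.
  have := @derive_inverse _ (fun p => \row_j F j p) g 0 'e_i dg0 _ _.
  rewrite g0 => /(_ (smooth_on_differentiable sFA Ap0)) E.
  have {E} : 'D_'e_i g 0 *m jac (fun p => \row_j F j p) p0 = 'e_i.
    by apply: E; apply: filterS (open_near oB B0) => y /gK[].
  have -> : jac (fun p => \row_j F j p) p0 = M.
    apply/matrixP => k l; rewrite mxE -DF; congr ('D__ _ p0).
    by apply/funext => p; rewrite mxE.
  move=> /(congr1 (fun X => X *m N)); rewrite -mulmxA mulVmx// mulmx1 => ->.
  by rewrite -rowE mxE.
pose f q := u (g q).
have sf : smooth_on B f.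
  by apply: (smooth_comp oB _ sg su).
have f0 : f 0 = 0 by rewrite /f g0.
have Df j : 'D_'e_j f 0 = 0.
  have du : differentiable u p0 by exact: smooth_on_differentiable su _.
  rewrite (derive_composite_val 'e_j dg0 g0 du (Du i0) (Du i1) (Du i2)).
  by rewrite !mulr0 !addr0.
have hf i j : 'D_'e_i ('D_'e_j f) 0 = if i == j then h j else 0.
  have BT y : B y -> setT (g y) by [].
  have Dug j' : 'D_'e_j' u (g 0) = 0 by rewrite g0; exact: Du.
  rewrite (hess_comp openT oB B0 BT su sg Dug gN i j) g0 NH !mxE eq_sym.
  by case: eqVneq => [->|_]; rewrite ?mulr1n ?mulr0n.
have [sigma [rho [U [Lsig sr rax rpos E]]]] := fold_form oB B0 sf f0 Df hf h0.
exists (fun p => g (sigma p)), rho, U; split=> //.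
  have Lg : local_diffeo g 0 p0 by exact: local_diffeoI gK FK sg sFA.
  exact: local_diffeo_comp Lsig Lg.
have [sig' [A' [B' [[oA' A'0] _ _ _ [ssig _ _ _]]]]] := local_diffeo_sub Lsig openT I.
have sig0 : sigma 0 = 0 by have [] := Lsig.
have nB : \forall p \near 0, B (sigma p).
  apply: (continuous_near (smooth_on_continuous ssig A'0)); rewrite sig0.
  exact: (open_near oB B0).
apply: filterS2 E nB => p [E1 E2] Bs.
have wE : w (g (sigma p)) = sigma p 0 i2.
  have [_ /(congr1 (fun X : 'rV[R]_3 => X 0 i2))] := gK _ Bs.
  by rewrite mxE.
by rewrite wE -/(axis (sigma p)) rax.
Qed.

End germ.

(** * Bases adapted to a quadratic form and a covector *)

Section linear_algebra.
Context {R : realType}.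
Implicit Types (H : 'I_3 -> 'I_3 -> R) (v p q : 'rV[R]_3).

(** The determinant of the symmetric matrix with upper triangle H. Only entries
    H i j with i <= j occur, so that second derivatives are needed in one order
    only. *)
Definition det_sym H : R :=
  H i0 i0 * H i1 i1 * H i2 i2 + 2 * H i0 i1 * H i1 i2 * H i0 i2
  - H i0 i0 * H i1 i2 ^+ 2 - H i1 i1 * H i0 i2 ^+ 2 - H i2 i2 * H i0 i1 ^+ 2.

(** The image of v under the adjugate of the symmetric matrix H. *)
Definition adj_sym H v : 'rV[R]_3 := row3
  ((H i1 i1 * H i2 i2 - H i1 i2 ^+ 2) * v 0 i0
   + (H i0 i2 * H i1 i2 - H i0 i1 * H i2 i2) * v 0 i1
   + (H i0 i1 * H i1 i2 - H i0 i2 * H i1 i1) * v 0 i2)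
  ((H i0 i2 * H i1 i2 - H i0 i1 * H i2 i2) * v 0 i0
   + (H i0 i0 * H i2 i2 - H i0 i2 ^+ 2) * v 0 i1
   + (H i0 i1 * H i0 i2 - H i0 i0 * H i1 i2) * v 0 i2)
  ((H i0 i1 * H i1 i2 - H i0 i2 * H i1 i1) * v 0 i0
   + (H i0 i1 * H i0 i2 - H i0 i0 * H i1 i2) * v 0 i1
   + (H i0 i0 * H i1 i1 - H i0 i1 ^+ 2) * v 0 i2).

Definition dot3 p q : R := p 0 i0 * q 0 i0 + p 0 i1 * q 0 i1 + p 0 i2 * q 0 i2.

(** The determinant of the restriction of H to the plane orthogonal to v, times
    the square of the length of v. *)
Definition bordered H v : R := dot3 v (adj_sym H v).

Definition form H p q : R := \sum_i \sum_j p 0 i * H i j * q 0 j.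

Definition cross p q : 'rV[R]_3 := row3
  (p 0 i1 * q 0 i2 - p 0 i2 * q 0 i1)
  (p 0 i2 * q 0 i0 - p 0 i0 * q 0 i2)
  (p 0 i0 * q 0 i1 - p 0 i1 * q 0 i0).

Definition form_row H p : 'rV[R]_3 := \row_j \sum_i p 0 i * H i j.

Definition mat3 (a b c : 'rV[R]_3) : 'M[R]_3 := \matrix_(i, j) sel3 a b c i 0 j.

Lemma form_adj H v p : (forall i j, H i j = H j i) ->
  form H (adj_sym H v) p = det_sym H * dot3 v p.
Proof.
move=> sH; rewrite /form !sum3 /adj_sym !row3_0 !row3_1 !row3_2.
rewrite (sH i1 i0) (sH i2 i0) (sH i2 i1) /det_sym /dot3; ring.
Qed.

Lemma form_sym H p q : (forall i j, H i j = H j i) -> form H p q = form H q p.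
Proof.
by move=> sH; rewrite /form !sum3 (sH i1 i0) (sH i2 i0) (sH i2 i1); ring.
Qed.

Lemma formDl H p p' q : form H (p + p') q = form H p q + form H p' q.
Proof. by rewrite /form !sum3 !mxE; ring. Qed.

Lemma dot_cross_l p q : dot3 p (cross p q) = 0.
Proof. by rewrite /dot3 /cross !row3_0 !row3_1 !row3_2; ring. Qed.

Lemma dot_cross_r p q : dot3 q (cross p q) = 0.
Proof. by rewrite /dot3 /cross !row3_0 !row3_1 !row3_2; ring. Qed.

Lemma form_dot H p q : form H p q = dot3 (form_row H p) q.
Proof. by rewrite /form /dot3 /form_row !sum3 !mxE !sum3; ring. Qed.

(** The plane orthogonal to v is spanned by the vectors v x e_i; if all of them
   and their sums were isotropic, H would vanish on this plane. *)
Lemma nonisotropic H v : (forall i j, H i j = H j i) -> bordered H v != 0 ->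
  exists2 e, dot3 v e = 0 & form H e e != 0.
Proof.
move=> sH; apply: contra_neqP => noe.
have iso i j : form H (cross v ('e_i + 'e_j)) (cross v ('e_i + 'e_j)) = 0.
  apply/eqP/negPn/negP => ne; apply: noe.
  by exists (cross v ('e_i + 'e_j)) => //; exact: dot_cross_l.
have := iso i0 i0; have := iso i1 i1; have := iso i2 i2.
have := iso i0 i1; have := iso i0 i2; have := iso i1 i2.
rewrite /form !sum3 /cross !row3_0 !row3_1 !row3_2 !mxE /=.
rewrite (sH i1 i0) (sH i2 i0) (sH i2 i1).
rewrite /bordered /dot3 /adj_sym !row3_0 !row3_1 !row3_2.
move: (v 0 i0) (v 0 i1) (v 0 i2) (H i0 i0) (H i0 i1) (H i0 i2) (H i1 i1) (H i1 i2) (H i2 i2).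
move=> x y z a d e b f c.
move=> h12 h02 h01 h22 h11 h00.
have P00 : b * z ^+ 2 - 2 * f * y * z + c * y ^+ 2 = 0 by lra.
have P11 : a * z ^+ 2 - 2 * e * x * z + c * x ^+ 2 = 0 by lra.
have P22 : a * y ^+ 2 - 2 * d * x * y + b * x ^+ 2 = 0 by lra.
have P01 : - d * z ^+ 2 + f * x * z + e * y * z - c * x * y = 0 by lra.
have P02 : - e * y ^+ 2 + f * x * y + d * y * z - b * x * z = 0 by lra.
have P12 : - f * x ^+ 2 + e * x * y + d * x * z - a * y * z = 0 by lra.
clear h00 h11 h22 h01 h02 h12.
set q := (X in X = 0).
have qz : z ^+ 2 * q = 0.
  rewrite (_ : z ^+ 2 * q = (b * z ^+ 2 - 2 * f * y * z + c * y ^+ 2) *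
    (a * z ^+ 2 - 2 * e * x * z + c * x ^+ 2) -
    (- d * z ^+ 2 + f * x * z + e * y * z - c * x * y) ^+ 2); last by rewrite /q; ring.
  by rewrite P00 P01; ring.
have qy : y ^+ 2 * q = 0.
  rewrite (_ : y ^+ 2 * q = (b * z ^+ 2 - 2 * f * y * z + c * y ^+ 2) *
    (a * y ^+ 2 - 2 * d * x * y + b * x ^+ 2) -
    (- e * y ^+ 2 + f * x * y + d * y * z - b * x * z) ^+ 2); last by rewrite /q; ring.
  by rewrite P00 P02; ring.
have qx : x ^+ 2 * q = 0.
  rewrite (_ : x ^+ 2 * q = (a * z ^+ 2 - 2 * e * x * z + c * x ^+ 2) *
    (a * y ^+ 2 - 2 * d * x * y + b * x ^+ 2) -
    (- f * x ^+ 2 + e * x * y + d * x * z - a * y * z) ^+ 2); last by rewrite /q; ring.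
  by rewrite P11 P12; ring.
apply/eqP/negPn/negP => q0.
move: qx qy qz => /eqP; rewrite mulf_eq0 (negbTE q0) orbF sqrf_eq0 => /eqP x0.
move=> /eqP; rewrite mulf_eq0 (negbTE q0) orbF sqrf_eq0 => /eqP y0.
move=> /eqP; rewrite mulf_eq0 (negbTE q0) orbF sqrf_eq0 => /eqP z0.
by move: q0; rewrite /q x0 y0 z0 !mul0r !addr0 eqxx.
Qed.

Lemma mat3_form H a b c : mat3 a b c *m (\matrix_(i, j) H i j) *m (mat3 a b c)^T =
  \matrix_(i, j) form H (sel3 a b c i) (sel3 a b c j).
Proof.
apply/matrixP => i j; rewrite !mxE /form; under eq_bigr => k _ do rewrite !mxE mulr_suml.
rewrite exchange_big /=; apply: eq_bigr => k _; apply: eq_bigr => l _.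
by rewrite !mxE.
Qed.

Lemma mat3_col a b c v : mat3 a b c *m (\col_j v 0 j) = \col_i dot3 v (sel3 a b c i).
Proof.
by apply/colP => i; rewrite !mxE sum3 /dot3 !mxE; ring.
Qed.

(** The rows e1, e2, e3 of N are orthogonal for H: e1 is a nonisotropic vector of
    the plane orthogonal to v, e2 spans the orthogonal of e1 in this plane, and
    e3, a multiple of adj(H) v, is orthogonal to the whole plane. *)
Theorem adapted_basis H v : (forall i j, H i j = H j i) -> det_sym H != 0 ->
  bordered H v != 0 -> exists (N : 'M[R]_3) h, [/\ N \in unitmx,
    N *m (\col_j v 0 j) = \col_j (j == i2)%:R,
    N *m (\matrix_(i, j) H i j) *m N^T = diag_mx (\row_j h j) &
    forall j, h j != 0].
Proof.
move=> sH dH bH; have [e1 ve1 He1] := nonisotropic sH bH.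
pose e2 := cross v (form_row H e1).
pose e3 := (bordered H v)^-1 *: adj_sym H v.
have ve2 : dot3 v e2 = 0 by exact: dot_cross_l.
have H12 : form H e1 e2 = 0 by rewrite form_dot; exact: dot_cross_r.
have formZ k p q : form H (k *: p) q = k * form H p q.
  by rewrite /form !sum3 !mxE; ring.
have dotZ k p q : dot3 p (k *: q) = k * dot3 p q by rewrite /dot3 !mxE; ring.
have dotD p q q' : dot3 p (q + q') = dot3 p q + dot3 p q' by rewrite /dot3 !mxE; ring.
have H3 p : form H e3 p = (bordered H v)^-1 * (det_sym H * dot3 v p).
  by rewrite formZ form_adj.
have ve3 : dot3 v e3 = 1.
  by rewrite dotZ mulVf.
have H31 : form H e3 e1 = 0 by rewrite H3 ve1 !mulr0.
have H32 : form H e3 e2 = 0 by rewrite H3 ve2 !mulr0.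
have H33 : form H e3 e3 != 0 by rewrite H3 ve3 mulr1 mulf_neq0// invr_neq0.
clearbody e3.
pose N := mat3 e1 e2 e3.
pose h j := form H (sel3 e1 e2 e3 j) (sel3 e1 e2 e3 j).
have H21 := etrans (form_sym e2 e1 sH) H12.
have H13 := etrans (form_sym e1 e3 sH) H31.
have H23 := etrans (form_sym e2 e3 sH) H32.
have NH : N *m (\matrix_(i, j) H i j) *m N^T = diag_mx (\row_j h j).
  rewrite mat3_form; apply/matrixP => i j; rewrite !mxE /h.
  move: i; apply: I3P; move: j; apply: I3P; rewrite !sel3E /= ?mulr1n ?mulr0n//.
have Nv : N *m (\col_j v 0 j) = \col_j (j == i2)%:R.
  by rewrite mat3_col; apply/colP => i; rewrite !mxE; move: i; apply: I3P; rewrite sel3E.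
have v0 : v != 0.
  apply: contraNneq bH => ->; rewrite /bordered /dot3 !mxE !mul0r !addr0//.
have comb (x : 'rV[R]_3) : x *m N = x 0 i0 *: e1 + x 0 i1 *: e2 + x 0 i2 *: e3.
  by apply/rowP => j; rewrite !mxE sum3 !mxE !sel3E.
have e2_neq0 : e2 != 0.
  apply: contraNneq v0 => e20; set r := form_row H e1.
  have re1 : dot3 r e1 != 0 by rewrite -form_dot.
  have cr i : e2 0 i = 0 by rewrite e20 mxE.
  have c0 : v 0 i1 * r 0 i2 - v 0 i2 * r 0 i1 = 0 by rewrite -(cr i0) /e2 row3_0.
  have c1 : v 0 i2 * r 0 i0 - v 0 i0 * r 0 i2 = 0 by rewrite -(cr i1) /e2 row3_1.
  have c2 : v 0 i0 * r 0 i1 - v 0 i1 * r 0 i0 = 0 by rewrite -(cr i2) /e2 row3_2.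
  have z i : v 0 i * dot3 r e1 = 0 -> v 0 i = 0.
    by move=> /eqP; rewrite mulf_eq0 (negbTE re1) orbF => /eqP.
  apply/eqP; apply: row3_eq; rewrite mxE; apply: z.
  - rewrite (_ : _ * _ = r 0 i0 * dot3 v e1 + (v 0 i0 * r 0 i1 - v 0 i1 * r 0 i0) * e1 0 i1
       - (v 0 i2 * r 0 i0 - v 0 i0 * r 0 i2) * e1 0 i2); last by rewrite /dot3; ring.
    by rewrite ve1 c1 c2; ring.
  - rewrite (_ : _ * _ = r 0 i1 * dot3 v e1 + (v 0 i1 * r 0 i2 - v 0 i2 * r 0 i1) * e1 0 i2
       - (v 0 i0 * r 0 i1 - v 0 i1 * r 0 i0) * e1 0 i0); last by rewrite /dot3; ring.
    by rewrite ve1 c0 c2; ring.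
  - rewrite (_ : _ * _ = r 0 i2 * dot3 v e1 + (v 0 i2 * r 0 i0 - v 0 i0 * r 0 i2) * e1 0 i0
       - (v 0 i1 * r 0 i2 - v 0 i2 * r 0 i1) * e1 0 i1); last by rewrite /dot3; ring.
    by rewrite ve1 c0 c1; ring.
have uN : N \in unitmx.
  rewrite -row_free_unit; apply: inj_row_free => x; rewrite comb => x0.
  have x2 : x 0 i2 = 0.
    have := congr1 (dot3 v) x0; rewrite !dotD !dotZ ve1 ve2 ve3 !mulr0 !add0r mulr1 => ->.
    by rewrite /dot3 !mxE; ring.
  have x00 : x 0 i0 = 0.
    have := congr1 (fun y => form H y e1) x0.
    rewrite !formDl !formZ H21 H31 !mulr0 !addr0 (_ : form H 0 e1 = 0); last first.
      by rewrite -(scale0r (0 : 'rV[R]_3)) formZ mul0r.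
    by move=> /eqP; rewrite mulf_eq0 (negbTE He1) orbF => /eqP.
  have /eqP : x 0 i1 *: e2 = 0 by move: x0; rewrite x2 x00 !scale0r add0r addr0.
  rewrite scaler_eq0 (negbTE e2_neq0) orbF => /eqP x1.
  by apply: row3_eq; rewrite mxE.
exists N, h; split=> //; apply: I3P; rewrite /h sel3E//.
apply/negP => /eqP H22.
have : form H (adj_sym H e2) e2 = det_sym H * dot3 e2 e2 by exact: form_adj.
rewrite -(mulmxKV uN (adj_sym H e2)) comb !formDl !formZ H12 H22 H32 !mulr0 !addr0 => /esym/eqP.
rewrite mulf_eq0 (negbTE dH) /= => /eqP d0.
move/eqP: e2_neq0; apply.
have := sqr_ge0 (e2 0 i0); have := sqr_ge0 (e2 0 i1); have := sqr_ge0 (e2 0 i2).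
move: d0; rewrite /dot3 -!expr2 => d0 s2 s1 s0.
have z i : e2 0 i ^+ 2 = 0 -> e2 0 i = 0 by move=> /eqP; rewrite sqrf_eq0 => /eqP.
apply: row3_eq; rewrite [RHS]mxE; apply: z; lra.
Qed.

End linear_algebra.

(** * Radial equivalence *)

Section radial.
Context {R : realType}.

Lemma polar (a b : R) : (a, b) != 0 -> exists theta r, 0 < r /\ (a, b) = (r * cos theta, r * sin theta).
Proof.
move=> ab0; pose r := Num.sqrt (a ^+ 2 + b ^+ 2).
have s0 : 0 < a ^+ 2 + b ^+ 2.
  rewrite lt_neqAle addr_ge0 ?sqr_ge0// andbT eq_sym paddr_eq0 ?sqr_ge0// !sqrf_eq0.
  by apply: contraNN ab0 => /andP[/eqP-> /eqP->].
have r0 : 0 < r by rewrite sqrtr_gt0.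
have rn0 : r != 0 by rewrite gt_eqF.
have r2 : r ^+ 2 = a ^+ 2 + b ^+ 2 by rewrite sqr_sqrtr// ltW.
pose c := a / r.
have rc : r * c = a by rewrite /c mulrC divfK.
have c2 : r ^+ 2 * (1 - c ^+ 2) = b ^+ 2 by rewrite mulrBr -exprMn rc r2 mulr1; ring.
have c1 : 0 <= 1 - c ^+ 2.
  by rewrite -(pmulr_rge0 _ (exprn_gt0 2 r0)) c2 sqr_ge0.
have c11 : -1 <= c <= 1.
  have : c ^+ 2 <= 1 by rewrite -subr_ge0.
  by move=> c21; apply/andP; split; nra.
have rs : r * Num.sqrt (1 - c ^+ 2) = `|b|.
  by rewrite -[r]gtr0_norm// -sqrtr_sqr -sqrtrM ?sqr_ge0// c2 sqrtr_sqr.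
have ca : cos (acos c) = c by rewrite acosK// in_itv.
have sa : sin (acos c) = Num.sqrt (1 - c ^+ 2) by rewrite sin_acos.
have [b0|b0] := leP 0 b.
  exists (acos c), r; split=> //.
  by rewrite ca sa rs rc ger0_norm.
exists (- acos c), r; split=> //.
by rewrite cosN sinN ca sa mulrN rs rc ltr0_norm// opprK.
Qed.

Lemma smooth_comp_lin (V W X : normedModType R) (f : V -> W) (l : {linear W -> X}) A :
  open A -> continuous l -> smooth_on A f -> smooth_on A (fun x => l (f x)).
Proof.
by move=> oA cl /smooth_onP sf; apply/smooth_onP => k; exact: (Cn_comp_lin oA cl (sf k)).
Qed.

Lemma smooth_on_lin (V W X : normedModType R) (f : W -> X) (l : {linear V -> W}) B :
  continuous l -> smooth_on B f -> smooth_on (l @^-1` B) (fun x => f (l x)).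
Proof.
move=> cl sf; have := @smooth_on_affine _ _ _ _ _ _ l 0 cl sf.
have -> : (fun x => f (l x + 0)) = (fun x => f (l x)) by apply/funext => x; rewrite addr0.
by have -> : [set x | B (l x + 0)] = l @^-1` B by apply/funext => x /=; rewrite addr0.
Qed.

Lemma local_diffeo_lin (V V' W W' : normedModType R) (f : V -> W) (a : V) (b : W)
    (l : {linear V' -> V}) (l' : {linear V -> V'}) (m : {linear W -> W'}) (m' : {linear W' -> W}) :
  continuous l -> continuous l' -> continuous m -> continuous m' ->
  cancel l l' -> cancel l' l -> cancel m m' -> cancel m' m ->
  local_diffeo f a b -> local_diffeo (fun x => m (f (l x))) (l' a) (m b).
Proof.
move=> cl cl' cm cm' lK l'K mK m'K fab; have [fa _] := fab.
have [g [A [B [[oA Aa] [oB Bb] fg gf [sf sg _ _]]]]] := local_diffeo_sub fab openT I.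
have oA' : open (l @^-1` A) by apply: open_comp => // x _; exact: cl.
have oB' : open (m' @^-1` B) by apply: open_comp => // x _; exact: cm'.
apply: (@local_diffeoI _ _ _ _ (fun y => l' (g (m' y))) (l @^-1` A) (m' @^-1` B)) => //=.
- by rewrite l'K.
- by rewrite l'K fa.
- by move=> x Ax; have [Bf gfx] := fg _ Ax; rewrite mK gfx lK.
- by move=> y By; have [Ag fgy] := gf _ By; rewrite l'K fgy m'K.
- apply: smooth_comp_lin => //.
  exact: smooth_on_lin.
- by apply: smooth_comp_lin => //; exact: smooth_on_lin.
Qed.

(** Complex numbers are turned into row vectors, for which the inverse function
    theorem is stated. *)
Definition to_row (z : R * R) : 'rV[R]_2 := \row_j (if j == 0 then z.1 else z.2).
Definition of_row (p : 'rV[R]_2) : R * R := (p 0 0, p 0 1).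
Definition lin2 (a b c d : R) (z : R * R) : R * R := (a * z.1 + b * z.2, c * z.1 + d * z.2).

Lemma to_rowK : cancel to_row of_row.
Proof. by move=> [u w]; rewrite /of_row !mxE. Qed.

Lemma I2P (P : 'I_2 -> Prop) : P 0 -> P 1 -> forall i, P i.
Proof.
move=> P0 P1 [[|[|//]] H].
- by rewrite (_ : Ordinal H = 0)//; exact: val_inj.
- by rewrite (_ : Ordinal H = 1)//; exact: val_inj.
Qed.

Lemma of_rowK : cancel of_row to_row.
Proof. by move=> p; apply/rowP; apply: I2P; rewrite mxE. Qed.

Lemma to_row_linear : linear to_row.
Proof. by move=> k x y; apply/rowP; apply: I2P; rewrite !mxE. Qed.

Lemma of_row_linear : linear of_row.
Proof. by move=> k x y; rewrite /of_row !mxE. Qed.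

Lemma lin2_linear a b c d : linear (lin2 a b c d).
Proof. by move=> k [x1 x2] [y1 y2]; congr pair; rewrite /= /GRing.scale /=; ring. Qed.

Lemma lin2K a b c d : a * d - b * c != 0 -> let e := (a * d - b * c)^-1 in
  cancel (lin2 a b c d) (lin2 (e * d) (- e * b) (- e * c) (e * a)).
Proof. by move=> D0 e [u w]; rewrite /lin2 /= /e; congr pair; field. Qed.

Lemma linear_pair_continuous (W : normedModType R) (f : R * R -> W) : linear f -> continuous f.
Proof.
move=> lf; have -> : f = fun z => z.1 *: f (1, 0) + z.2 *: f (0, 1).
  apply/funext => -[u w]; pose F := mklin lf; rewrite -[f]/(F : _ -> _) -!linearZ -linearD.
  by congr (F _); congr pair; rewrite /= /GRing.scale /= ?mulr0 ?mulr1 ?addr0 ?add0r.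
move=> z; apply: cvgD; apply: cvgZr_tmp; [exact: cvg_fst|exact: cvg_snd].
Qed.

(** The germ of f at p0 becomes (Q, z) after a change of coordinates of the
    source, a linear map of the target, and the map sending (u, w) to
    rho(w) (u, w). *)
Definition preform (f : 'rV[R]_3 -> R * R) (p0 : 'rV[R]_3) (Q : 'rV[R]_3 -> R) : Prop :=
  exists (sigma : 'rV[R]_3 -> 'rV[R]_3) (rho : 'rV[R]_3 -> R) (U : set 'rV[R]_3) (a b c d : R),
    [/\ local_diffeo sigma 0 p0, [/\ open U, U 0 & smooth_on U rho],
        (\forall q \near 0, 0 < rho q), a * d - b * c != 0 &
        \forall p \near 0, let z := lin2 a b c d (f (sigma p)) in
          rho (row3 0 0 z.2) * z.1 = Q p /\ rho (row3 0 0 z.2) * z.2 = p 0 i2].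

Lemma preformN f p0 Q : preform f p0 Q -> preform f p0 (fun p => - Q p).
Proof.
move=> [sigma [rho [U [a [b [c [d [Ls sr rp D E]]]]]]]].
exists sigma, rho, U, (- a), (- b), c, d; split=> //.
  have -> : - a * d - - b * c = - (a * d - b * c) by ring.
  by rewrite oppr_eq0.
apply: filterS E => p /=; rewrite /lin2 /= => -[E1 E2]; split=> //.
by rewrite -E1; ring.
Qed.

Definition swap01 (p : 'rV[R]_3) : 'rV[R]_3 := row3 (p 0 i1) (p 0 i0) (p 0 i2).

Lemma swap01K : cancel swap01 swap01.
Proof. by move=> p; apply: row3_eq; rewrite !mxE !sel3E ?mxE ?sel3E. Qed.

Lemma preform_swap f p0 Q : preform f p0 Q -> preform f p0 (fun p => Q (swap01 p)).
Proof.
move=> [sigma [rho [U [a [b [c [d [Ls sr rp D E]]]]]]]].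
have ls : linear swap01.
  by move=> k x y; apply: row3_eq; rewrite !mxE !sel3E ?mxE.
have cs := linear_rV_continuous ls.
have s0 : swap01 0 = 0 by apply: row3_eq; rewrite !mxE ?sel3E ?mxE.
exists (fun p => sigma (swap01 p)), rho, U, a, b, c, d; split=> //.
  have lid : linear (@id 'rV[R]_3) by [].
  have := @local_diffeo_lin _ _ _ _ sigma 0 p0 (mklin ls) (mklin ls) (mklin lid) (mklin lid)
    cs cs (fun x => cvg_id) (fun x => cvg_id) swap01K swap01K (fun x => erefl) (fun x => erefl) Ls.
  by rewrite /= s0.
pose P p := let z := lin2 a b c d (f (sigma p)) in
   rho (row3 0 0 z.2) * z.1 = Q p /\ rho (row3 0 0 z.2) * z.2 = p 0 i2.
have : \forall p \near 0, P (swap01 p).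
  by apply: (@continuous_near _ _ _ swap01 0 P (@cs 0)); rewrite s0.
by rewrite /P; apply: filterS => p; rewrite /= mxE sel3E.
Qed.

(** The derivative at 0 is the multiplication by rho 0. *)
Lemma scaling_local_diffeo (rho : 'rV[R]_3 -> R) U : open U -> U 0 -> smooth_on U rho ->
  0 < rho 0 ->
  local_diffeo (fun p : 'rV[R]_2 => rho (row3 0 0 (p 0 1)) *: p) 0 0.
Proof.
move=> oU U0 sr r0.
have le : linear (fun p : 'rV[R]_2 => row3 0 0 (p 0 1)).
  by move=> k x y; apply: row3_eq; rewrite !mxE ?sel3E ?mxE//; ring.
have ce := linear_rV_continuous le.
pose rho2 (p : 'rV[R]_2) := rho (row3 0 0 (p 0 1)).
pose U2 := (fun p : 'rV[R]_2 => row3 0 0 (p 0 1)) @^-1` U.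
have oU2 : open U2 by apply: open_comp => // x _; exact: ce.
have e0 : row3 0 0 ((0 : 'rV[R]_2) 0 1) = 0.
  by apply: row3_eq; rewrite !mxE ?sel3E ?mxE.
have U20 : U2 0 by rewrite /U2 /= e0.
have sr2 : smooth_on U2 rho2 by exact: (@smooth_on_lin _ _ _ rho (mklin le) U ce sr).
pose F j (p : 'rV[R]_2) := p 0 j * rho2 p + p 0 j * 0.
have sF j : smooth_on U2 (F j).
  by apply: smoothD => //; apply: smoothM => //; [exact: smooth_coord|exact: smooth_coord|exact: smooth_cst].
have dr : differentiable rho2 0 by exact: smooth_on_differentiable sr2 U20.
have DF i j : 'D_'e_i (F j) 0 = (i == j)%:R * rho 0.
  rewrite (derive_coordM j j 'e_i dr (differentiable_cst _ _)) mulr0 addr0 mxE eqxx /=.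
  by rewrite eq_sym /rho2 e0.
have := inverse_function_diag oU2 U20 sF.
have -> : (fun x => \row_j F j x) = (fun p : 'rV[R]_2 => rho (row3 0 0 (p 0 1)) *: p).
  by apply/funext => p; apply/rowP => j; rewrite !mxE /F /rho2; ring.
have -> : \row_j F j 0 = 0 by apply/rowP => j; rewrite !mxE /F !mxE mul0r mul0r addr0.
apply; first by move=> i j ij; rewrite DF (negbTE ij) mul0r.
by move=> j; rewrite DF eqxx mul1r gt_eqF.
Qed.

(** Multiplication by the positive number rho(w) preserves rays and a linear map
    permutes them; tau inverts the composite of the two. *)
Theorem preform_radially_equivalent f p0 Q : smooth_on setT f -> f p0 = 0 ->
  preform f p0 Q -> radially_equivalent f p0 (fun p => (Q p, p 0 i2)).
Proof.
move=> sf f0 [sigma [rho [U [a [b [c [d [Ls [oU U0 sr] rp D E]]]]]]]].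
have r0 : 0 < rho 0 by exact: nbhs_singleton rp.
pose T2 (p : 'rV[R]_2) := rho (row3 0 0 (p 0 1)) *: p.
have LT : local_diffeo T2 0 0 by exact: scaling_local_diffeo sr r0.
have [S2 LS [ST TS]] := local_diffeo_inv LT.
have S20 : S2 0 = 0 by have [] := LS.
pose e := (a * d - b * c)^-1.
pose lin := lin2 a b c d; pose lin' := lin2 (e * d) (- e * b) (- e * c) (e * a).
have linK : cancel lin lin' by exact: lin2K.
have lin'K : cancel lin' lin.
  by move=> [u w]; rewrite /lin /lin' /lin2 /= /e; congr pair; field.
have ll := lin2_linear a b c d.
have ll' := lin2_linear (e * d) (- e * b) (- e * c) (e * a).
have lm : linear (lin' \o of_row).
  by move=> k x y; rewrite /= of_row_linear; exact: ll'.
have lm' : linear (to_row \o lin).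
  by move=> k x y; rewrite /= [lin _]ll; exact: to_row_linear.
have lt := to_row_linear; have lo := of_row_linear.
pose tau z := lin' (of_row (S2 (to_row z))).
have Ltau : local_diffeo tau 0 0.
  have := @local_diffeo_lin _ _ _ _ S2 0 0 (mklin lt) (mklin lo) (mklin lm) (mklin lm')
    (linear_pair_continuous lt) (linear_rV_continuous lo)
    (linear_rV_continuous lm) (linear_pair_continuous lm') to_rowK of_rowK _ _ LS.
  move=> /(_ (fun p => _) (fun z => _)) H.
  have {}H := H (fun p => ltac:(by rewrite /= lin'K of_rowK)) (fun z => ltac:(by rewrite /= to_rowK linK)).
  by move: H; rewrite (linear0 (mklin lo)) (linear0 (mklin lm)).
have cto : continuous to_row by exact: linear_pair_continuous.
have to0 : to_row 0 = 0 by exact: (linear0 (mklin lt)).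
have near_to (P : set 'rV[R]_2) : nbhs 0 P -> \forall z \near (0 : R * R), P (to_row z).
  by move=> nP; apply: (continuous_near (@cto 0)); rewrite to0.
exists sigma, tau; split=> //.
- split=> //.
  pose P (y : 'rV[R]_2) := 0 < rho (row3 0 0 (S2 y 0 1)) /\ T2 (S2 y) = y.
  have nP : nbhs 0 P.
    apply: filterI => //.
    have cS : {for 0, continuous S2}.
      have [g [A [B [[_ A0] _ _ _ [sS _ _ _]]]]] := local_diffeo_sub LS openT I.
      exact: smooth_on_continuous sS A0.
    apply: (@continuous_near _ _ _ S2 0 (fun y => 0 < rho (row3 0 0 (y 0 1))) cS); rewrite S20.
    have le : linear (fun p : 'rV[R]_2 => row3 0 0 (p 0 1)).
      by move=> k x y; apply: row3_eq; rewrite !mxE ?sel3E ?mxE//; ring.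
    apply: (@continuous_near _ _ _ (fun p : 'rV[R]_2 => row3 0 0 (p 0 1)) 0 (fun q => 0 < rho q)).
      exact: linear_rV_continuous.
    by rewrite (_ : row3 0 0 _ = 0)//; exact: (linear0 (mklin le)).
  exists (to_row @^-1` P); first exact: near_to.
  move=> theta; pose v := (cos theta, sin theta).
  have v0 : lin' v != 0.
    apply/eqP => lv; have : v = 0 by rewrite -(lin'K v) lv; exact: (linear0 (mklin ll)).
    move=> -[c0 s0]; have := cos2Dsin2 theta; rewrite c0 s0 !expr0n /= addr0 => /esym/eqP.
    by rewrite oner_eq0.
  have [theta' [r' [r'0 vE]]] : exists theta' r', 0 < r' /\ lin' v = (r' * cos theta', r' * sin theta').
    exact: (@polar (lin' v).1 (lin' v).2).
  exists theta' => _ [z [[r_gt0 TSz] [r r0' zE]] <-].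
  set k := rho _ in r_gt0.
  exists (k^-1 * r * r'); first by rewrite !mulr_gt0// invr_gt0.
  have yE : S2 (to_row z) = k^-1 *: to_row z.
    by rewrite -[in RHS]TSz /T2 -/k scalerA mulVf ?scale1r// gt_eqF.
  have -> : tau z = (k^-1 * r) *: lin' v.
    have oZ (t : R) y : of_row (t *: y) = t *: of_row y by rewrite /of_row !mxE.
    have lZ (t : R) y : lin' (t *: y) = t *: lin' y.
      by rewrite /lin' /lin2; congr pair; rewrite /= /GRing.scale /=; ring.
    rewrite /tau yE oZ to_rowK lZ -scalerA -(lZ r); congr (_ *: lin' _).
    by rewrite zE /v; congr pair.
  by rewrite vE; congr pair; rewrite /= /GRing.scale /=; ring.
have csig : {for 0, continuous sigma}.
  have [g [A [B [[_ A0] _ _ _ [ss _ _ _]]]]] := local_diffeo_sub Ls openT I.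
  exact: smooth_on_continuous ss A0.
have sig0 : sigma 0 = p0 by have [] := Ls.
have near_f (P : set 'rV[R]_2) : nbhs 0 P -> \forall p \near 0, P (to_row (lin (f (sigma p)))).
  move=> nP; apply: (@continuous_near _ _ _ sigma 0 (fun x => P (to_row (lin (f x)))) csig).
  rewrite sig0; apply: (@continuous_near _ _ _ f p0 (fun x => P (to_row (lin x)))).
    exact: smooth_on_continuous sf _.
  rewrite f0; apply: (@continuous_near _ _ _ lin 0 (fun x => P (to_row x))).
    exact: linear_pair_continuous.
  rewrite (_ : lin 0 = 0); last exact: (linear0 (mklin ll)).
  exact: near_to.
apply: filterS2 E (near_f _ ST) => p /= [E1 E2] ST'.
rewrite /tau; apply: (can_inj linK); rewrite lin'K.
apply: (can_inj to_rowK); rewrite of_rowK -ST' /T2; congr S2.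
by apply/rowP; apply: I2P; rewrite !mxE /=; [exact: E1|exact: E2].
Qed.

End radial.

(** * Classification of nondegenerate zeros *)

Section cross_product.
Context {R : realType}.
Implicit Types p q n : 'rV[R]_3.

Lemma dot3_linear n : linear (dot3 n).
Proof. by move=> k x y; rewrite /dot3 !mxE /GRing.scale /=; ring. Qed.

Lemma dot3_delta n i : dot3 n 'e_i = n 0 i.
Proof. by move: i; apply: I3P; rewrite /dot3 !mxE /=; ring. Qed.

Lemma dot3_eq0 n : dot3 n n = 0 -> n = 0.
Proof.
rewrite /dot3 -!expr2 => d0.
have := sqr_ge0 (n 0 i0); have := sqr_ge0 (n 0 i1); have := sqr_ge0 (n 0 i2).
move=> t2 t1 t0.
have z i : n 0 i ^+ 2 = 0 -> n 0 i = 0 by move=> /eqP; rewrite sqrf_eq0 => /eqP.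
apply: row3_eq; rewrite [RHS]mxE; apply: z; lra.
Qed.

(** The cross product is orthogonal to p and q, but not to itself. *)
Lemma cross_unitmx p q : cross p q != 0 -> mat3 p q (cross p q) \in unitmx.
Proof.
have n1 : dot3 (cross p q) p = 0 by have := dot_cross_l p q; rewrite /dot3 => <-; ring.
have n2 : dot3 (cross p q) q = 0 by have := dot_cross_r p q; rewrite /dot3 => <-; ring.
have crossDl (a b : R) : cross (a *: p + b *: q) q = a *: cross p q.
  by apply: row3_eq; rewrite !(mxE, sel3E); ring.
have crossDr (a b : R) : cross p (a *: p + b *: q) = b *: cross p q.
  by apply: row3_eq; rewrite !(mxE, sel3E); ring.
have cross0l : cross 0 q = 0 by apply: row3_eq; rewrite !(mxE, sel3E); ring.
have cross0r : cross p 0 = 0 by apply: row3_eq; rewrite !(mxE, sel3E); ring.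
move: (cross p q) n1 n2 crossDl crossDr => n n1 n2 crossDl crossDr n0.
rewrite -row_free_unit; apply: inj_row_free => x.
have -> : x *m mat3 p q n = x 0 i0 *: p + x 0 i1 *: q + x 0 i2 *: n.
  by apply/rowP => j; rewrite !mxE sum3 !mxE !sel3E.
move=> x0; have x2 : x 0 i2 = 0.
  have E : dot3 n (x 0 i0 *: p + x 0 i1 *: q + x 0 i2 *: n) =
     x 0 i0 * dot3 n p + x 0 i1 * dot3 n q + x 0 i2 * dot3 n n.
    by rewrite /dot3 !mxE; ring.
  have d00 : dot3 n 0 = 0 by rewrite /dot3 !mxE; ring.
  move: E; rewrite x0 n1 n2 !mulr0 !add0r d00 => /esym/eqP.
  by rewrite mulf_eq0 => /orP[/eqP//|/eqP/dot3_eq0 n00]; rewrite n00 eqxx in n0.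
move: x0; rewrite x2 scale0r addr0 => x0.
have sc k : k *: n = 0 -> k = 0 by move=> /eqP; rewrite scaler_eq0 (negbTE n0) orbF => /eqP.
by apply: row3_eq; rewrite [RHS]mxE//; apply: sc;
  [rewrite -(crossDl _ (x 0 i1)) x0|rewrite -(crossDr (x 0 i0)) x0].
Qed.

Lemma cross_eq0 p q : cross p q = 0 -> q != 0 -> exists k, p + k *: q = 0.
Proof.
move=> pq0 q0; have [i qi] : exists i, q 0 i != 0.
  apply/existsP; apply: contraNT q0; rewrite negb_exists => /forallP h.
  by apply/eqP/rowP => j; rewrite mxE; apply/eqP; have := h j; rewrite negbK.
have c0 : p 0 i1 * q 0 i2 - p 0 i2 * q 0 i1 = 0 by have := congr1 (fun x : 'rV[R]_3 => x 0 i0) pq0; rewrite row3_0 mxE.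
have c1 : p 0 i2 * q 0 i0 - p 0 i0 * q 0 i2 = 0 by have := congr1 (fun x : 'rV[R]_3 => x 0 i1) pq0; rewrite row3_1 mxE.
have c2 : p 0 i0 * q 0 i1 - p 0 i1 * q 0 i0 = 0 by have := congr1 (fun x : 'rV[R]_3 => x 0 i2) pq0; rewrite row3_2 mxE.
exists (- (p 0 i / q 0 i)); apply/rowP => j; rewrite !mxE mulNr mulrAC.
have -> : p 0 i * q 0 j = p 0 j * q 0 i.
  by move: i j {qi}; do 2!apply: I3P; lra.
by rewrite mulfK// subrr.
Qed.

End cross_product.

Section classification.
Context {R : realType}.
Implicit Types (f : 'rV[R]_3 -> R * R) (c : bool) (lambda : R).

Definition comp c (z : R * R) : R := if c then z.1 else z.2.

Lemma comp_linear c : linear (comp c).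
Proof. by case: c => k [x1 x2] [y1 y2]. Qed.

(** When the differentials of the two components are dependent, a combination in
    which one of them has coefficient 1 is critical; c tells which one. *)
Definition combination f c lambda (p : 'rV[R]_3) : R :=
  comp c (f p) + lambda * comp (~~ c) (f p).

Definition grad (u : 'rV[R]_3 -> R) p : 'rV[R]_3 := \row_j 'D_'e_j u p.
Definition hess (u : 'rV[R]_3 -> R) p (i j : 'I_3) : R := 'D_'e_i ('D_'e_j u) p.

(** For a critical combination u, and for w the other component: the Hessian of u
    is nondegenerate, and so is its restriction to the kernel of dw. This implies
    that dw is not zero. *)
Definition nondegenerate f p := forall c lambda,
  grad (combination f c lambda) p = 0 ->
  det_sym (hess (combination f c lambda) p) *
  bordered (hess (combination f c lambda) p) (grad (fun p => comp (~~ c) (f p)) p) != 0.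

Lemma smooth_component (V : normedModType R) (f : V -> R * R) c :
  smooth_on setT f -> smooth_on setT (fun p => comp c (f p)).
Proof.
move=> sf; apply: (@smooth_comp_lin _ _ _ _ f (mklin (@comp_linear c))) => //.
  exact: openT.
exact/linear_pair_continuous/comp_linear.
Qed.

Lemma smooth_combination f c lambda : smooth_on setT f -> smooth_on setT (combination f c lambda).
Proof.
move=> sf; have oT : open [set: 'rV[R]_3] by exact: openT.
apply: smoothD => //; first exact: smooth_component.
by apply: smoothM => //; [exact: smooth_cst|exact: smooth_component].
Qed.

Lemma radial_transformation_id : radial_transformation (@id (R * R)).
Proof.
split.
  have lid : linear (@id (R * R)) by [].
  have sid A : smooth_on A (@id (R * R)) by apply: smooth_linear => // x; exact: cvg_id.
  by apply: (@local_diffeoI _ _ _ id id setT setT) => //; exact: openT.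
exists setT; first exact: filterT.
by move=> theta; exists theta => _ [z [_ rz] <-].
Qed.

(** The two components and the linear form given by the cross product of their
    gradients are local coordinates. *)
Theorem regular_germ f p0 : smooth_on setT f -> f p0 = 0 ->
  cross (grad (fun p => (f p).1) p0) (grad (fun p => (f p).2) p0) != 0 ->
  radially_equivalent f p0 regular_form.
Proof.
move=> sf f0; set g1 := grad _ _; set g2 := grad _ _; set n := cross _ _ => n0.
have oT : open [set: 'rV[R]_3] by exact: openT.
have s1 : smooth_on setT (fun p => (f p).1) by exact: (@smooth_component _ f true sf).
have s2 : smooth_on setT (fun p => (f p).2) by exact: (@smooth_component _ f false sf).
have ll := dot3_linear n; have cl := linear_rV_continuous ll.
have uN : mat3 g1 g2 n \in unitmx by exact: cross_unitmx.
pose F : 'I_3 -> 'rV[R]_3 -> R := sel3 (fun p => (f p).1) (fun p => (f p).2)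
  (fun p => dot3 n p - dot3 n p0).
have sl : smooth_on setT (dot3 n) by exact: smooth_linear.
have sF j : smooth_on setT (F j).
  move: j; apply: I3P; rewrite /F ?sel3E//.
  by apply: smoothB => //; exact: smooth_cst.
have DF : \matrix_(i, j) 'D_'e_i (F j) p0 = (mat3 g1 g2 n)^T.
  have m3 i j : mat3 g1 g2 n i j = sel3 g1 g2 n i 0 j by rewrite mxE.
  apply/matrixP => i j; rewrite mxE [RHS]mxE m3; clear m3; move: j; apply: I3P; rewrite /F !sel3E; [by rewrite mxE|by rewrite mxE|].
  rewrite (derive_subr 'e_i (smooth_on_differentiable sl I) (differentiable_cst _ _)).
  rewrite derive_cst subr0 deriveE; last exact: smooth_on_differentiable sl I.
  have -> : 'd (dot3 n) p0 'e_i = dot3 n 'e_i.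
    exact: (congr1 (fun h => h 'e_i) (@diff_lin _ _ _ (mklin ll) p0 cl)).
  by rewrite dot3_delta.
have LF : local_diffeo (fun p => \row_j F j p) p0 0.
  have -> : 0 = \row_j F j p0.
    by apply: row3_eq; rewrite !mxE /F ?sel3E ?f0 ?subrr.
  by apply: (inverse_function_row oT I sF); rewrite DF unitmx_tr.
have [g Lg [_ gK]] := local_diffeo_inv LF.
exists g, id; split=> //; first exact: radial_transformation_id.
apply: filterS gK => q qE.
have Fq j : F j (g q) = q 0 j by rewrite -[in RHS]qE mxE.
have := Fq i0; have := Fq i1; rewrite /F !sel3E => q1 q0.
by rewrite [LHS]surjective_pairing q0 q1.
Qed.

(** The eight sign patterns reduce to three: u may be replaced by - u, and the
   first two coordinates may be exchanged. *)
Lemma preform_signs f p0 (e : 'I_3 -> R) : smooth_on setT f -> f p0 = 0 ->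
  (forall j, e j = 1 \/ e j = -1) ->
  preform f p0 (fun p => e i0 * p 0 i0 ^+ 2 + e i1 * p 0 i1 ^+ 2 + e i2 * p 0 i2 ^+ 2) ->
  [\/ radially_equivalent f p0 definite_hyperbolic_form,
      radially_equivalent f p0 definite_elliptic_form
    | radially_equivalent f p0 indefinite_form].
Proof.
move=> sf f0 he P.
have RE Q (F : 'rV[R]_3 -> R * R) : preform f p0 Q -> (forall p, F p = (Q p, p 0 i2)) ->
    radially_equivalent f p0 F.
  move=> PQ FE; rewrite (_ : F = fun p => (Q p, p 0 i2)); last exact/funext.
  exact: preform_radially_equivalent.
have PN := preformN P; have PS := preform_swap P; have PNS := preform_swap PN.
have [h0|h0] := he i0; have [h1|h1] := he i1; have [h2|h2] := he i2;
  rewrite ?h0 ?h1 ?h2 in P PN PS PNS.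
- apply: Or32; apply: (RE _ _ P) => p; congr pair; rewrite /=; ring.
- apply: Or31; apply: (RE _ _ P) => p; congr pair; rewrite /=; ring.
- apply: Or33; apply: (RE _ _ PNS) => p; congr pair; rewrite /= !mxE !sel3E; ring.
- apply: Or33; apply: (RE _ _ P) => p; congr pair; rewrite /=; ring.
- apply: Or33; apply: (RE _ _ PN) => p; congr pair; rewrite /=; ring.
- apply: Or33; apply: (RE _ _ PS) => p; congr pair; rewrite /= !mxE !sel3E; ring.
- apply: Or31; apply: (RE _ _ PN) => p; congr pair; rewrite /=; ring.
- apply: Or32; apply: (RE _ _ PN) => p; congr pair; rewrite /=; ring.
Qed.

(** When the differentials of the components are dependent, a critical
    combination and the other component can be put in the form of germ_form, by a
    basis adapted to the Hessian of the former and the differential of the latter. *)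
Theorem classification f p0 : smooth_on setT f -> f p0 = 0 -> nondegenerate f p0 ->
  [\/ radially_equivalent f p0 regular_form,
      radially_equivalent f p0 definite_hyperbolic_form,
      radially_equivalent f p0 definite_elliptic_form
    | radially_equivalent f p0 indefinite_form].
Proof.
move=> sf f0 nd.
have [cr|cr] := eqVneq (cross (grad (fun p => (f p).1) p0) (grad (fun p => (f p).2) p0)) 0; last first.
  by apply: Or41; exact: regular_germ.
have [c [lambda gu0]] : exists c lambda, grad (combination f c lambda) p0 = 0.
  have gE c lambda : grad (combination f c lambda) p0 =
      grad (fun p => comp c (f p)) p0 + lambda *: grad (fun p => comp (~~ c) (f p)) p0.
    apply/rowP => j; rewrite !mxE.
    have d1 := smooth_on_differentiable (smooth_component c sf) (I : setT p0).
    have d2 := smooth_on_differentiable (smooth_component (~~ c) sf) (I : setT p0).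
    rewrite (derive_addr 'e_j d1 (differentiableM (differentiable_cst lambda p0) d2)).
    rewrite (derive_mulr 'e_j (differentiable_cst lambda p0) d2) derive_cst.
    by rewrite mulr0 addr0.
  have [g20|g20] := eqVneq (grad (fun p => (f p).2) p0) 0.
    by exists false, 0; rewrite gE scale0r addr0.
  by have [k kE] := cross_eq0 cr g20; exists true, k; rewrite gE.
have := nd c lambda gu0; rewrite mulf_eq0 negb_or => /andP[detH bordH].
pose u := combination f c lambda; pose w p := comp (~~ c) (f p).
have su : smooth_on setT u by exact: smooth_combination.
have sw : smooth_on setT w by exact: smooth_component.
have Hsym i j : hess u p0 i j = hess u p0 j i by exact: (schwarz 'e_j 'e_i openT I su).
have [N [h [uN Nv NH h0]]] := adapted_basis Hsym detH bordH.
have u0 : u p0 = 0 by rewrite /u /combination f0; case: (c); rewrite /= mulr0 addr0.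
have w0 : w p0 = 0 by rewrite /w f0; case: (c).
have Du j : 'D_'e_j u p0 = 0.
  by have := congr1 (fun x : 'rV[R]_3 => x 0 j) gu0; rewrite !mxE.
have Nv' : N *m (\col_j 'D_'e_j w p0) = \col_j (j == i2)%:R.
  by rewrite -Nv; congr (_ *m _); apply/colP => j; rewrite !mxE.
have [sigma [rho [U [Ls sr _ rp E]]]] := germ_form su sw u0 w0 Du uN Nv' NH h0.
have P : preform f p0 (fun p => Num.sg (h i0) * p 0 i0 ^+ 2 + Num.sg (h i1) * p 0 i1 ^+ 2 +
    Num.sg (h i2) * p 0 i2 ^+ 2).
  exists sigma, rho, U, (if c then 1 else lambda), (if c then lambda else 1),
    (if c then 0 else 1), (if c then 1 else 0).
  split=> //.
    by case: (c); rewrite ?mulr1 ?mulr0 ?subr0 ?mul1r ?sub0r ?oppr_eq0 ?oner_neq0.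
  apply: filterS E => p; rewrite /u /w /combination /lin2 /=.
  by case: (c) => /=; rewrite !(mul1r, mul0r, add0r, addr0)// (addrC (lambda * _)).
have sg1 j : Num.sg (h j) = 1 \/ Num.sg (h j) = -1.
  by have := h0 j; case: sgrP => // _ _; [left|right].
have [] := preform_signs sf f0 sg1 P; by [exact: Or42|exact: Or43|exact: Or44].
Qed.

End classification.

(** * Smooth bump functions *)

Section bump.
Context {R : realType}.

Lemma derive_chain (V : normedModType R) (f : V -> R) (h : R -> R) (d : R) (x v : V) :
  differentiable f x -> is_derive (f x) 1 h d ->
  differentiable (fun y => h (f y)) x /\ 'D_v (fun y => h (f y)) x = d * 'D_v f x.
Proof.
move=> df hd; have dh : differentiable h (f x).
  by apply/derivable1_diffP; exact: (@ex_derive _ _ _ _ _ _ _ hd).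
have dhf : differentiable (h \o f) x by exact: differentiable_comp.
split; first exact: dhf.
rewrite -[fun y => _]/(h \o f) (deriveE _ dhf) (diff_comp df dh) /= (deriveE _ df).
have hE := @derive_val _ _ _ _ _ _ _ hd; rewrite (deriveE _ dh) in hE.
rewrite -[X in 'd _ _ X]mulr1 -[_ * 1]/('d f x v *: (1 : R)) linearZ /= hE.
by rewrite mulrC.
Qed.

(** The family is closed under differentiation up to smooth factors, which is
    what makes a proof of smoothness by induction possible. *)
Definition flat (j : nat) (u : R) : R :=
  if 0 < u then expR (- u^-1) * (u^-1) ^+ j else 0.

Lemma flat_le0 j u : u <= 0 -> flat j u = 0.
Proof. by rewrite /flat leNgt => /negbTE ->. Qed.

Lemma flat_ge0 j u : 0 <= flat j u.
Proof.
rewrite /flat; case: ifP => // u0; apply: mulr_ge0; first exact: expR_ge0.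
by rewrite exprn_ge0// invr_ge0 ltW.
Qed.

Lemma flat0_gt0 u : 0 < u -> 0 < flat 0 u.
Proof. by move=> u0; rewrite /flat u0 expr0 mulr1 expR_gt0. Qed.

(** The exponential dominates all powers. This bound shows that flat j has
    derivative 0 at 0. *)
Lemma flat_quadratic j u : `|flat j u| <= (j.+2)`!%:R * u ^+ 2.
Proof.
have f0 : 0 < (j.+2)`!%:R :> R by rewrite ltr0n fact_gt0.
rewrite ger0_norm ?flat_ge0// /flat; case: ifP => [u0|_]; last first.
  by rewrite mulr_ge0 ?sqr_ge0// ltW.
have v0 : 0 < u^-1 by rewrite invr_gt0.
have E : (u^-1) ^+ j.+2 <= (j.+2)`!%:R * expR (u^-1).
  have := expR_ge1Dxn j.+1 (ltW v0) => h.
  have : (u^-1) ^+ j.+2 / (j.+2)`!%:R <= expR (u^-1) by apply: le_trans h; rewrite lerDr.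
  by rewrite ler_pdivrMr// mulrC.
have Ee : expR (- u^-1) * expR u^-1 = 1 by rewrite -expRD addNr expR0.
have e0 := expR_gt0 (- u^-1).
have U : u^-1 * u = 1 by rewrite mulVf// gt_eqF.
have -> : expR (- u^-1) * u^-1 ^+ j = expR (- u^-1) * u^-1 ^+ j.+2 * u ^+ 2.
  rewrite !exprS expr0 mulr1; set a := expR _; set b := _ ^+ j.
  by transitivity (a * b * (u^-1 * u) * (u^-1 * u)); [rewrite U !mulr1|ring].
rewrite ler_pM2r ?exprn_gt0//; apply: le_trans (ler_wpM2l (ltW e0) E) _.
by rewrite mulrCA Ee mulr1.
Qed.

Lemma is_derive_flat j u :
  is_derive u (1 : R) (flat j) (flat j.+2 u - j%:R * flat j.+1 u).
Proof.
have [u0|u0|u0] := ltgtP u 0.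
- rewrite !(flat_le0 _ (ltW u0)) mulr0 subr0.
  apply: (near_eq_is_derive _ (is_derive_cst (0 : R) u 1)).
  have nu : \forall x \near u, x < 0 by exact: open_near (@open_lt R 0) u0.
  by apply: filterS nu => x x0; rewrite flat_le0// ltW.
- have un0 : u != 0 by rewrite gt_eqF.
  pose g (x : R) := expR (- x^-1) * (x^-1) ^+ j.
  have dV : is_derive u (1 : R) (fun x : R => x^-1) (- u ^- 2).
    by have := @is_deriveV _ id u 1 1 un0 (is_derive_id _ _); rewrite /GRing.scale /= mulr1.
  have dN : is_derive u (1 : R) (fun x : R => - x^-1) (u ^- 2).
    by have := is_deriveN dV; rewrite opprK.
  have dE : is_derive u (1 : R) (fun x : R => expR (- x^-1)) (expR (- u^-1) * u ^- 2).
    exact: (@is_derive1_comp _ expR (fun x => - x^-1) u _ _ (is_derive_expR _) dN).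
  have dX := @is_deriveX _ _ _ j _ _ _ dV.
  have dg := is_deriveM dE dX.
  apply: (@near_eq_is_derive _ _ _ g).
    have nu : \forall x \near u, 0 < x by exact: open_near (@open_gt R 0) u0.
    by apply: filterS nu => x x0; rewrite /flat x0.
  have gE : g = (fun x : R => expR (- x^-1)) * (fun x : R => x^-1) ^+ j.
    by apply/funext => x; rewrite /g fctE exprfctE.
  rewrite gE; apply: is_derive_eq; rewrite /flat u0 /GRing.scale /=.
  rewrite exprfctE; set a := expR _; rewrite -exprVn; set b := u^-1.
  case: (j) => [|k] /=; first by rewrite !expr0 expr2; ring.
  by rewrite !exprS expr0; ring.
rewrite u0 !flat_le0// mulr0 subr0.
have E : forall e, 0 < e -> \forall h \near (0 : R),
    `|flat j (h + 0) - flat j 0 - (\0 : R -> R) h| <= e * `|h|.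
  move=> e e0; set C : R := (j.+2)`!%:R.
  have C0 : 0 < C by rewrite ltr0n fact_gt0.
  have eC : 0 < e / C by rewrite divr_gt0.
  apply: filterS (nbhsx_ballx (0 : R) (e / C) eC) => h.
  rewrite -ball_normE /= sub0r normrN => he.
  rewrite addr0 (flat_le0 j (lexx 0)) !subr0.
  apply: le_trans (flat_quadratic j h) _.
  rewrite -real_normK ?num_real// expr2 mulrA ler_wpM2r//.
  by rewrite mulrC -ler_pdivlMr// ltW.
have l0 : linear (\0 : R -> R) by move=> k x y; rewrite /GRing.scale /= mulr0 addr0.
have c0 : continuous (mklin l0) by move=> x; exact: cvg_cst.
have df : differentiable (flat j) 0.
  by apply/differentiable_epsP; exists (mklin l0).
have dE := diff_eps_unique c0 E.
apply: DeriveDef; first exact: diff_derivable.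
by rewrite (deriveE _ df) dE.
Qed.

Lemma smooth_flat (V : normedModType R) A (f : V -> R) j : open A ->
  smooth_on A f -> smooth_on A (fun x => flat j (f x)).
Proof.
move=> oA /smooth_onP sf; apply/smooth_onP => k.
elim: k j => [//|k IH] j; apply/CnS; have df x Ax := CnS_diff (sf 1) Ax : differentiable f x.
split=> [x Ax|v]; first by have [] := derive_chain 0 (df x Ax) (is_derive_flat j (f x)).
pose g x := (flat j.+2 (f x) - j%:R * flat j.+1 (f x)) * 'D_v f x.
apply: (@eq_Cn _ _ _ _ _ g) => //.
  by move=> x Ax; have [_ ->] := derive_chain v (df x Ax) (is_derive_flat j (f x)).
apply: CnM => //; last by have /CnS[] := sf k.+1.
apply: (CnD oA (IH _)); apply: Cn_opp => //.
by apply: (CnM oA _ (IH _)); exact: Cn_cst.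
Qed.

Definition step (u : R) : R := flat 0 u / (flat 0 u + flat 0 (1 - u)).

Lemma step_le0 u : u <= 0 -> step u = 0.
Proof. by move=> u0; rewrite /step flat_le0// mul0r. Qed.

Lemma step_denominator u : flat 0 u + flat 0 (1 - u) != 0.
Proof.
rewrite gt_eqF//; have [u0|u0] := ltP 0 u.
  by rewrite ltr_wpDr ?flat_ge0// flat0_gt0.
by rewrite ltr_wpDl ?flat_ge0// flat0_gt0//; lra.
Qed.

Lemma step_ge1 u : 1 <= u -> step u = 1.
Proof.
move=> u1; have := step_denominator u; rewrite /step.
by rewrite (@flat_le0 0 (1 - u)) ?subr_le0// addr0 => h; rewrite divff.
Qed.

Lemma smooth_step (V : normedModType R) A (f : V -> R) : open A ->
  smooth_on A f -> smooth_on A (fun x => step (f x)).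
Proof.
move=> oA sf; have sf' : smooth_on A (fun x => 1 - f x).
  by apply: smoothB => //; exact: smooth_cst.
apply: smoothM => //; first exact: smooth_flat.
apply: smoothV => //; first by move=> x _; exact: step_denominator.
by apply: smoothD => //; exact: smooth_flat.
Qed.

Lemma bump n (r : R) : 0 <= r -> exists (chi : 'rV[R]_n -> R) (r' : R) (O : set 'rV[R]_n),
  [/\ smooth_on setT chi, forall x, r' < `|x| -> chi x = 0, open O,
    [set x | `|x| <= r] `<=` O & forall x, O x -> chi x = 1].
Proof.
(* the sum of the squares of the coordinates is at most n r^2 on the ball, where
   u >= 2; chi is 1 where u >= 1 and 0 where u <= 0 *)
move=> r0; pose u (x : 'rV[R]_n) := n%:R * r ^+ 2 + 2 - \sum_i x 0 i ^+ 2.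
have oT : open [set: 'rV[R]_n] by exact: openT.
have su : smooth_on setT u.
  apply: smoothB => //; first exact: smooth_cst.
  apply: smooth_sum => // i; rewrite (_ : (fun _ => _) = fun x : 'rV[R]_n => x 0 i * x 0 i).
    by apply: smoothM => //; exact: smooth_coord.
  by apply/funext => x; rewrite expr2.
have cu : continuous u by move=> x; exact: (smooth_on_continuous su I).
pose C : R := n%:R * r ^+ 2 + 2.
have C0 : 0 < C by rewrite /C ltr_wpDl// mulr_ge0// sqr_ge0.
exists (fun x => step (u x)), (C + 1), [set x | 1 < u x]; split.
- exact: smooth_step.
- move=> x Cx; apply: step_le0; rewrite /u -/C subr_le0.
  rewrite leNgt; apply/negP => sC; move: Cx; rewrite ltNge => /negP; apply.
  apply: norm_rV_le => [|i]; first by rewrite addr_ge0// ltW.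
  have : x 0 i ^+ 2 < C.
    apply: le_lt_trans sC; rewrite (bigD1 i)//= lerDl sumr_ge0// => j _.
    exact: sqr_ge0.
  rewrite -(real_normK (num_real (x 0 i))); set a := `|_| => aC.
  have C1 : 0 < C + 1 by rewrite addr_gt0.
  apply: ltW; rewrite ltNge; apply/negP => Ca.
  have := ler_pM (ltW C1) (ltW C1) Ca Ca; have := mulr_gt0 C0 C0; clearbody a C.
  by move: aC; rewrite expr2; lra.
- have := smooth_open_preimage oT su (@open_gt R 1); congr (open _).
  by apply/seteqP; split=> x //= [].
- move=> x /= xr; rewrite /u.
  have : \sum_i x 0 i ^+ 2 <= n%:R * r ^+ 2.
    rewrite -[n in n%:R]card_ord -sum1_card natr_sum mulr_suml; apply: ler_sum => i _.
    rewrite mul1r -(real_normK (num_real (x 0 i))) lerXn2r ?nnegrE//.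
    exact: le_trans (coord_le_norm _ _) xr.
  by rewrite -/C; rewrite /C; lra.
by move=> x /= /ltW; exact: step_ge1.
Qed.

End bump.

(** * Compactly supported perturbations in the Whitney topology *)

Section perturbation.
Context {R : realType} {n : nat} {W : normedModType R}.
Implicit Types (f : 'rV[R]_n -> W) (vs : seq 'rV[R]_n).

Definition perturb f m (h : 'I_m -> 'rV[R]_n -> W) (a : 'rV[R]_m) : 'rV[R]_n -> W :=
  fun x => f x + \sum_j a 0 j *: h j x.

Lemma iter_derive_perturb f m (h : 'I_m -> 'rV[R]_n -> W) a vs :
  smooth_on setT f -> (forall j, smooth_on setT (h j)) ->
  iter_derive vs (perturb f h a) =
  perturb (iter_derive vs f) (fun j => iter_derive vs (h j)) a.
Proof.
move=> sf sh; elim: vs => [//|v vs /= ->]; apply/funext => x; rewrite /perturb.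
set F := iter_derive vs f; pose H j := iter_derive vs (h j).
have dF : differentiable F x by exact: sf.
have dH j : differentiable (H j) x by exact: sh.
have -> : (fun x => F x + \sum_j a 0 j *: H j x) = F + \sum_j (a 0 j \*: H j).
  by apply/funext => y; rewrite fctE; congr (_ + _); rewrite fct_sumE.
have dZ j : derivable (a 0 j \*: H j) x v by apply/derivableZ/diff_derivable.
rewrite (deriveD (diff_derivable dF) (derivable_sum dZ)) (derive_sum dZ).
congr (_ + _); apply: eq_bigr => j _.
exact: (deriveZ (a 0 j) (diff_derivable (dH j))).
Qed.

Lemma smooth_perturb f m (h : 'I_m -> 'rV[R]_n -> W) a :
  smooth_on setT f -> (forall j, smooth_on setT (h j)) -> smooth_on setT (perturb f h a).
Proof.
move=> sf sh vs x _; rewrite iter_derive_perturb//.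
have -> : perturb (iter_derive vs f) (fun j => iter_derive vs (h j)) a =
    iter_derive vs f + \sum_j (a 0 j \*: iter_derive vs (h j)).
  by apply/funext => y; rewrite fctE; congr (_ + _); rewrite fct_sumE.
apply: differentiableD; first exact: sf.
apply: differentiable_sum => j; apply: differentiableZ; exact: sh.
Qed.

Lemma iter_derive_eq0 (A : set 'rV[R]_n) f vs x : open A -> A x ->
  (forall y, A y -> f y = 0) -> iter_derive vs f x = 0.
Proof.
move=> oA Ax f0; elim: vs x Ax => [|v vs IH] x Ax /=; first exact: f0.
have <- : 'D_v (cst 0 : 'rV[R]_n -> W) x = 'D_v (iter_derive vs f) x.
  by apply: near_eq_derive; apply: filterS (open_near oA Ax) => y /IH.
by rewrite derive_cst.
Qed.

Lemma row_continuous (T : topologicalType) (U : topologicalType) N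
    (G : 'I_N -> T -> U) q :
  (forall i, {for q, continuous (G i)}) -> {for q, continuous (fun p => \row_i G i p)}.
Proof.
move=> cG P [Q vQ QP].
have : \forall p \near q, forall i, Q 0 i (G i p).
  by apply: filter_forall => i; have := vQ 0 i; rewrite mxE => /cG.
by apply: filterS => p Qp; apply: QP => i j; rewrite (ord1 i) mxE.
Qed.

Lemma perturb_continuous f m (h : 'I_m -> 'rV[R]_n -> W) x :
  {for x, continuous f} -> (forall j, {for x, continuous (h j)}) ->
  {for (x, 0), continuous (fun q : 'rV[R]_n * 'rV[R]_m => perturb f h q.2 q.1)}.
Proof.
move=> cf ch; apply: cvgD.
  exact: (cvg_comp fst f cvg_fst cf).
apply: cvg_big => [|j _]; first exact: add_continuous.
apply: cvgZ.
  exact: (cvg_comp snd (fun a : 'rV[R]_m => a 0 j) cvg_snd (@coord_continuous R 1 m 0 j 0)).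
exact: (cvg_comp fst (h j) cvg_fst (ch j)).
Qed.

(** Nothing changes outside a ball containing the supports of the h j, and on this
    ball, which is compact, finitely many open conditions on a suffice. *)
Lemma small_perturbation k (U : set (jet_space R n W k)) f m
    (h : 'I_m -> 'rV[R]_n -> W) r :
  open U -> smooth_on setT f -> (forall j, smooth_on setT (h j)) ->
  (forall j x, r < `|x| -> h j x = 0) -> (forall x, U (jet k f x)) ->
  exists2 e, 0 < e & forall a : 'rV[R]_m, `|a| < e -> forall x, U (jet k (perturb f h a) x).
Proof.
move=> oU sf sh h0 Uf; pose K : set 'rV[R]_n := [set x | `|x| <= r].
have cn : continuous (fun x : 'rV[R]_n => `|x|) by exact: norm_continuous.
have oK : open (~` K).
  have -> : ~` K = [set x | r < `|x|].
    by apply/seteqP; split=> x /=; rewrite /K /= ltNge => /negP.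
  by apply: (open_comp (D := [set y | r < y])) => [x _|]; [exact: cn|exact: open_gt].
have clK : closed K by rewrite -[K]setCK; exact: open_closedC.
have cK : compact K.
  apply: bounded_closed_compact => //.
  exists r; split; first exact: num_real.
  by move=> M rM x Kx; apply: le_trans Kx _; exact: ltW.
have jetE a x vs : iter_derive vs (perturb f h a) x =
    perturb (iter_derive vs f) (fun j => iter_derive vs (h j)) a x.
  by rewrite iter_derive_perturb.
have KU : \forall a \near (0 : 'rV[R]_m), K `<=` [set x | U (jet k (perturb f h a) x)].
  move/compact_near_coveringP: cK => cK.
  apply: (cK 'rV[R]_m (nbhs (0 : 'rV[R]_m)) (fun a x => U (jet k (perturb f h a) x)) (nbhs_filter _)) => x _.
  have c2 : {for (x, 0), continuous
      (fun q : 'rV[R]_n * 'rV[R]_m => (jet k (perturb f h q.2) q.1).2)}.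
    apply: row_continuous => i.
    rewrite /partial; set vs := flatten _.
    rewrite (_ : (fun _ => _) = fun q : 'rV[R]_n * 'rV[R]_m =>
      perturb (iter_derive vs f) (fun j => iter_derive vs (h j)) q.2 q.1); last first.
      by apply/funext => q; rewrite jetE.
    by apply: perturb_continuous => [|j]; apply: differentiable_continuous; [exact: sf|exact: sh].
  have c : {for (x, 0), continuous (fun q : 'rV[R]_n * 'rV[R]_m => jet k (perturb f h q.2) q.1)}.
    move=> P [[P1 P2] /= [xP1 vP2] PP].
    have n1 : \forall q \near (x, 0 : 'rV[R]_m), P1 q.1 by exact: cvg_fst xP1.
    by apply: filterS2 n1 (c2 _ vP2) => q q1 q2; apply: PP.
  have p0 : perturb f h 0 = f.
    apply/funext => y; rewrite /perturb big1 ?addr0// => j _.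
    by rewrite mxE scale0r.
  have Un : nbhs (jet k (perturb f h 0) x) U by apply: open_nbhs_nbhs; split=> //; rewrite p0.
  exact: (c _ Un).
have [e /= e0 he] := (nbhs_ballP _ _).1 KU.
exists e => // a ae x; have [Kx|Kx] := pselect (K x).
  by apply: (he a) => //; rewrite -ball_normE /= sub0r normrN.
suff -> : jet k (perturb f h a) x = jet k f x by [].
rewrite /jet; congr pair; apply/rowP => i; rewrite !mxE /partial jetE /perturb.
rewrite big1 ?addr0// => j _; rewrite (iter_derive_eq0 _ oK Kx) ?scaler0// => y Ky.
by apply: h0; rewrite ltNge; apply/negP.
Qed.

End perturbation.

(** * A parameter value avoided by a Lipschitz family *)

(** A fibre of f projects injectively to A, into a set with at most k elements. *)
Lemma card_pairs_fibers (A B C : finType) (f : A * C -> B) k :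
  (forall p, exists2 S : {set A}, (#|S| <= k)%N & forall q, f q = f p -> q.1 \in S) ->
  (forall p q, f p = f q -> p.1 = q.1 -> p = q) ->
  (#|A| * #|C| <= k * #|B|)%N.
Proof.
move=> hS hf; rewrite -card_prod -sum1_card (partition_big f predT)//=.
rewrite mulnC -sum_nat_const; apply: leq_sum => b _.
have [p /eqP pb|no] := pickP (fun p => f p == b); last first.
  by rewrite big_pred0// => p; rewrite -[RHS](no p).
rewrite sum1_card; have [S Sk Sf] := hS p.
have inj : {in [pred q | f q == b] &, injective (fun q : A * C => q.1)}.
  by move=> q q' /eqP qb /eqP qb'; apply: hf; rewrite qb qb'.
rewrite -(card_in_imset inj); apply: leq_trans Sk; apply: subset_leq_card.
by apply/fintype.subsetP => a /imsetP[q /eqP qb ->]; apply: Sf; rewrite qb.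
Qed.

Section avoidance.
Context {R : realType} {d : nat}.
Implicit Types y : 'rV[R]_d.

Lemma compact_closed_ball0 (r : R) : compact [set y : 'rV[R]_d | `|y| <= r].
Proof.
have cn : continuous (fun y : 'rV[R]_d => `|y|) by exact: norm_continuous.
apply: bounded_closed_compact.
  exists r; split; first exact: num_real.
  by move=> M rM x xr; apply: le_trans xr _; exact: ltW.
by apply: (closed_comp (D := [set z | z <= r])) => [x _|]; [exact: cn|exact: closed_le].
Qed.

(** A parameter which is good at the centre of a ball remains good nearby, since
    the bad sets are closed; compactness makes the radius uniform. *)
Lemma uniformly_few_bad (r : R) (bad : R -> set 'rV[R]_d) J (s : 'I_J -> R) k :
  (forall t, closed (bad t)) ->
  (forall y, `|y| <= r -> (#|[set j | `[< bad (s j) y >]]%SET| <= k)%N) ->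
  exists2 delta : R, 0 < delta & forall y, `|y| <= r ->
    (#|[set j | `[< exists2 y' : 'rV[R]_d, (`|y' - y| < delta)%R & bad (s j) y' >]]%SET| <= k)%N.
Proof.
move=> cb few; pose P (delta : R) y :=
  (#|[set j | `[< exists2 y' : 'rV[R]_d, (`|y' - y| < delta)%R & bad (s j) y' >]]%SET| <= k)%N.
suff /nbhs_ballP[e /= e0 he] : \forall delta \near (0 : R), [set y : 'rV[R]_d | `|y| <= r] `<=` P delta.
  have e2 : 0 < e / 2 by rewrite divr_gt0.
  exists (e / 2) => // y yr; apply: (he (e / 2)) => //.
  by rewrite -ball_normE /= sub0r normrN gtr0_norm// ltr_pdivrMr// ltr_pMr// ltr1n.
have /compact_near_coveringP cov := @compact_closed_ball0 r.
apply: (cov R (nbhs (0 : R)) P (nbhs_filter _)) => y yr.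
have [rho rho0 hrho] : exists2 rho : R, 0 < rho &
    forall j, ~ bad (s j) y -> forall z, `|z - y| < rho -> ~ bad (s j) z.
  have : \forall z \near nbhs (y : 'rV[R]_d), forall j, ~ bad (s j) y -> ~ bad (s j) z.
    apply: (@filter_forall _ _ (fun j z => ~ bad (s j) y -> ~ bad (s j) z) _ (nbhs_filter _)) => j; have [b|nb] := pselect (bad (s j) y).
      by apply: filterE => z /(_ b).
    have := open_near (closed_openC (cb (s j))) nb.
    by apply: filterS => z bz _.
  move=> /nbhs_ballP[e /= e0 he]; exists e => // j nb z zy; apply: (he z) => //.
  by rewrite -ball_normE /= distrC.
have r2 : 0 < rho / 2 by rewrite divr_gt0.
have n1 : \forall z \near y, `|z - y| < rho / 2.
  by apply: filterS (nbhsx_ballx y _ r2) => z; rewrite -ball_normE /= distrC.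
have n2 : \forall delta \near (0 : R), `|delta| < rho / 2.
  by apply: filterS (nbhsx_ballx (0 : R) _ r2) => z; rewrite -ball_normE /= sub0r normrN.
exists ([set z | `|z - y| < rho / 2], [set delta | `|delta| < rho / 2]) => //.
move=> [z delta] /= [zy drho]; apply: leq_trans (few y yr); apply: subset_leq_card.
apply/fintype.subsetP => j; rewrite !finset.in_set => /asboolP[y' y'z by'].
apply/asboolP; apply: contrapT => nb; apply: (hrho j nb y' _ by').
rewrite -(subrK z y') -addrA; apply: le_lt_trans (ler_normD _ _) _.
have := ler_norm delta; lra.
Qed.

Variables (r L : R) (G : R -> 'rV[R]_d -> 'rV[R]_d) (bad : R -> set 'rV[R]_d) (k : nat).
Hypothesis L0 : 0 <= L.
Hypothesis G_lipschitz : forall s y y', 0 <= s <= 1 -> `|y| <= r -> `|y'| <= r ->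
  `|G s y - G s y'| <= L * `|y - y'|.
Hypothesis bad_closed : forall s, closed (bad s).
Hypothesis bad_few : forall y J (s : 'I_J -> R), `|y| <= r -> injective s ->
  (#|[set j | `[< bad (s j) y >]]%SET| <= k)%N.

(** For each s the bad points may fill a set of full dimension, so a count is
    made over many values of s at once. With J values of s, M^d values of a and
    (c M)^d cells for y, a cell accounts for at most k values of s, and for each
    of them for one value of a, as a cell is small at the scale of the values of
    a. Were every pair (s, a) attained then J M^d <= k (c M)^d, but c does not
    depend on J. *)
Lemma avoid_lipschitz_family (eps : R) : 0 < eps ->
  exists s a, [/\ `|s| < eps, `|a| < eps &
    forall y, `|y| <= r -> bad s y -> G s y <> a].
Proof.
move=> eps0; apply: contrapT => no.
pose e : R := Num.min eps 1.
have e0 : 0 < e by rewrite lt_min eps0 ltr01.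
have [ee e1] : e <= eps /\ e <= 1 by rewrite !ge_min !lexx orbT.
(* The values of s lie in (0, e), those of a on a grid of step e / M. Cells for y
   have width w = eta / M, so that L w < e / M; c M of them
   cover [-r, r]. *)
pose eta := e / (L + 1).
have L1 : 0 < L + 1 by rewrite ltr_wpDl.
have eta0 : 0 < eta by rewrite divr_gt0.
have Leta : L * eta < e.
  by rewrite /eta mulrCA gtr_pMr// ltr_pdivrMr// mul1r ltrDl.
pose c := (Num.truncn (2 * r / eta)).+1.
have ceta : 2 * r < c%:R * eta by rewrite -ltr_pdivrMr// truncnS_gt.
pose J := (k * c ^ d).+1.
pose s (j : 'I_J) : R := e * (j%:R / J%:R).
have J0 : 0 < J%:R :> R by rewrite ltr0n.
have s01 j : 0 <= s j /\ s j < e.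
  split; first by rewrite mulr_ge0 ?divr_ge0 ?ler0n// ltW.
  by rewrite /s gtr_pMr// ltr_pdivrMr// mul1r ltr_nat.
have s_inj : injective s.
  move=> i j /(mulfI (lt0r_neq0 e0)) /(mulIf (invr_neq0 (lt0r_neq0 J0))) /eqP.
  by rewrite eqr_nat => /eqP/val_inj.
have [delta delta0 hdelta] := uniformly_few_bad bad_closed (fun y yr => bad_few yr s_inj).
pose M := (Num.truncn (eta / delta)).+1.
have M0 : 0 < M%:R :> R by rewrite ltr0n.
pose w := eta / M%:R.
have w0 : 0 < w by rewrite divr_gt0.
have wdelta : w < delta.
  by rewrite ltr_pdivrMr// mulrC -ltr_pdivrMr// truncnS_gt.
pose N := (c * M).-1.
have NE : (c * M = N.+1)%N by rewrite /N prednK.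
have cw : 2 * r < (c * M)%:R * w.
  suff -> : (c * M)%:R * w = c%:R * eta by [].
  by rewrite natrM -mulrA [M%:R * w]mulrC /w divfK// lt0r_neq0.
pose cell y : {ffun 'I_d -> 'I_N.+1} := [ffun i => inord (Num.truncn ((y 0 i + r) / w))].
have cell_close y y' : `|y| <= r -> `|y'| <= r -> cell y = cell y' -> `|y - y'| <= w.
  move=> yr yr' ce; apply: norm_rV_le => [|i]; first exact: ltW.
  have coordE z : `|z| <= r -> (((cell z i)%:R * w <= z 0 i + r) /\
      (z 0 i + r < ((cell z i).+1)%:R * w)).
    move=> zr; have zi := le_trans (coord_le_norm z i) zr.
    move: zi; rewrite ler_norml => /andP[z1 z2].
    have zw : 0 <= (z 0 i + r) / w by rewrite divr_ge0 ?(ltW w0)//; lra.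
    have /andP[t1 t2] := truncn_itv zw.
    have tN : (Num.truncn ((z 0 i + r) / w)%R < N.+1)%N.
      rewrite -NE -(ltr_nat R); apply: le_lt_trans t1 _.
      by rewrite ltr_pdivrMr//; apply: le_lt_trans cw; lra.
    by rewrite ffunE inordK// -ler_pdivlMr// -ltr_pdivrMr.
  have := coordE y yr; have := coordE y' yr'; rewrite ce => -[a1 a2] [b1 b2].
  rewrite !mxE ler_norml; move: a2 b2; rewrite -natr1 mulrDl mul1r; lra.
pose a (m : {ffun 'I_d -> 'I_M}) : 'rV[R]_d := \row_i (e * ((m i)%:R / M%:R)).
have a_small m : `|a m| < e.
  apply: (@le_lt_trans _ _ (e * (M.-1%:R / M%:R))).
    apply: norm_rV_le => [|i]; first by rewrite mulr_ge0 ?divr_ge0 ?ler0n// ltW.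
    rewrite mxE ger0_norm; last by rewrite mulr_ge0 ?divr_ge0 ?ler0n// ltW.
    by rewrite ler_pM2l// ler_pM2r ?invr_gt0// ler_nat -ltnS ltn_ord.
  by rewrite gtr_pMr// ltr_pdivrMr// mul1r ltr_nat.
have a_inj m m' : `|a m - a m'| < e / M%:R -> m = m'.
  move=> am; apply/ffunP => i; apply/val_inj/eqP; rewrite -(eqr_nat R).
  have := le_lt_trans (coord_le_norm _ i) am; rewrite !mxE -mulrBr -mulrBl.
  rewrite normrM (gtr0_norm e0) ltr_pM2l// normrM (gtr0_norm (x := M%:R^-1)) ?invr_gt0//.
  rewrite -[ltRHS]mul1r ltr_pM2r ?invr_gt0// ltr_norml => /andP[lt1 lt2].
  have le_nat (p q : nat) : p%:R < q%:R + 1 :> R -> (p <= q)%N.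
    by rewrite natr1 ltr_nat ltnS.
  by rewrite eqr_nat eqn_leq !le_nat//; lra.
have attained (p : 'I_J * {ffun 'I_d -> 'I_M}) :
    exists y, [/\ `|y| <= r, bad (s p.1) y & G (s p.1) y = a p.2].
  apply: contrapT => h; apply: no; exists (s p.1), (a p.2); split.
  - by have [? ?] := s01 p.1; rewrite ger0_norm//; exact: lt_le_trans ee.
  - exact: lt_le_trans ee.
  - by move=> y yr b Ga; apply: h; exists y.
have [Y hY] := choice attained.
have := @card_pairs_fibers _ _ _ (fun p => cell (Y p)) k.
rewrite !card_ffun !card_ord => h.
suff : (J * M ^ d <= k * N.+1 ^ d)%N.
  rewrite -NE expnMn mulnA leq_pmul2r ?expn_gt0//.
  by rewrite /J ltnn.
apply: h => [p|p q cpq pq].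
  have [yr _ _] := hY p.
  exists [set j | `[< exists2 y' : 'rV[R]_d, (`|y' - Y p| < delta)%R & bad (s j) y' >]]%SET.
    exact: hdelta.
  move=> q cq; rewrite finset.in_set; apply/asboolP; exists (Y q); last by have [] := hY q.
  have [qr _ _] := hY q.
  exact: le_lt_trans (cell_close _ _ qr yr cq) wdelta.
have [pr _ pa] := hY p; have [qr _ qa] := hY q.
suff : p.2 = q.2 by case: (p) (q) pq => [? ?] [? ?] /= -> ->.
apply: a_inj; rewrite -pa -qa pq.
have [sq0 sq1] := s01 q.1.
have sq : 0 <= s q.1 <= 1 by rewrite sq0 (le_trans (ltW sq1)).
apply: le_lt_trans (G_lipschitz sq pr qr) _.
apply: le_lt_trans (ler_wpM2l L0 (cell_close _ _ pr qr cpq)) _.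
by rewrite /w mulrA ltr_pM2r ?invr_gt0.
Qed.

End avoidance.

(** * Roots of the degeneracy condition *)

Section roots.
Context {R : realType}.
Implicit Types (p q : {poly R}) (H : 'I_3 -> 'I_3 -> R) (v : 'rV[R]_3).

Lemma card_roots p J (s : 'I_J -> R) : p != 0 -> injective s ->
  (#|[set j | (p.[s j] == 0)%R]%SET| <= (size p).-1)%N.
Proof.
move=> p0 si; set S := [set j | _]%SET.
have := @max_poly_roots _ p [seq s j | j <- enum S] p0.
rewrite size_map -cardE map_inj_uniq// enum_uniq => h.
rewrite -ltnS prednK ?size_poly_gt0//; apply: h => //.
by apply/allP => _ /mapP[j jS ->]; move: jS; rewrite mem_enum finset.in_set.
Qed.

Definition shift_diag H (s : R) : 'I_3 -> 'I_3 -> R := fun i j => H i j + s * (i == j)%:R.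

(** Both factors are monic polynomials in s, of degrees 3 and 4. *)
Lemma few_singular_shifts H v J (s : 'I_J -> R) : injective s ->
  (#|[set j | (det_sym (shift_diag H (s j)) *
      bordered (shift_diag H (s j)) (v + s j *: 'e_i0) == 0)%R]%SET| <= 7)%N.
Proof.
move=> si; pose C := adj_sym H v.
pose P := Poly [:: det_sym H;
  H i0 i0 * H i1 i1 - H i0 i1 ^+ 2 + (H i0 i0 * H i2 i2 - H i0 i2 ^+ 2)
    + (H i1 i1 * H i2 i2 - H i1 i2 ^+ 2);
  H i0 i0 + H i1 i1 + H i2 i2; 1].
(* adj (H + s) = s^2 + s (tr H - H) + adj H; Bv is the coordinate 0 of (tr H - H) v,
   and vBv its scalar product with v *)
pose Bv := (H i1 i1 + H i2 i2) * v 0 i0 - H i0 i1 * v 0 i1 - H i0 i2 * v 0 i2.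
pose vBv := (H i1 i1 + H i2 i2) * v 0 i0 ^+ 2 + (H i0 i0 + H i2 i2) * v 0 i1 ^+ 2
  + (H i0 i0 + H i1 i1) * v 0 i2 ^+ 2 - 2 * H i0 i1 * v 0 i0 * v 0 i1
  - 2 * H i0 i2 * v 0 i0 * v 0 i2 - 2 * H i1 i2 * v 0 i1 * v 0 i2.
pose Q := Poly [:: bordered H v; vBv + 2 * C 0 i0;
  v 0 i0 ^+ 2 + v 0 i1 ^+ 2 + v 0 i2 ^+ 2 + 2 * Bv + (H i1 i1 * H i2 i2 - H i1 i2 ^+ 2);
  2 * v 0 i0 + (H i1 i1 + H i2 i2); 1].
have sP : size P = 4 by rewrite (@PolyK _ 0)//= oner_neq0.
have sQ : size Q = 5 by rewrite (@PolyK _ 0)//= oner_neq0.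
have P0 : P != 0 by rewrite -size_poly_gt0 sP.
have Q0 : Q != 0 by rewrite -size_poly_gt0 sQ.
have PE t : P.[t] = det_sym (shift_diag H t).
  by rewrite horner_Poly /= /det_sym /shift_diag /=; ring.
have QE t : Q.[t] = bordered (shift_diag H t) (v + t *: 'e_i0).
  rewrite horner_Poly /= /C /vBv /Bv /bordered /dot3 /adj_sym !row3_0 !row3_1 !row3_2.
  by rewrite /shift_diag !mxE /=; ring.
have := @card_roots (P * Q) J s; rewrite mulf_neq0// => /(_ isT si).
rewrite size_mul// sP sQ; congr (_ <= _)%N; apply: eq_card => j.
by rewrite !finset.in_set hornerM PE QE.
Qed.

End roots.

(** * Lipschitz bounds for smooth functions *)

Section lipschitz.
Context {R : realType} {n : nat}.

(** The partial derivatives are bounded on the ball, which is compact. *)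
Lemma lipschitz_scalar (g : 'rV[R]_n -> R) (r : R) : smooth_on setT g ->
  exists2 L, 0 <= L & forall y y' : 'rV[R]_n, `|y| <= r -> `|y'| <= r ->
    `|g y - g y'| <= L * `|y - y'|.
Proof.
move=> sg; pose S (y : 'rV[R]_n) := \sum_j `|'D_(delta_mx 0 j) g y|.
have cS : continuous S.
  move=> y; apply: (@continuous_big _ _ _ _ _ _ _ _ _ _) => [|j _]; first exact: add_continuous.
  move=> z; apply: (@continuous_comp _ _ _ ('D_(delta_mx 0 j) g) (fun t : R => `|t|)); last exact: norm_continuous.
  exact: (smooth_on_continuous (smooth_onD _ sg) I).
have := compact_bounded (continuous_compact (continuous_subspaceT cS) (@compact_closed_ball0 R n r)).
move=> [C0 [_ /(_ (Num.max (C0 + 1) 1))]].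
set C := Num.max _ _ => hC.
have hS y : `|y| <= r -> S y <= C.
  move=> yr; apply: le_trans (ler_norm _) _; apply: hC; last by exists y.
  by rewrite lt_max ltrDl ltr01.
exists C; first by rewrite le_max ler01 orbT.
move=> y y' yr yr'.
have [t t01] : exists2 t : R, 0 <= t <= 1 &
    g ((y - y') + y') - g y' = 'D_(y - y') g (t *: (y - y') + y').
  by apply: mean_value_segment => t _; exact: (smooth_on_differentiable sg I).
rewrite subrK => ->; set z := _ + _.
have zr : `|z| <= r.
  have -> : z = t *: y + (1 - t) *: y'.
    by rewrite /z scalerBr scalerBl scale1r -addrA (addrC (- _)).
  have [t0 t1] := andP t01; apply: le_trans (ler_normD _ _) _; rewrite !normrZ.
  rewrite ger0_norm// ger0_norm ?subr_ge0//.
  have := ler_wpM2l t0 yr; have := ler_wpM2l (_ : 0 <= 1 - t) yr'.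
  rewrite subr_ge0 => /(_ t1); lra.
have dz : differentiable g z by exact: (smooth_on_differentiable sg I).
rewrite (deriveE _ dz) (diff_sum_coord _ dz).
apply: (@le_trans _ _ (S z * `|y - y'|)); last by rewrite ler_wpM2r// hS.
apply: le_trans (ler_norm_sum _ _ _) _; rewrite mulr_suml; apply: ler_sum => j _.
by rewrite normrM mulrC ler_wpM2l// coord_le_norm.
Qed.

Lemma lipschitz_vector m (g : 'rV[R]_n -> 'rV[R]_m) (r : R) : smooth_on setT g ->
  exists2 L, 0 <= L & forall y y' : 'rV[R]_n, `|y| <= r -> `|y'| <= r ->
    `|g y - g y'| <= L * `|y - y'|.
Proof.
move=> /(smooth_coordP _ openT) sg.
have /choice[L hL] i : exists L, 0 <= L /\ forall y y' : 'rV[R]_n, `|y| <= r -> `|y'| <= r ->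
    `|g y 0 i - g y' 0 i| <= L * `|y - y'|.
  by have [L L0 hL] := lipschitz_scalar r (sg i); exists L.
have L0 : 0 <= \sum_i L i by apply: sumr_ge0 => i _; have [] := hL i.
exists (\sum_i L i) => // y y' yr yr'; apply: norm_rV_le => [|i]; first exact: mulr_ge0.
have [_ h] := hL i; rewrite !mxE; apply: le_trans (h y y' yr yr') _.
rewrite ler_wpM2r// (bigD1 i)//= lerDl sumr_ge0// => j _.
by have [] := hL j.
Qed.

End lipschitz.

(** * Removal of degenerate zeros by a quadratic perturbation *)

(** For a polynomial function the derivative is read off an exact expansion. *)
Lemma derive_expansion (R : realType) (V : normedModType R) (F : V -> R) x v L Q :
  (forall h : R, F (h *: v + x) - F x = h * L + h ^+ 2 * Q) -> 'D_v F x = L.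
Proof.
move=> E; apply: cvg_lim => //.
have c : h * Q @[h --> (0 : R)] --> (0 : R).
  by rewrite -[Z in _ --> Z](mul0r Q); apply: cvgM; [exact: cvg_id|exact: cvg_cst].
have c' : L + h * Q @[h --> (0 : R)^'] --> L.
  rewrite -[Z in _ --> Z]addr0; apply: cvgD; first exact: cvg_cst.
  exact: cvg_within_filter c.
apply: cvg_trans c'; apply: near_eq_cvg.
apply: filterS (@nbhs_dnbhs_neq R 0) => h h0 /=.
by rewrite /= E /GRing.scale /= expr2; field.
Qed.

Lemma smooth_row_mx (R : realType) (V : normedModType R) m n A
    (f : V -> 'rV[R]_m) (g : V -> 'rV[R]_n) : open A ->
  smooth_on A f -> smooth_on A g -> smooth_on A (fun x => row_mx (f x) (g x)).
Proof.
move=> oA /(smooth_coordP _ oA) sf /(smooth_coordP _ oA) sg.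
apply/(smooth_coordP _ oA) => i; have [j ->|j ->] := split_ordP i.
  by rewrite (_ : (fun x => _) = fun x => f x 0 j)//; apply/funext => x; rewrite row_mxEl.
by rewrite (_ : (fun x => _) = fun x => g x 0 j)//; apply/funext => x; rewrite row_mxEr.
Qed.

Lemma norm_row_mx_le (R : realType) m n (a : 'rV[R]_m) (b : 'rV[R]_n) r :
  `|a| <= r -> `|b| <= r -> `|row_mx a b| <= r.
Proof.
move=> ar br; apply: norm_rV_le => [|i]; first exact: le_trans ar.
have [j ->|j ->] := split_ordP i; rewrite ?row_mxEl ?row_mxEr;
  by [apply: le_trans ar; exact: coord_le_norm|apply: le_trans br; exact: coord_le_norm].
Qed.

Lemma smooth_lsubmx_comp (R : realType) m n (f : 'rV[R]_m -> R) : smooth_on setT f ->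
  smooth_on setT (fun y : 'rV[R]_(m + n) => f (lsubmx y)).
Proof.
move=> sf; have ll : linear (@lsubmx R 1 m n) by move=> k x y; apply/rowP => j; rewrite !mxE.
exact: (@smooth_on_lin _ _ _ _ f (mklin ll) setT (linear_rV_continuous ll) sf).
Qed.

Section polynomial_expressions.
Context {R : realType} {T : Type}.
Variable C : (T -> R) -> Prop.
Hypothesis closedD : forall f g, C f -> C g -> C (fun y => f y + g y).
Hypothesis closedM : forall f g, C f -> C g -> C (fun y => f y * g y).
Hypothesis closedN : forall f, C f -> C (fun y => - f y).
Hypothesis closed_cst : forall k, C (fun=> k).

(** C stands for smoothness as well as for continuity. *)
Lemma closed_det_bordered (H : T -> 'I_3 -> 'I_3 -> R) (v : T -> 'rV[R]_3) :
  (forall i j, C (fun y => H y i j)) -> (forall j, C (fun y => v y 0 j)) ->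
  C (fun y => det_sym (H y) * bordered (H y) (v y)).
Proof.
move=> cH cv; rewrite /det_sym /bordered /dot3 /adj_sym.
under eq_fun do rewrite row3_0 row3_1 row3_2 !expr2.
by repeat (first [exact: cH|exact: cv|exact: closed_cst
  |apply: closedD|apply: closedN|apply: closedM]).
Qed.

End polynomial_expressions.

Section degenerate.
Context {R : realType}.
Local Notation space_time := 'rV[R]_(3 + 1).
Implicit Types (u w : space_time -> R) (x : space_time) (a : 'rV[R]_3) (b s lam : R).

Definition space_dir (i : 'I_3) : space_time := delta_mx 0 (lshift 1 i).
Local Notation X x i := (x 0 (lshift 1 i)).

Definition space_hess u w lam x (i j : 'I_3) : R :=
  'D_(space_dir i) ('D_(space_dir j) u) x + lam * 'D_(space_dir i) ('D_(space_dir j) w) x.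

Definition space_grad w x : 'rV[R]_3 := \row_j 'D_(space_dir j) w x.

(** These are six equations on the five unknowns x and lam, so that a generic
    pair (u, w) has no solution. *)
Definition degenerate_zero u w lam x : Prop :=
  [/\ u x = 0, w x = 0,
      forall i, 'D_(space_dir i) u x + lam * 'D_(space_dir i) w x = 0
    & det_sym (space_hess u w lam x) * bordered (space_hess u w lam x) (space_grad w x) = 0].

Definition dot_space a x : R := a 0 i0 * (X x i0) + a 0 i1 * (X x i1) + a 0 i2 * (X x i2).

(** The same s occurs in the perturbation quad of u and in the perturbation affine
    of w: it adds s to the diagonal of the Hessian and s e_0 to the gradient of w,
    which makes the last equation of a degenerate zero monic in s. *)
Definition quad b a s x : R :=
  b + dot_space a x + s * ((X x i0) ^+ 2 + (X x i1) ^+ 2 + (X x i2) ^+ 2) / 2.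

Definition affine b s x : R := b + s * (X x i0).

Lemma smooth_quad b a s : smooth_on setT (quad b a s).
Proof.
have oT : open [set: space_time] by exact: openT.
by rewrite /quad /dot_space; smooth_auto.
Qed.

Lemma smooth_affine b s : smooth_on setT (affine b s).
Proof.
have oT : open [set: space_time] by exact: openT.
by rewrite /affine; smooth_auto.
Qed.

Lemma derive_quad b a s i x : 'D_(space_dir i) (quad b a s) x = a 0 i + s * (X x i).
Proof.
apply: (@derive_expansion _ _ _ _ _ _ (s / 2)) => h.
rewrite /quad /dot_space !mxE /=.
rewrite !(inj_eq (@lshift_inj _ _)).
by move: i; apply: I3P => /=; field.
Qed.

Lemma derive_affine_form b s i x : 'D_(space_dir i) (affine b s) x = s * (i == i0)%:R.
Proof.
apply: (@derive_expansion _ _ _ _ _ _ 0) => h.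
by rewrite /affine !mxE eqxx /= (inj_eq (@lshift_inj _ _)) eq_sym; ring.
Qed.

Lemma derive_add_at u v i x : smooth_on setT u -> smooth_on setT v ->
  'D_(space_dir i) (fun x => u x + v x) x = 'D_(space_dir i) u x + 'D_(space_dir i) v x.
Proof.
move=> su sv.
exact: (derive_addr _ (smooth_on_differentiable su I) (smooth_on_differentiable sv I)).
Qed.

Lemma derive_add_fun u v i : smooth_on setT u -> smooth_on setT v ->
  'D_(space_dir i) (fun x => u x + v x) = fun x => 'D_(space_dir i) u x + 'D_(space_dir i) v x.
Proof. by move=> su sv; apply/funext => x; exact: derive_add_at. Qed.

Lemma derive2_quad b a s i j x :
  'D_(space_dir i) ('D_(space_dir j) (quad b a s)) x = s * (i == j)%:R.
Proof.
have -> : 'D_(space_dir j) (quad b a s) = fun x => a 0 j + s * (X x j).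
  by apply/funext => z; exact: derive_quad.
apply: (@derive_expansion _ _ _ _ _ _ 0) => h.
by rewrite !mxE eqxx /= (inj_eq (@lshift_inj _ _)) eq_sym; ring.
Qed.

Lemma derive2_affine b s i j x :
  'D_(space_dir i) ('D_(space_dir j) (affine b s)) x = 0.
Proof.
have -> : 'D_(space_dir j) (affine b s) = cst (s * (j == i0)%:R).
  by apply/funext => z; exact: derive_affine_form.
by rewrite derive_cst.
Qed.

Section shifted.
Variables (u w : space_time -> R).
Hypotheses (su : smooth_on setT u) (sw : smooth_on setT w).

Lemma space_hess_shift b0 a b s lam x i j :
  space_hess (fun x => u x + quad b0 a s x) (fun x => w x + affine b s x) lam x i j =
  shift_diag (space_hess u w lam x) s i j.
Proof.
have sq := smooth_quad b0 a s; have sa := smooth_affine b s.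
rewrite /space_hess /shift_diag (derive_add_fun j su sq) (derive_add_fun j sw sa).
set e := space_dir j; rewrite (derive_add_at i x (smooth_onD e su) (smooth_onD e sq)).
rewrite (derive_add_at i x (smooth_onD e sw) (smooth_onD e sa)) {}/e.
have add_shift (A B P Q k : R) : P = k -> Q = 0 -> A + P + lam * (B + Q) = A + lam * B + k.
  by move=> -> ->; rewrite addr0 addrAC.
exact: add_shift (derive2_quad b0 a s i j x) (derive2_affine b s i j x).
Qed.

Lemma space_grad_shift b s x :
  space_grad (fun x => w x + affine b s x) x = space_grad w x + s *: 'e_i0.
Proof.
apply/rowP => j; rewrite !mxE (derive_add_at j x sw (smooth_affine b s)).
by rewrite derive_affine_form eqxx.
Qed.

(** The parameters for which x is a degenerate zero with multiplier lam are
    determined by x, lam and s. *)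
Lemma degenerate_zero_shift b0 a b s lam x :
  degenerate_zero (fun x => u x + quad b0 a s x) (fun x => w x + affine b s x) lam x ->
  [/\ forall i, a 0 i = - ('D_(space_dir i) u x + lam * 'D_(space_dir i) w x)
        + s * - (X x i + lam * (i == i0)%:R),
      b = - w x + s * - X x i0,
      b0 = - u x + \sum_i ('D_(space_dir i) u x + lam * 'D_(space_dir i) w x) * X x i
        + s * (\sum_i (X x i + lam * (i == i0)%:R) * X x i
               - (X x i0 ^+ 2 + X x i1 ^+ 2 + X x i2 ^+ 2) / 2)
    & det_sym (shift_diag (space_hess u w lam x) s) *
      bordered (shift_diag (space_hess u w lam x) s) (space_grad w x + s *: 'e_i0) = 0].
Proof.
move=> [u0 w0 Du hb].
have sq := smooth_quad b0 a s; have sa := smooth_affine b s.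
have aE i : a 0 i = - ('D_(space_dir i) u x + lam * 'D_(space_dir i) w x)
        + s * - (X x i + lam * (i == i0)%:R).
  have := Du i; rewrite (derive_add_at i x su sq) (derive_add_at i x sw sa).
  rewrite derive_quad derive_affine_form.
  move: ('D_(space_dir i) u x) ('D_(space_dir i) w x) => A B; lra.
split=> //.
- by move: w0; rewrite /affine; lra.
- move: u0; rewrite /quad /dot_space !sum3 !aE /=.
  move: (u x) ('D_(space_dir i0) u x) ('D_(space_dir i1) u x) ('D_(space_dir i2) u x) => U U0 U1 U2.
  move: ('D_(space_dir i0) w x) ('D_(space_dir i1) w x) ('D_(space_dir i2) w x) => W0 W1 W2.
  move: (X x i0) (X x i1) (X x i2) => x0 x1 x2; lra.
have E : space_hess (fun x => u x + quad b0 a s x) (fun x => w x + affine b s x) lam x =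
    shift_diag (space_hess u w lam x) s.
  by apply/funext => i; apply/funext => j; exact: space_hess_shift.
by move: hb; rewrite E space_grad_shift.
Qed.

(** By degenerate_zero_shift the parameters to be avoided form a Lipschitz family
    indexed by (x, lam), and by few_singular_shifts a given (x, lam) matters for
    at most seven values of s. *)
Theorem remove_degenerate_zeros (r eps : R) : 0 < eps ->
  exists s b0 b a, [/\ `|s| < eps, `|b0| < eps, `|b| < eps, forall i, `|a 0 i| < eps &
    forall x lam, `|x| <= r -> `|lam| <= r ->
      ~ degenerate_zero (fun x => u x + quad b0 a s x) (fun x => w x + affine b s x) lam x].
Proof.
move=> eps0; pose T := 'rV[R]_((3 + 1) + 1).
pose l (y : T) := y 0 (rshift (3 + 1) 0).
have oT : open [set: T] by exact: openT.
have sl : smooth_on setT l by exact: smooth_coord.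
have sX i : smooth_on setT (fun y : T => X (lsubmx y) i).
  by apply: (@smooth_lsubmx_comp _ _ _ (fun x : space_time => X x i)); exact: smooth_coord.
have su' : smooth_on setT (fun y : T => u (lsubmx y)) by exact: smooth_lsubmx_comp.
have sw' : smooth_on setT (fun y : T => w (lsubmx y)) by exact: smooth_lsubmx_comp.
have sDu i : smooth_on setT (fun y : T => 'D_(space_dir i) u (lsubmx y)).
  by apply: (@smooth_lsubmx_comp _ _ _ ('D_(space_dir i) u)); exact: smooth_onD.
have sDw i : smooth_on setT (fun y : T => 'D_(space_dir i) w (lsubmx y)).
  by apply: (@smooth_lsubmx_comp _ _ _ ('D_(space_dir i) w)); exact: smooth_onD.
have sDDu i j : smooth_on setT (fun y : T => 'D_(space_dir i) ('D_(space_dir j) u) (lsubmx y)).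
  by apply: (@smooth_lsubmx_comp _ _ _ ('D_(space_dir i) ('D_(space_dir j) u))); do 2!apply: smooth_onD.
have sDDw i j : smooth_on setT (fun y : T => 'D_(space_dir i) ('D_(space_dir j) w) (lsubmx y)).
  by apply: (@smooth_lsubmx_comp _ _ _ ('D_(space_dir i) ('D_(space_dir j) w))); do 2!apply: smooth_onD.
pose al i y := 'D_(space_dir i) u (lsubmx y) + l y * 'D_(space_dir i) w (lsubmx y).
pose be i y := X (lsubmx y) i + l y * (i == i0)%:R.
have sal i : smooth_on setT (al i) by rewrite /al; smooth_auto.
have sbe i : smooth_on setT (be i) by rewrite /be; smooth_auto.
(* G s y = g0 y + s g1 y is the triple (a, b, b0) found in degenerate_zero_shift *)
pose g0 y : T := row_mx (row_mx (\row_i - al i y) (- w (lsubmx y))%:M)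
  (- u (lsubmx y) + \sum_i al i y * X (lsubmx y) i)%:M.
pose g1 y : T := row_mx (row_mx (\row_i - be i y) (- X (lsubmx y) i0)%:M)
  (\sum_i be i y * X (lsubmx y) i
    - (X (lsubmx y) i0 ^+ 2 + X (lsubmx y) i1 ^+ 2 + X (lsubmx y) i2 ^+ 2) / 2)%:M.
have smooth_scalar (f : T -> R) : smooth_on setT f ->
    smooth_on setT (fun y => (f y)%:M : 'rV[R]_1).
  move=> sf; apply/(smooth_coordP _ oT) => i; rewrite (_ : (fun y => _) = f)//.
  by apply/funext => y; rewrite (ord1 i) mxE eqxx mulr1n.
have smooth_rowf (f : 'I_3 -> T -> R) : (forall i, smooth_on setT (f i)) ->
    smooth_on setT (fun y => \row_i - f i y).
  move=> sf; apply/(smooth_coordP _ oT) => i; rewrite (_ : (fun y => _) = fun y => - f i y).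
    exact: smoothN.
  by apply/funext => y; rewrite mxE.
have sg0 : smooth_on setT g0.
  apply: smooth_row_mx => //; first apply: smooth_row_mx => //.
  - exact: smooth_rowf.
  - by apply: smooth_scalar; exact: smoothN.
  apply: smooth_scalar; apply: smoothD => //; first exact: smoothN.
  by apply: smooth_sum => // i; exact: smoothM.
have sg1 : smooth_on setT g1.
  apply: smooth_row_mx => //; first apply: smooth_row_mx => //.
  - exact: smooth_rowf.
  - by apply: smooth_scalar; exact: smoothN.
  apply: smooth_scalar; apply: smoothB => //.
    by apply: smooth_sum => // i; exact: smoothM.
  by smooth_auto.
have [L0 L00 hL0] := lipschitz_vector r sg0.
have [L1 L10 hL1] := lipschitz_vector r sg1.
pose G s y := g0 y + s *: g1 y.
have GL s y y' : 0 <= s <= 1 -> `|y| <= r -> `|y'| <= r ->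
    `|G s y - G s y'| <= (L0 + L1) * `|y - y'|.
  move=> /andP[s0 s1] yr yr'.
  have -> : G s y - G s y' = (g0 y - g0 y') + s *: (g1 y - g1 y').
    by rewrite /G scalerBr addrACA opprD.
  apply: le_trans (ler_normD _ _) _; rewrite normrZ ger0_norm// mulrDl.
  apply: lerD; first exact: hL0.
  apply: le_trans (hL1 y y' yr yr'); rewrite -[leRHS]mul1r.
  by rewrite ler_wpM2r.
pose q s y := det_sym (shift_diag (space_hess u w (l y) (lsubmx y)) s) *
      bordered (shift_diag (space_hess u w (l y) (lsubmx y)) s)
        (space_grad w (lsubmx y) + s *: 'e_i0).
have sH s i j : smooth_on setT (fun y : T => shift_diag (space_hess u w (l y) (lsubmx y)) s i j).
  by rewrite /shift_diag /space_hess; smooth_auto.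
have sv s j : smooth_on setT (fun y : T => (space_grad w (lsubmx y) + s *: 'e_i0) 0 j).
  rewrite (_ : (fun y => _) = fun y : T => 'D_(space_dir j) w (lsubmx y) + s * (j == i0)%:R).
    by smooth_auto.
  by apply/funext => y; rewrite !mxE eqxx.
have sq s : smooth_on setT (q s).
  apply: (closed_det_bordered (C := smooth_on setT)) => // [f g|f g|f|k].
  - exact: smoothD.
  - exact: smoothM.
  - exact: smoothN.
  - exact: smooth_cst.
pose bad s y := q s y = 0.
have bad_closed s : closed (bad s).
  apply: (closed_comp (D := [set z : R | z = 0])) => [y _|]; last exact: closed_eq.
  exact: (smooth_on_continuous (sq s) I).
have bad_few (y : T) J (s : 'I_J -> R) : `|y| <= r -> injective s ->
    (#|[set j | `[< bad (s j) y >]]%SET| <= 7)%N.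
  move=> _ sinj.
  apply: leq_trans (few_singular_shifts (space_hess u w (l y) (lsubmx y))
    (space_grad w (lsubmx y)) sinj); apply: subset_leq_card.
  by apply/fintype.subsetP => j; rewrite !finset.in_set => /asboolP/eqP.
have [s [a [se ae nbad]]] :=
  @avoid_lipschitz_family R _ r (L0 + L1) G bad 7 (addr_ge0 L00 L10) GL bad_closed bad_few eps eps0.
have ak k : `|a 0 k| < eps by exact: le_lt_trans (coord_le_norm _ _) ae.
exists s, (a 0 (rshift (3 + 1) 0)), (a 0 (lshift 1 (rshift 3 0))), (lsubmx (lsubmx a)).
split=> // [i|x lam xr lr]; first by rewrite !mxE.
move=> /degenerate_zero_shift[aE bE b0E qE].
pose y : T := row_mx x lam%:M.
have yx : lsubmx y = x by rewrite row_mxKl.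
have yl : l y = lam by rewrite /l row_mxEr mxE.
apply: (nbad y).
- apply: norm_row_mx_le => //; apply: norm_rV_le => [|i]; first exact: le_trans xr.
  by rewrite (ord1 i) mxE eqxx mulr1n.
- by rewrite /bad /q yx yl.
apply/rowP => k; rewrite [LHS]mxE [Z in _ + Z]mxE.
have [k1 ->|k1 ->] := split_ordP k; rewrite !(row_mxEl, row_mxEr) yx.
  have [k2 ->|k2 ->] := split_ordP k1; rewrite !(row_mxEl, row_mxEr).
    rewrite [Z in Z + _]mxE [Z in _ + _ * Z]mxE /al /be yx yl.
    by have := aE k2; rewrite !mxE => ->.
  by rewrite (ord1 k2) [Z in Z + _]mxE [Z in _ + _ * Z]mxE !mulr1n bE.
rewrite (ord1 k1) [Z in Z + _]mxE [Z in _ + _ * Z]mxE !mulr1n b0E /al /be yx yl.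
by [].
Qed.

End shifted.

End degenerate.

(** * Zeros at a fixed time *)

Section fixed_time.
Context {R : realType}.
Local Notation space_time := 'rV[R]_(3 + 1).
Implicit Types (Psi : space_time -> R * R) (u w : space_time -> R).

Definition embed (t : R) (p : 'rV[R]_3) : space_time := row_mx p t%:M.

Lemma embed_linear : linear (fun p : 'rV[R]_3 => row_mx p 0 : space_time).
Proof. by move=> k p q; rewrite scale_row_mx add_row_mx scaler0 addr0. Qed.

Lemma embedE t p : embed t p = row_mx p 0 + row_mx 0 t%:M.
Proof. by rewrite add_row_mx addr0 add0r. Qed.

Lemma derive_embed u t i : 'D_'e_i (fun p => u (embed t p)) = fun p => 'D_(space_dir i) u (embed t p).
Proof.
apply/funext => p.
have := @derive_affine _ _ _ _ u (mklin embed_linear) (row_mx 0 t%:M) 'e_i p.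
rewrite /= -embedE (_ : row_mx 'e_i 0 = space_dir i); last first.
  apply/rowP => j; have [k ->|k ->] := split_ordP j; rewrite ?row_mxEl ?row_mxEr !mxE.
    by rewrite (inj_eq (@lshift_inj _ _)).
  by rewrite eq_rlshift andbF.
move=> <-; congr (derive _ _ _); apply/funext => q; exact/congr1/embedE.
Qed.

Lemma smooth_at_time Psi t : smooth_on setT Psi -> smooth_on setT (at_time Psi t).
Proof.
move=> sP; have := @smooth_on_affine _ _ _ _ setT Psi (mklin embed_linear) (row_mx 0 t%:M)
  (linear_rV_continuous embed_linear) sP.
by congr (smooth_on _ _); apply/funext => p; rewrite /at_time -embedE.
Qed.

Lemma derive_scaled_add u w lam i : smooth_on setT u -> smooth_on setT w ->
  'D_(space_dir i) (fun x => u x + lam * w x) =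
  fun x => 'D_(space_dir i) u x + lam * 'D_(space_dir i) w x.
Proof.
move=> su sw; have oT : open [set: space_time] by exact: openT.
have sl : smooth_on setT (fun x => lam * w x) by apply: smoothM => //; exact: smooth_cst.
rewrite (derive_add_fun i su sl); apply/funext => x; congr (_ + _).
have dw := smooth_on_differentiable sw (I : setT x).
rewrite (derive_mulr (space_dir i) (differentiable_cst lam x) dw) derive_cst.
by rewrite mulr0 addr0.
Qed.

Lemma nondegenerate_at_time Psi t p : smooth_on setT Psi -> at_time Psi t p = 0 ->
  (forall c lam, ~ degenerate_zero (fun x => comp c (Psi x)) (fun x => comp (~~ c) (Psi x))
    lam (embed t p)) ->
  nondegenerate (at_time Psi t) p.
Proof.
move=> sP P0 nd c lam; set u := fun x => comp c (Psi x); set w := fun x => comp (~~ c) (Psi x).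
have su : smooth_on setT u by exact: smooth_component.
have sw : smooth_on setT w by exact: smooth_component.
have cE : combination (at_time Psi t) c lam = fun p => (fun x => u x + lam * w x) (embed t p) by [].
have DE i : 'D_'e_i (combination (at_time Psi t) c lam) =
    fun p => (fun x => 'D_(space_dir i) u x + lam * 'D_(space_dir i) w x) (embed t p).
  rewrite cE (derive_embed (fun x => u x + lam * w x) t i); apply/funext => q.
  exact: (congr1 (fun F : space_time -> R => F (embed t q)) (derive_scaled_add lam i su sw)).
have HE : hess (combination (at_time Psi t) c lam) p = space_hess u w lam (embed t p).
  apply/funext => i; apply/funext => j; rewrite /hess DE.
  pose U x := 'D_(space_dir j) u x + lam * 'D_(space_dir j) w x.
  apply: (etrans (congr1 (fun F : 'rV[R]_3 -> R => F p) (derive_embed U t i))).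
  exact: (congr1 (fun F : space_time -> R => F (embed t p))
    (derive_scaled_add lam i (smooth_onD (space_dir j) su) (smooth_onD (space_dir j) sw))).
have GE : grad (fun p => comp (~~ c) (at_time Psi t p)) p = space_grad w (embed t p).
  apply/rowP => j; rewrite !mxE.
  exact: (congr1 (fun F : 'rV[R]_3 -> R => F p) (derive_embed w t j)).
move=> g0; rewrite HE GE; apply/eqP => h0; apply: (nd c lam); split=> //.
- by rewrite /u -/(at_time Psi t p) P0; case: (c).
- by rewrite /w -/(at_time Psi t p) P0; case: (c).
- move=> i; have := congr1 (fun g : 'rV[R]_3 => g 0 i) g0; rewrite !mxE => <-.
  exact: (esym (congr1 (fun F : 'rV[R]_3 -> R => F p) (DE i))).
Qed.

End fixed_time.

(** * Openness of the nondegeneracy condition *)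

Section jets.
Context {R : realType}.
Local Notation space_time := 'rV[R]_(3 + 1).

Lemma enum_space_time :
  enum 'I_(3 + 1) = [:: lshift 1 i0; lshift 1 i1; lshift 1 i2; rshift 3 (0 : 'I_1)].
Proof. by apply: (inj_map val_inj); rewrite val_enum_ord. Qed.

(** The jet contains an iterated derivative only with its directions in
    increasing order. *)
Lemma jet_entry (b : 'I_(3 + 1) -> nat) : (\sum_l b l <= 2)%N ->
  exists k : 'I_#|{: multi_index (3 + 1) 2}|,
  forall (W : normedModType R) (f : space_time -> W) x, (jet 2 f x).2 0 k =
    iter_derive (nseq (b (lshift 1 i0)) (space_dir i0) ++ nseq (b (lshift 1 i1)) (space_dir i1)
      ++ nseq (b (lshift 1 i2)) (space_dir i2)
      ++ nseq (b (rshift 3 0)) (delta_mx 0 (rshift 3 0)) ++ [::]) f x.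
Proof.
move=> b2; have bl l : (b l < 3)%N by apply: leq_trans b2; rewrite (bigD1 l)//= leq_addr.
pose a : {ffun 'I_(3 + 1) -> 'I_3} := [ffun l => inord (b l)].
have aE l : a l = b l :> nat by rewrite ffunE inordK.
have a2 : (\sum_(l < 3 + 1) a l <= 2)%N by under eq_bigr do rewrite aE.
exists (enum_rank (exist _ a a2 : multi_index (3 + 1) 2)) => W f x.
by rewrite mxE enum_rankK /partial enum_space_time /= !aE.
Qed.

End jets.

Section open_condition.
Context {R : realType}.
Local Notation space_time := 'rV[R]_(3 + 1).
Local Notation jets2 := (jet_space R (3 + 1) (R * R)%type 2).

Lemma derive_comp_component (Psi : space_time -> R * R) c v : smooth_on setT Psi ->
  'D_v (fun x => comp c (Psi x)) = fun x => comp c ('D_v Psi x).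
Proof.
move=> sP; apply/funext => x; pose l := mklin (@comp_linear R c).
have cl : continuous l by exact/linear_pair_continuous/comp_linear.
have dP : differentiable Psi x by exact: smooth_on_differentiable sP I.
have dl : differentiable l (Psi x) by exact: linear_differentiable.
rewrite (deriveE v dP) (deriveE (f := l \o Psi) v); last exact: differentiable_comp.
by rewrite (diff_comp dP dl) /= (diff_lin _ cl).
Qed.

Lemma entry_continuous (T : topologicalType) N (k : 'I_N) :
  continuous (fun M : 'rV[T]_N => M 0 k).
Proof.
move=> M P MP; exists (fun i j => [set z | j = k -> P z]).
  move=> i j; rewrite (ord1 i); have [->|jk] := eqVneq j k.
    by apply: filterS MP => z Pz _.
  by apply: filterE => z /= jk'; rewrite jk' eqxx in jk.
by move=> N' /(_ 0 k); apply.
Qed.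

Section degeneracy_continuous.
Context {T : topologicalType}.
Implicit Types f g : T -> R.

Lemma add_cont f g : continuous f -> continuous g -> continuous (fun x => f x + g x).
Proof. by move=> cf cg x; apply: cvgD; [exact: cf|exact: cg]. Qed.

Lemma mul_cont f g : continuous f -> continuous g -> continuous (fun x => f x * g x).
Proof. by move=> cf cg x; apply: cvgM; [exact: cf|exact: cg]. Qed.

Lemma opp_cont f : continuous f -> continuous (fun x => - f x).
Proof. by move=> cf x; apply: cvgN; exact: cf. Qed.

Lemma sqr_cont f : continuous f -> continuous (fun x => f x ^+ 2).
Proof.
move=> cf; rewrite (_ : (fun x => _) = fun x => f x * f x); first exact: mul_cont.
by apply/funext => x; exact: expr2.
Qed.

Lemma cst_cont (k : R) : continuous (fun _ : T => k).
Proof. by move=> x; exact: cvg_cst. Qed.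

End degeneracy_continuous.

(** A continuous function of the 2-jet and of the multiplier which vanishes
    precisely at degenerate zeros. *)
Definition degeneracy c lam (J0 : R * R) (J1 : 'I_3 -> R * R) (J2 : 'I_3 -> 'I_3 -> R * R) : R :=
  let lin z := comp c z + lam * comp (~~ c) z in
  let H i j := lin (J2 i j) in
  comp c J0 ^+ 2 + comp (~~ c) J0 ^+ 2 +
  (lin (J1 i0) ^+ 2 + lin (J1 i1) ^+ 2 + lin (J1 i2) ^+ 2) +
  (det_sym H * bordered H (\row_j comp (~~ c) (J1 j))) ^+ 2.

Lemma degeneracy_ext c lam J0 (J1 J1' : 'I_3 -> R * R) (J2 J2' : 'I_3 -> 'I_3 -> R * R) :
  (forall i, J1 i = J1' i) -> (forall i j : 'I_3, (i <= j)%N -> J2 i j = J2' i j) ->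
  degeneracy c lam J0 J1 J2 = degeneracy c lam J0 J1' J2'.
Proof.
move=> /funext -> e2; rewrite /degeneracy /bordered /dot3 /adj_sym /det_sym.
by rewrite !row3_0 !row3_1 !row3_2 !(e2 i0) ?(e2 i1)// (e2 i2).
Qed.

Lemma degeneracy_continuous (T : topologicalType) c (lam : T -> R) (J0 : T -> R * R) J1 J2 :
  continuous lam -> continuous J0 -> (forall i, continuous (J1 i)) ->
  (forall i j, continuous (J2 i j)) ->
  continuous (fun q => degeneracy c (lam q) (J0 q) (J1^~ q) (fun i j => J2 i j q)).
Proof.
move=> clam c0 c1 c2.
have cc (b : bool) (J : T -> R * R) : continuous J -> continuous (fun q => comp b (J q)).
  move=> cJ q; apply: (cvg_comp J (comp b) (cJ q)).
  exact: (linear_pair_continuous (@comp_linear R b)).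
have cc0 b := cc b J0 c0; have cc1 b i := cc b _ (c1 i); have cc2 b i j := cc b _ (c2 i j).
pose lin (J : T -> R * R) q := comp c (J q) + lam q * comp (~~ c) (J q).
have clin J : continuous J -> continuous (lin J).
  by move=> cJ; apply: add_cont; [exact: cc|apply: mul_cont => //; exact: cc].
have c1l i := sqr_cont (clin _ (c1 i)).
rewrite /degeneracy; apply: add_cont; first apply: add_cont.
- by apply: add_cont; apply: sqr_cont.
- apply: add_cont; last exact: c1l i2.
  by apply: add_cont; [exact: c1l i0|exact: c1l i1].
apply: sqr_cont; apply: (@closed_det_bordered _ _ (fun f : T -> R => continuous f)).
- exact: add_cont.
- exact: mul_cont.
- exact: opp_cont.
- exact: cst_cont.
- by move=> i j; exact: clin (c2 i j).
move=> j.
rewrite (_ : (fun q => _) = fun q => comp (~~ c) (J1 j q)); first exact: cc1.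
by apply/funext => q; rewrite mxE.
Qed.

Lemma sum_sqr_eq0 (a b x y z d : R) :
  a ^+ 2 + b ^+ 2 + (x ^+ 2 + y ^+ 2 + z ^+ 2) + d ^+ 2 = 0 <->
  [/\ a = 0, b = 0, [/\ x = 0, y = 0 & z = 0] & d = 0].
Proof.
split=> [s0|[-> -> [-> -> ->] ->]]; last by ring.
have sq0 (t : R) : t ^+ 2 = 0 -> t = 0 by move=> /eqP; rewrite sqrf_eq0 => /eqP.
have := sqr_ge0 a; have := sqr_ge0 b; have := sqr_ge0 x; have := sqr_ge0 y.
have := sqr_ge0 z; have := sqr_ge0 d => *.
by split; [| |split|]; apply: sq0; lra.
Qed.

Lemma degeneracy_eq0 (Psi : space_time -> R * R) c lam x : smooth_on setT Psi ->
  degeneracy c lam (Psi x) (fun i => 'D_(space_dir i) Psi x)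
    (fun i j => 'D_(space_dir i) ('D_(space_dir j) Psi) x) = 0 <->
  degenerate_zero (fun x => comp c (Psi x)) (fun x => comp (~~ c) (Psi x)) lam x.
Proof.
move=> sP; have D1 b j := derive_comp_component b (space_dir j) sP.
have D2 b i j := derive_comp_component b (space_dir i) (smooth_onD (space_dir j) sP).
rewrite /degenerate_zero /degeneracy.
have -> : space_hess (fun x => comp c (Psi x)) (fun x => comp (~~ c) (Psi x)) lam x =
    fun i j => comp c ('D_(space_dir i) ('D_(space_dir j) Psi) x) +
      lam * comp (~~ c) ('D_(space_dir i) ('D_(space_dir j) Psi) x).
  have e b i j : 'D_(space_dir i) ('D_(space_dir j) (fun x => comp b (Psi x))) x =
      comp b ('D_(space_dir i) ('D_(space_dir j) Psi) x).
    by rewrite D1; exact: (congr1 (fun F : space_time -> R => F x) (D2 b i j)).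
  apply/funext => i; apply/funext => j.
  exact: (congr2 (fun a b => a + lam * b) (e c i j) (e (~~ c) i j)).
have -> : space_grad (fun x => comp (~~ c) (Psi x)) x =
    \row_j comp (~~ c) ('D_(space_dir j) Psi x).
  by apply/rowP => j; rewrite !mxE; exact: (congr1 (fun F : space_time -> R => F x) (D1 _ j)).
have E i : 'D_(space_dir i) (fun x => comp c (Psi x)) x +
      lam * 'D_(space_dir i) (fun x => comp (~~ c) (Psi x)) x =
    comp c ('D_(space_dir i) Psi x) + lam * comp (~~ c) ('D_(space_dir i) Psi x).
  have e b := congr1 (fun F : space_time -> R => F x) (D1 b i).
  exact: (congr2 (fun a b => a + lam * b) (e c) (e (~~ c))).
set d := det_sym _ * _; clearbody d.
rewrite sum_sqr_eq0; split=> [[h0 h1 [h2 h3 h4] h5]|[h0 h1 h2 h5]].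
  have hl : forall i, comp c ('D_(space_dir i) Psi x) + lam * comp (~~ c) ('D_(space_dir i) Psi x) = 0.
    by apply: I3P; [exact: h2|exact: h3|exact: h4].
  exact: And4 h0 h1 (fun i => etrans (E i) (hl i)) h5.
have hl i := etrans (esym (E i)) (h2 i).
exact: And4 h0 h1 (And3 (hl i0) (hl i1) (hl i2)) h5.
Qed.

Lemma jet2_entries : exists (k0 : 'I_#|{: multi_index (3 + 1) 2}|) k1 k2,
  forall (Psi : space_time -> R * R) x,
  [/\ (jet 2 Psi x).2 0 k0 = Psi x,
      forall i : 'I_3, (jet 2 Psi x).2 0 (k1 i) = 'D_(space_dir i) Psi x
    & forall i j : 'I_3, (i <= j)%N ->
      (jet 2 Psi x).2 0 (k2 i j) = 'D_(space_dir i) ('D_(space_dir j) Psi) x].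
Proof.
have [k0 h0] : exists k0 : 'I_#|{: multi_index (3 + 1) 2}|,
    forall (Psi : space_time -> R * R) x, (jet 2 Psi x).2 0 k0 = Psi x.
  have [|k hk] := @jet_entry R (fun=> 0%N); first by rewrite big1.
  by exists k => Psi x; rewrite hk.
have s1 (l : 'I_(3 + 1)) : (\sum_(m < 3 + 1) (m == l) = 1)%N.
  by rewrite (bigD1 l)//= eqxx big1 ?addn0// => m /negbTE ->.
have /choice[k1 h1] (i : 'I_3) : exists k : 'I_#|{: multi_index (3 + 1) 2}|,
    forall (Psi : space_time -> R * R) x, (jet 2 Psi x).2 0 k = 'D_(space_dir i) Psi x.
  have [|k hk] := @jet_entry R (fun l => (l == lshift 1 i) : nat); first by rewrite s1.
  exists k => Psi x; rewrite hk !(inj_eq (@lshift_inj _ _)) eq_rlshift.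
  by move: i {hk}; apply: I3P.
have /choice[k2 h2] (p : 'I_3 * 'I_3) : exists k : 'I_#|{: multi_index (3 + 1) 2}|,
    forall (Psi : space_time -> R * R) x, (p.1 <= p.2)%N ->
      (jet 2 Psi x).2 0 k = 'D_(space_dir p.1) ('D_(space_dir p.2) Psi) x.
  have [|k hk] := @jet_entry R (fun l => (l == lshift 1 p.1) + (l == lshift 1 p.2))%N.
    by rewrite big_split /= !s1.
  exists k => Psi x; rewrite hk !(inj_eq (@lshift_inj _ _)) !eq_rlshift.
  move: p {hk} => [i j] /=; move: i j.
  by do 2!apply: I3P => /=; first [move=> h; discriminate h|move=> _; reflexivity].
exists k0, k1, (fun i j => k2 (i, j)) => Psi x; split=> // i j ij.
exact: (h2 (i, j)).
Qed.

Definition avoids_degeneracy (c : bool) (r : R) : set (smooth_map (3 + 1) (R * R)%type) :=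
  [set Psi | forall x lam, `|x| <= r -> `|lam| <= r ->
    ~ degenerate_zero (fun x => comp c (Psi x)) (fun x => comp (~~ c) (Psi x)) lam x].

(** The condition only concerns 2-jets; it is open there because the multiplier
    ranges over a compact interval. *)
Lemma open_avoids_degeneracy c r : open (avoids_degeneracy c r).
Proof.
have [k0 [k1 [k2 kE]]] := jet2_entries.
pose Q (lam : R) (p : jets2) := degeneracy c lam (p.2 0 k0) (fun i => p.2 0 (k1 i))
  (fun i j => p.2 0 (k2 i j)).
have QE (Psi : smooth_map (3 + 1) (R * R)%type) lam x : Q lam (jet 2 Psi x) = 0 <->
    degenerate_zero (fun x => comp c (Psi x)) (fun x => comp (~~ c) (Psi x)) lam x.
  have sP : smooth_on setT Psi by case: Psi.
  rewrite -(degeneracy_eq0 c lam x sP) /Q; have [-> E1 E2] := kE Psi x.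
  suff -> : degeneracy c lam (Psi x) (fun i => (jet 2 Psi x).2 0 (k1 i))
      (fun i j => (jet 2 Psi x).2 0 (k2 i j)) =
    degeneracy c lam (Psi x) (fun i => 'D_(space_dir i) Psi x)
      (fun i j => 'D_(space_dir i) ('D_(space_dir j) Psi) x) by [].
  exact: degeneracy_ext.
have cQ : continuous (fun q : R * jets2 => Q q.1 q.2).
  have ce k : continuous (fun q : R * jets2 => q.2.2 0 k).
    move=> q P /entry_continuous nP.
    exists (setT, [set p : jets2 | P (p.2 0 k)]) => [|[y p] [] //].
    split; first exact: filterT.
    rewrite /=; exists (setT, [set M : 'rV[R * R]_#|{: multi_index (3 + 1) 2}| | P (M 0 k)]) => [|[y M] [] //].
    by split; [exact: filterT|exact: nP].
  by apply: degeneracy_continuous => // q; exact: cvg_fst.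
pose L : set R := `[- r, r]%classic.
pose O : set jets2 := [set p | r < `|p.1| \/ forall lam, L lam -> Q lam p <> 0].
have oO : open O.
  rewrite openE => p [rp|Lp].
    have n1 : \forall p' \near p, r < `|p'.1|.
      have cn : {for p, continuous (fun p' : jets2 => `|p'.1|)}.
        by apply: cvg_norm; exact: cvg_fst.
      exact: cn _ (open_near (@open_gt R r) rp).
    by apply: filterS n1 => p' rp'; left.
  have /compact_near_coveringP cov := @segment_compact R (- r) r.
  have n2 : \forall p' \near p, L `<=` (fun lam => Q lam p' <> 0).
    apply: (cov jets2 (nbhs p) (fun p' lam => Q lam p' <> 0) (nbhs_filter _)) => lam Llam.
    have o0 : open [set z : R | z <> 0].
      rewrite (_ : [set z : R | z <> 0] = [set z | z != 0]); first exact: open_neq.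
      by apply/funext => z /=; apply/propext; split=> /eqP.
    exact: (cQ (lam, p) _ (open_near o0 (Lp _ Llam))).
  by apply: filterS n2 => p' Lp'; right.
move=> Psi hPsi; exists [set f : smooth_map (3 + 1) (R * R)%type | forall x, O (jet 2 f x)].
split.
- by exists 2%N, O.
- move=> x /=; have [xr|xr] := leP `|x| r; last by left.
  right=> lam; rewrite /L /= in_itv /= -ler_norml => lr /QE; exact: hPsi.
- move=> f hf x lam xr lr /QE q0; case: (hf x) => /= [|h].
    by rewrite ltNge xr.
  by apply: (h lam) => //; rewrite /L /= in_itv /= -ler_norml.
Qed.

End open_condition.

(** * Density of the nondegeneracy condition *)

Section density.
Context {R : realType}.
Local Notation space_time := 'rV[R]_(3 + 1).
Local Notation X x i := (x 0 (lshift 1 i)).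

Lemma degenerate_zero_local (A : set space_time) (u u' w w' : space_time -> R) lam x :
  open A -> A x -> (forall y, A y -> u y = u' y) -> (forall y, A y -> w y = w' y) ->
  degenerate_zero u w lam x -> degenerate_zero u' w' lam x.
Proof.
move=> oA Ax uu ww.
have D1 (f g : space_time -> R) v : (forall y, A y -> f y = g y) ->
    forall y, A y -> 'D_v f y = 'D_v g y.
  move=> fg y Ay; apply: near_eq_derive; exact: filterS (open_near oA Ay).
have Du v := D1 _ _ v uu; have Dw v := D1 _ _ v ww.
have eH : space_hess u w lam x = space_hess u' w' lam x.
  apply/funext => i; apply/funext => j.
  exact: (congr2 (fun a b => a + lam * b) (D1 _ _ (space_dir i) (Du (space_dir j)) x Ax)
    (D1 _ _ (space_dir i) (Dw (space_dir j)) x Ax)).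
have eG : space_grad w x = space_grad w' x.
  by apply/rowP => j; rewrite !mxE; exact: (Dw (space_dir j) x Ax).
rewrite /degenerate_zero eH eG => -[u0 w0 d0 q0]; split=> [| |i|].
- by rewrite -uu.
- by rewrite -ww.
- exact: etrans (esym (congr2 (fun a b => a + lam * b) (Du (space_dir i) x Ax)
    (Dw (space_dir i) x Ax))) (d0 i).
- exact: q0.
Qed.

Definition unit_component (c : bool) : R * R := if c then (1, 0) else (0, 1).

Lemma comp_pair c (a b : R) :
  comp c (a *: unit_component c + b *: unit_component (~~ c)) = a /\
  comp (~~ c) (a *: unit_component c + b *: unit_component (~~ c)) = b.
Proof.
by case: c; rewrite /comp /unit_component /= /GRing.scale /= !(mulr0, mulr1, addr0, add0r).
Qed.

(** The coefficients (a, b0, b, s) enter linearly, so that quad and affine are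
    combinations of these fixed functions. *)
Definition quad_monomial (j : 'I_6) : space_time -> R := nth (fun=> 0)
  [:: (fun x => X x i0); (fun x => X x i1); (fun x => X x i2); (fun=> 1); (fun=> 0);
      (fun x => (X x i0 ^+ 2 + X x i1 ^+ 2 + X x i2 ^+ 2) / 2)] j.

Definition affine_monomial (j : 'I_6) : space_time -> R := nth (fun=> 0)
  [:: (fun=> 0); (fun=> 0); (fun=> 0); (fun=> 0); (fun=> 1); (fun x => X x i0)] j.

Definition coefficients (a : 'rV[R]_3) (b0 b s : R) : 'rV[R]_6 :=
  \row_j nth 0 [:: a 0 i0; a 0 i1; a 0 i2; b0; b; s] j.

Lemma sum_quad_monomial a b0 b s x :
  \sum_j coefficients a b0 b s 0 j * quad_monomial j x = quad b0 a s x.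
Proof.
by rewrite !big_ord_recr big_ord0 /= !mxE /quad_monomial /= /quad /dot_space; ring.
Qed.

Lemma sum_affine_monomial a b0 b s x :
  \sum_j coefficients a b0 b s 0 j * affine_monomial j x = affine b s x.
Proof.
by rewrite !big_ord_recr big_ord0 /= !mxE /affine_monomial /= /affine; ring.
Qed.

Lemma smooth_monomial (j : 'I_6) :
  smooth_on setT (quad_monomial j) /\ smooth_on setT (affine_monomial j).
Proof.
have oT : open [set: space_time] by exact: openT.
by case: j => [[|[|[|[|[|[|j]]]]]] j6] //; split;
  rewrite /quad_monomial /affine_monomial /=; smooth_auto.
Qed.

(** The perturbation is cut off by a function equal to 1 near the ball, where it
    thus keeps the derivatives of quad and affine. *)
Lemma dense_avoids_degeneracy c (r : R) : dense (avoids_degeneracy c r).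
Proof.
move=> O [f Of] oO.
have [B [[k [U [oU BE]]] Bf BO]] := oO f Of.
have sf : smooth_on setT f by case: (f).
have oT : open [set: space_time] by exact: openT.
have rr : 0 <= `|r| by [].
have [chi [r' [A [schi chi0 oA rA chi1]]]] := @bump R (3 + 1) `|r| rr.
pose h j x : R * R := (chi x * quad_monomial j x) *: unit_component c +
  (chi x * affine_monomial j x) *: unit_component (~~ c).
have smooth_scale (g : space_time -> R) (z : R * R) : smooth_on setT g ->
    smooth_on setT (fun x => g x *: z).
  have lz : linear (fun t : R => t *: z) by move=> a t t'; rewrite scalerDl scalerA.
  move=> sg; apply: (@smooth_comp_lin _ _ _ _ g (mklin lz)) => // t.
  exact: scalel_continuous.
have sh j : smooth_on setT (h j).
  have [sq sa] := smooth_monomial j.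
  by apply: smoothD => //; apply: smooth_scale; apply: smoothM.
have h0 j x : r' < `|x| -> h j x = 0.
  by move=> /chi0 xE; rewrite /h xE !mul0r !scale0r addr0.
have Uf x : U (jet k f x) by move: Bf; rewrite BE; exact.
have [e e0 he] := small_perturbation oU sf sh h0 Uf.
pose u x := comp c (f x); pose w x := comp (~~ c) (f x).
have su : smooth_on setT u by exact: smooth_component.
have sw : smooth_on setT w by exact: smooth_component.
have e2 : 0 < e / 2 by rewrite divr_gt0.
have [s [b0 [b [a [se b0e be ae nd]]]]] := remove_degenerate_zeros su sw r e2.
pose al := coefficients a b0 b s.
have ale : `|al| < e.
  apply: (@le_lt_trans _ _ (e / 2)); last by rewrite ltr_pdivrMr// ltr_pMr// ltr1n.
  apply: norm_rV_le => [|j]; first exact: ltW.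
  by rewrite mxE; case: j => [[|[|[|[|[|[|j]]]]]] j6] //=; apply: ltW.
pose g := SmoothMap (smooth_perturb al sf sh).
exists g; split.
  by apply: BO; rewrite BE => x; exact: he.
have gE b' x : comp b' (g x) = comp b' (f x) + \sum_j al 0 j * comp b' (h j x).
  rewrite /= /perturb.
  rewrite -[comp b']/(mklin (@comp_linear R b') : _ -> _).
  by rewrite linearD linear_sum; congr (_ + _); apply: eq_bigr => j _; rewrite linearZ.
move=> x lam xr lr dg.
have xr' : `|x| <= `|r| by apply: le_trans xr (ler_norm r).
apply: (nd x lam xr lr); apply: degenerate_zero_local oA (rA x xr') _ _ dg => y Ay.
  rewrite gE; congr (_ + _); rewrite -(sum_quad_monomial a b0 b s y).
  by apply: eq_bigr => j _; have [-> _] := comp_pair c (chi y * quad_monomial j y) (chi y * affine_monomial j y); rewrite chi1// mul1r.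
rewrite gE; congr (_ + _); rewrite -(sum_affine_monomial a b0 b s y).
by apply: eq_bigr => j _; have [_ ->] := comp_pair c (chi y * quad_monomial j y) (chi y * affine_monomial j y); rewrite chi1// mul1r.
Qed.

End density.

Theorem theorem4p1 (R : realType) :
  generically (fun Psi : smooth_map (3 + 1) (R * R)%type =>
    forall (p0 : 'rV[R]_3) (t0 : R), at_time Psi t0 p0 = 0 ->
      [\/ radially_equivalent (at_time Psi t0) p0 regular_form,
          radially_equivalent (at_time Psi t0) p0 definite_hyperbolic_form,
          radially_equivalent (at_time Psi t0) p0 definite_elliptic_form
        | radially_equivalent (at_time Psi t0) p0 indefinite_form]).
Proof.
(* n encodes a component, by its parity, and the radius n./2 *)
pose U (n : nat) := @avoids_degeneracy R (odd n) (n./2)%:R.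
exists (\bigcap_n U n).
  exists U; split=> // n.
  by split; [exact: open_avoids_degeneracy|exact: dense_avoids_degeneracy].
move=> Psi UPsi p0 t0 P0.
have sP : smooth_on setT Psi by case: (Psi).
apply: classification => //; first exact: smooth_at_time.
apply: nondegenerate_at_time => // c lam.
pose n := (Num.truncn (`|embed t0 p0| + `|lam|)).+1.
have nE : `|embed t0 p0| + `|lam| <= n%:R by exact/ltW/truncnS_gt.
have := UPsi (c + n.*2)%N I; rewrite /U oddD odd_double addbF oddb.
rewrite (_ : (c + n.*2)./2 = n); last by rewrite half_bit_double.
move=> /(_ (embed t0 p0) lam); apply.
  by apply: le_trans nE; rewrite lerDl.
by apply: le_trans nE; rewrite lerDr.
Qed.
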